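(* Let $(\vec U^{m+1},P^{m+1},\vec X^{m+1},\kappa^{m+1})\in\mathbb{U}^m\times\mathbb{P}^m\times[V^h(\Gamma^m)]^d\times V^h(\Gamma^m)$, $m=0,\ldots,M-1$, be a solution of the fitted (nonconservative ALE) scheme (A1)--(A4) defined in the context, with $\Gamma^{m+1}=\vec X^{m+1}(\Gamma^m)$. Write $\mathcal{E}(\rho,\vec U,\Gamma)=\tfrac12\Vert\sqrt{\rho}\,\vec U\Vert^2+\gamma|\Gamma|$, where $\Vert\cdot\Vert$ is the $L^2(\Omega)$-norm and $|\Gamma|=\mathscr{H}^{d-1}(\Gamma)$. Then for every $k=0,1,\ldots,M-1$ $$\mathcal{E}(\rho^k,\vec U^{k+1},\Gamma^{k+1})+2\Delta t\sum_{m=0}^k\Vert\sqrt{\mu^m}\,\mathbb{D}(\vec U^{m+1})\Vert^2\le\mathcal{E}(\rho^0,\vec U^0,\Gamma^0)+\Delta t\sum_{m=0}^k(\rho^m\vec g,\vec U^{m+1}).$$ Moreover, for every $m=0,\ldots,M-1$: if $\mathscr{X}_{\Omega_-^m}-\omega^m\in\mathbb{P}^m$, where $\omega^m=\operatorname{vol}(\Omega_-^m)/\operatorname{vol}(\Omega)$ and $\mathscr{X}_E$ denotes the characteristic function of $E$, then $$\operatorname{vol}(\Omega_-^{m+1})=\operatorname{vol}(\Omega_-^m).$$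
   Context: **Setting.** $d\in\{2,3\}$; $\Omega\subset\mathbb{R}^d$ is a bounded (polytopal) domain with outer unit normal $\vec n$, and $\partial\Omega=\partial_1\Omega\cup\partial_2\Omega$ with $\partial_1\Omega\cap\partial_2\Omega=\emptyset$. $\rho_\pm,\mu_\pm,\gamma>0$ are constants, $\vec g\in[L^2(\Omega)]^d$ is given, $T>0$, $M\in\mathbb{N}$, $\Delta t=T/M$, $t_m=m\Delta t$. $(\cdot,\cdot)$ is the $L^2$-inner product over $\Omega$ (of scalars, vectors or matrices), with induced norm $\Vert\cdot\Vert$; $\mathbb{D}(\vec u)=\tfrac12(\nabla\vec u+(\nabla\vec u)^T)$. Set $$\mathbb{U}=\{\vec\varphi\in[H^1(\Omega)]^d:\vec\varphi=\vec 0\text{ on }\partial_1\Omega,\ \vec\varphi\cdot\vec n=0\text{ on }\partial_2\Omega\},\qquad \mathbb{P}=\{\eta\in L^2(\Omega):(\eta,1)=0\},$$ $$\mathscr{A}(\rho,\vec v;\vec u,\vec\chi)=\tfrac12\left[(\rho(\vec v\cdot\nabla)\vec u,\vec\chi)-(\rho(\vec v\cdot\nabla)\vec\chi,\vec u)\right].$$ **Interface.** For each $m$, $\Gamma^m=\bigcup_{j=1}^{J_\Gamma}\overline{\sigma_j^m}\subset\Omega$ is a closed $(d-1)$-dimensional polyhedral surface made of mutually disjoint nondegenerate $(d-1)$-simplices $\sigma_j^m$ with vertices $\vec q^m_{j_0},\ldots,\vec q^m_{j_{d-1}}$ (consistently ordered; the vertices of $\Gamma^m$ are $\{\vec q^m_k\}_{k=1}^{K_\Gamma}$).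 $\Omega_-^m$ is the interior of $\Gamma^m$ and $\Omega_+^m$ its exterior in $\Omega$. $V^h(\Gamma^m)$ is the space of continuous functions on $\Gamma^m$ that are affine on each $\sigma_j^m$. The orientation vector of $\sigma_j^m$ is $\vec A\{\sigma_j^m\}=(\vec q^m_{j_1}-\vec q^m_{j_0})\wedge\cdots\wedge(\vec q^m_{j_{d-1}}-\vec q^m_{j_0})$ (the cross product if $d=3$; a fixed rotation by $90^\circ$ of $\vec q^m_{j_1}-\vec q^m_{j_0}$ if $d=2$), so $|\sigma_j^m|=\frac1{(d-1)!}|\vec A\{\sigma_j^m\}|$. The unit normal is $\vec\nu^m|_{\sigma_j^m}=\vec A\{\sigma_j^m\}/|\vec A\{\sigma_j^m\}|$, and orientations are such that $\vec\nu^m$ points into $\Omega_+^m$ for every $m$. For piecewise continuous $u,v$ on $\Gamma^m$, $$\langle u,v\rangle_{\Gamma^m}=\int_{\Gamma^m}u\cdot v\,d\mathscr{H}^{d-1},\qquad \langle u,v\rangle^h_{\Gamma^m}=\frac1d\sum_{j=1}^{J_\Gamma}|\sigma_j^m|\sum_{k=0}^{d-1}\lim_{\sigma_j^m\ni\vec p\to\vec q^m_{j_k}}(u\cdot v)(\vec p).$$ $\nabla_s$ is the (elementwise) surface gradient on $\Gamma^m$ and $\vec{\mathrm{id}}$ is the identity map. Given $\vec X^{m+1}\in[V^h(\Gamma^m)]^d$, set $\Gamma^{m+1}=\vec X^{m+1}(\Gamma^m)$, with vertices $\vec q^{m+1}_k=\vec X^{m+1}(\vec q^m_k)$. For $t\in[t_m,t_{m+1}]$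 let $\sigma_j^h(t)$ be the simplex with vertices $\frac{t_{m+1}-t}{\Delta t}\vec q^m_{j_k}+\frac{t-t_m}{\Delta t}\vec q^{m+1}_{j_k}$, $k=0,\dots,d-1$, and define the time-weighted normal $$\vec\nu^{m+\frac12}|_{\sigma_j^m}=\frac{1}{\Delta t\,|\vec A\{\sigma_j^m\}|}\int_{t_m}^{t_{m+1}}\vec A\{\sigma_j^h(t)\}\,dt .$$ **Bulk mesh (fitted).** For each $m$, $\mathscr{T}^m=\{o_j^m\}_{j=1}^{J_\Omega}$ is a regular partition of $\overline\Omega$ into mutually disjoint open simplices with vertices $\{\vec a_k^m\}_{k=1}^{K_\Omega}$; connectivity and topology do not change with $m$. The mesh is fitted: every $\sigma_j^m$ is a face of elements of $\mathscr{T}^m$, so each element lies in $\Omega_-^m$ or in $\Omega_+^m$. $S_k^m$ ($k\ge1$) is the space of continuous functions on $\overline\Omega$ that are polynomials of degree at most $k$ on each $o_j^m$; $S_0^m$ is the space of functions constant on each $o_j^m$. The velocity/pressure spaces are $\mathbb{U}^m=[S_2^m]^d\cap\mathbb{U}$ and $\mathbb{P}^m$ equal to one of $S_1^m\cap\mathbb{P}$, $S_0^m\cap\mathbb{P}$, $(S_1^m+S_0^m)\cap\mathbb{P}$, or $\operatorname{span}(S_1^m\cup\{\mathscr{X}_{\Omega_-^m}\})\cap\mathbb{P}$. Put $\rho^m=\rho_-\mathscr{X}_{\Omega_-^m}+\rho_+\mathscr{X}_{\Omega_+^m}$ and $\mu^m=\mu_-\mathscr{X}_{\Omega_-^m}+\mu_+\mathscr{X}_{\Omega_+^m}$.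 **Mesh motion and discrete ALE maps.** For $m\ge1$, given $\Gamma^m=\vec X^m(\Gamma^{m-1})$, the mesh $\mathscr{T}^m$ is obtained from $\mathscr{T}^{m-1}$ by $\vec a_k^m=\vec a_k^{m-1}+\vec\psi^m(\vec a_k^{m-1})$, where $\vec\psi^m\in\mathbb{Y}^{m-1}=\{\vec\chi\in[S_1^{m-1}]^d:\vec\chi\cdot\vec n=0\text{ on }\partial\Omega,\ \vec\chi=\vec X^m-\vec{\mathrm{id}}\text{ on }\Gamma^{m-1}\}$ satisfies $$2(\lambda^{m-1}\mathbb{D}(\vec\psi^m),\mathbb{D}(\vec\chi))+(\lambda^{m-1}\nabla\cdot\vec\psi^m,\nabla\cdot\vec\chi)=0$$ for all $\vec\chi\in[S_1^{m-1}]^d$ with $\vec\chi\cdot\vec n=0$ on $\partial\Omega$ and $\vec\chi=\vec 0$ on $\Gamma^{m-1}$, with $\lambda^{m-1}|_{o_j^{m-1}}=1+\frac{\max_{o\in\mathscr{T}^{m-1}}|o|-\min_{o\in\mathscr{T}^{m-1}}|o|}{|o_j^{m-1}|}$. The discrete mesh velocity is $\vec W^m=\sum_{k=1}^{K_\Omega}\frac{\vec a_k^m-\vec a_k^{m-1}}{\Delta t}\phi_k^m\in[S_1^m]^d$, with $\phi_k^m$ the nodal basis function of $S_1^m$ at $\vec a_k^m$. The ALE map is $\vec{\mathcal A}^m[t]=\vec{\mathrm{id}}-(t_m-t)\vec W^m$ for $t\in[t_{m-1},t_m]$; thus $\vec{\mathcal A}^m[t_{m-1}]=\vec{\mathrm{id}}-\Delta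 t\,\vec W^m$ is elementwise affine, maps $\vec a_k^m$ to $\vec a_k^{m-1}$, and $\vec{\mathcal A}^m[t_{m-1}](\Omega_\pm^m)=\Omega_\pm^{m-1}$. Its Jacobian determinant is $\mathcal{J}^m=\det(\nabla\vec{\mathcal A}^m[t_{m-1}])\in S_0^m$. It is assumed throughout that the moved meshes remain valid regular partitions, so that $\vec{\mathcal A}^m[t_{m-1}]$ is a bijection of $\overline\Omega$ with $\mathcal{J}^m>0$. For $m=0$: $\Gamma^{-1}=\Gamma^0$, $\Omega_\pm^{-1}=\Omega_\pm^0$, $\rho^{-1}=\rho^0$, $\vec W^0=\vec0$, $\vec{\mathcal A}^0[t_{-1}]=\vec{\mathrm{id}}$, $\mathcal{J}^0=1$. **Scheme.** Given $\Gamma^0$, a fitted mesh $\mathscr{T}^0$ and $\vec U^0\in\mathbb{U}^0$, for $m\ge0$ find $\vec U^{m+1}\in\mathbb{U}^m$, $P^{m+1}\in\mathbb{P}^m$, $\vec X^{m+1}\in[V^h(\Gamma^m)]^d$, $\kappa^{m+1}\in V^h(\Gamma^m)$ such that (A1) for all $\vec\chi^h\in\mathbb{U}^m$: $$\Big(\rho^m\tfrac{\vec U^{m+1}-\vec U^m\circ\vec{\mathcal A}^m[t_{m-1}]\sqrt{\mathcal{J}^m}}{\Delta t},\vec\chi^h\Big)+\mathscr{A}(\rho^m,\vec U^m\circ\vec{\mathcal A}^m[t_{m-1}]-\vec W^m;\vec U^{m+1},\vec\chi^h)+2(\mu^m\mathbb{D}(\vec U^{m+1}),\mathbb{D}(\vec\chi^h))-(P^{m+1},\nabla\cdot\vec\chi^h)-\gamma\langle\kappa^{m+1}\vec\nu^m,\vec\chi^h\rangle_{\Gamma^m}=(\rho^m\vec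 g,\vec\chi^h);$$ (A2) $(\nabla\cdot\vec U^{m+1},q^h)=0$ for all $q^h\in\mathbb{P}^m$; (A3) $\big\langle\frac{\vec X^{m+1}-\vec{\mathrm{id}}}{\Delta t}\cdot\vec\nu^{m+\frac12},\varphi^h\big\rangle^h_{\Gamma^m}-\langle\vec U^{m+1}\cdot\vec\nu^m,\varphi^h\rangle_{\Gamma^m}=0$ for all $\varphi^h\in V^h(\Gamma^m)$; (A4) $\langle\kappa^{m+1}\vec\nu^{m+\frac12},\vec\zeta^h\rangle^h_{\Gamma^m}+\langle\nabla_s\vec X^{m+1},\nabla_s\vec\zeta^h\rangle_{\Gamma^m}=0$ for all $\vec\zeta^h\in[V^h(\Gamma^m)]^d$; then set $\Gamma^{m+1}=\vec X^{m+1}(\Gamma^m)$; construct $\mathscr{T}^{m+1}$ from $\mathscr{T}^m$ by moving the vertices according to $\vec a_k^{m+1}=\vec a_k^m+\vec\psi^{m+1}(\vec a_k^m)$, $1\le k\le K_\Omega$, where $\vec\psi^{m+1}\in[S_1^m]^d$ with $\vec\psi^{m+1}\cdot\vec n=0$ on $\partial\Omega$ and $\vec\psi^{m+1}=\vec X^{m+1}-\vec{\mathrm{id}}$ on $\Gamma^m$ solves $2(\lambda^m\mathbb{D}(\vec\psi^{m+1}),\mathbb{D}(\vec\chi))+(\lambda^m\nabla\cdot\vec\psi^{m+1},\nabla\cdot\vec\chi)=0$ for all $\vec\chi\in[S_1^m]^d$ with $\vec\chi\cdot\vec n=0$ on $\partial\Omega$ and $\vec\chi=\vec 0$ on $\Gamma^m$,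 with $\lambda^m|_{o_j^m}=1+\frac{\max_{o\in\mathscr{T}^m}|o|-\min_{o\in\mathscr{T}^m}|o|}{|o_j^m|}$; and set $\vec W^{m+1}=\sum_{k=1}^{K_\Omega}\frac{\vec a_k^{m+1}-\vec a_k^m}{\Delta t}\phi_k^{m+1}\in[S_1^{m+1}]^d$, with $\phi_k^{m+1}$ the nodal basis function of $S_1^{m+1}$ at $\vec a_k^{m+1}$. *)

(* Defs.v *)
(* The space R^d is ['rV[R]_d], with [d = n.+1].  Functions on (the closure of)
   Omega or on the interface are total functions on R^d; only their values
   there matter. *)
From HB Require Import structures.
From mathcomp Require Import all_boot all_order all_algebra.
From mathcomp Require Import all_classical all_reals all_analysis.
Set Implicit Arguments.
Unset Strict Implicit.
Unset Printing Implicit Defensive.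
Import Order.TTheory GRing.Theory Num.Theory.
Import numFieldNormedType.Exports.
Local Open Scope classical_set_scope.
Local Open Scope ring_scope.

(* [lebesgue_tuple n] below is the n-fold product of the one-dimensional Lebesgue
   measure, on the product sigma-algebra of [n.-tuple R]. *)
Section LebesgueRn.
Context {R : realType}.
Local Notation RT := (measurableTypeR R).

Definition tcons n (p : RT * n.-tuple RT) : n.+1.-tuple RT :=
  [tuple of p.1 :: p.2].

Lemma measurable_tcons n : measurable_fun setT (@tcons n).
Proof. by apply: measurable_cons. Qed.

HB.instance Definition _ n :=
  isMeasurableFun.Build _ _ _ _ (@tcons n) (@measurable_tcons n).

Section step.
Context {n : nat} (mu : {sigma_finite_measure set (n.-tuple RT) -> \bar R}).

Definition lebesgue_cons : set (n.+1.-tuple RT) -> \bar R :=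
  pushforward (lebesgue_measure \x mu)%E (@tcons n).

Let lebesgue_cons0 : lebesgue_cons set0 = 0%E.
Proof. exact: measure0. Qed.

Let lebesgue_cons_ge0 A : (0 <= lebesgue_cons A)%E.
Proof. exact: measure_ge0. Qed.

Let lebesgue_cons_sigma_additive : semi_sigma_additive lebesgue_cons.
Proof. exact: measure_semi_sigma_additive. Qed.

HB.instance Definition _ := isMeasure.Build _ _ _ lebesgue_cons
  lebesgue_cons0 lebesgue_cons_ge0 lebesgue_cons_sigma_additive.

Let sigma_finite_lebesgue_cons : sigma_finite setT lebesgue_cons.
Proof.
have /sigma_finiteP[F1 [TF1 ndF1 F1oo]] := sigma_finiteT (@lebesgue_measure R).
have /sigma_finiteP[F2 [TF2 ndF2 F2oo]] := sigma_finiteT mu.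
exists (fun k => @tcons n @` (F1 k `*` F2 k)).
  apply/seteqP; split => // t _; rewrite (tuple_eta t).
  have [k1 _ Fk1] : (\bigcup_k F1 k) (thead t) by rewrite -TF1.
  have [k2 _ Fk2] : (\bigcup_k F2 k) [tuple of behead t] by rewrite -TF2.
  exists (maxn k1 k2) => //; exists (thead t, [tuple of behead t]) => //.
  split => /=; first by move: Fk1; exact/subsetPset/ndF1/leq_maxl.
  by move: Fk2; exact/subsetPset/ndF2/leq_maxr.
have tconsI : injective (@tcons n).
  move=> [x t] [y u] /(congr1 val) /= [-> tu].
  by congr pair; exact: val_inj.
move=> k; have [mF1 F1k] := F1oo k; have [mF2 F2k] := F2oo k; split.
  rewrite (_ : _ @` _ = [set t : n.+1.-tuple RT | F1 k (thead t)] `&`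
                        [set t : n.+1.-tuple RT | F2 k [tuple of behead t]]); last first.
    apply/seteqP; split => [_ [[x t] [/= Fx Ft] <-]|t [/= Fx Ft]].
      split => /=; first by rewrite theadE.
      by move: Ft; congr (F2 k _); exact: val_inj.
    exists (thead t, [tuple of behead t]) => //.
    by rewrite /tcons/= -tuple_eta.
  apply: measurableI.
    by rewrite -[X in measurable X]setTI; exact: (measurable_tnth ord0).
  by rewrite -[X in measurable X]setTI; exact: measurable_behead.
rewrite /lebesgue_cons /pushforward.
rewrite (_ : _ @^-1` _ = F1 k `*` F2 k); last first.
  by apply/seteqP; split => [p [q Fq /tconsI <-]//|p Fp]; exists p.
by rewrite product_measure1E// lte_mul_pinfty// ge0_fin_numE.
Qed.

HB.instance Definition _ :=
  Measure_isSigmaFinite.Build _ _ _ lebesgue_cons sigma_finite_lebesgue_cons.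

End step.

Fixpoint lebesgue_tuple (n : nat) :
    {sigma_finite_measure set (n.-tuple RT) -> \bar R} :=
  match n with
  | 0 => dirac [tuple] : {sigma_finite_measure set (0.-tuple RT) -> \bar R}
  | m.+1 => lebesgue_cons (lebesgue_tuple m)
  end.


Definition pt n (t : n.-tuple RT) : 'rV[R]_n := \row_i tnth t i.

Definition int_Rn n (E : set 'rV[R]_n) (f : 'rV[R]_n -> R) : R :=
  \int[lebesgue_tuple n]_(t in pt (n := n) @^-1` E) f (pt t).

Definition vol n (E : set 'rV[R]_n) : R :=
  fine (lebesgue_tuple n (pt (n := n) @^-1` E)).

(* Square-integrable functions, through Borel representatives. *)
Definition L2 n (E : set 'rV[R]_n) (f : 'rV[R]_n -> R) : Prop :=
  measurable_fun (pt (n := n) @^-1` E) (f \o @pt n) /\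
  (\int[lebesgue_tuple n]_(t in pt (n := n) @^-1` E) ((f (pt t)) ^+ 2)%:E
     < +oo)%E.

End LebesgueRn.

Section InnerProducts.
Context {R : realType}.

(* Euclidean inner product of vectors, Frobenius product of matrices. *)
Definition dot p q (A B : 'M[R]_(p, q)) : R := \sum_i \sum_j A i j * B i j.

Definition enorm p q (A : 'M[R]_(p, q)) : R := Num.sqrt (dot A A).

Definition ips n (Om : set 'rV[R]_n) (f g : 'rV[R]_n -> R) : R :=
  int_Rn Om (fun x => f x * g x).

Definition ip n p q (Om : set 'rV[R]_n) (f g : 'rV[R]_n -> 'M[R]_(p, q)) : R :=
  int_Rn Om (fun x => dot (f x) (g x)).

Definition L2norm n p q (Om : set 'rV[R]_n) (f : 'rV[R]_n -> 'M[R]_(p, q)) : R :=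
  Num.sqrt (ip Om f f).

End InnerProducts.

Section Sobolev.
Context {R : realType} {d : nat}.
Local Notation V := 'rV[R]_d.

Fixpoint Ck (k : nat) (f : V -> R) : Prop :=
  match k with
  | 0 => continuous f
  | k'.+1 => continuous f /\
      forall v : V, (forall x, derivable f x v) /\ Ck k' (fun x => 'D_v f x)
  end.

Definition test_function (Om : set V) (f : V -> R) : Prop :=
  (forall k, Ck k f) /\
  exists K : set V, [/\ compact K, K `<=` Om & forall x, ~ K x -> f x = 0].

Definition weak_partial (Om : set V) (u : V -> R) (i : 'I_d) (g : V -> R) :=
  forall f, test_function Om f ->
    ips Om u (fun x => 'D_(delta_mx 0 i) f x) = - ips Om g f.

Definition H1 (Om : set V) (u : V -> R) : Prop :=
  L2 Om u /\ forall i, exists g, L2 Om g /\ weak_partial Om u i g.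

End Sobolev.

Section Simplices.
Context {R : realType} {d : nat}.
Local Notation V := 'rV[R]_d.

Definition csimplex p (q : 'I_p -> V) : set V :=
  [set x | exists c : 'I_p -> R,
    [/\ forall i, 0 <= c i, \sum_i c i = 1 & x = \sum_i c i *: q i]].

(* The open simplex, relative to its affine hull. *)
Definition osimplex p (q : 'I_p -> V) : set V :=
  [set x | exists c : 'I_p -> R,
    [/\ forall i, 0 < c i, \sum_i c i = 1 & x = \sum_i c i *: q i]].

Definition edges p (q : 'I_p.+1 -> V) : 'M[R]_(p, d) :=
  \matrix_(i, l) (q (lift ord0 i) - q ord0) 0 l.

Definition nondegenerate p (q : 'I_p.+1 -> V) : bool := row_free (edges q).

(* Simplicial connectivity: [simp j] lists the vertex labels of the j-th
   simplex, in order.  The vertex positions are kept separate, because they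
   move while the connectivity does not. *)
Record connectivity (p : nat) := Connectivity {
  nvert : nat;
  nsimp : nat;
  simp : 'I_nsimp -> 'I_p -> 'I_nvert }.

Definition corners p (C : connectivity p) (a : 'I_(nvert C) -> V)
  (j : 'I_(nsimp C)) : 'I_p -> V := fun i => a (simp j i).

Definition carrier p (C : connectivity p) (a : 'I_(nvert C) -> V) : set V :=
  \bigcup_(j in [set: 'I_(nsimp C)]) csimplex (corners a j).

(* [f] coincides on [E] with a polynomial of total degree at most [k]. *)
Definition poly_on (k : nat) (E : set V) (f : V -> R) : Prop :=
  exists c : {ffun 'I_d -> 'I_k.+1} -> R, forall x, E x ->
    f x = \sum_(al : {ffun 'I_d -> 'I_k.+1} | (\sum_i al i <= k)%N)
            c al * \prod_i x 0 i ^+ al i.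

End Simplices.

Section Domain.
Context {R : realType} {d : nat}.
Local Notation V := 'rV[R]_d.

Definition polytopal_domain (Om : set V) : Prop :=
  [/\ open Om, connected Om, Om !=set0, bounded_set Om &
      exists (C : connectivity d.+1) (a : 'I_(nvert C) -> V),
        (forall j, nondegenerate (corners a j)) /\ Om = (carrier a)°].

Definition bdry (Om : set V) : set V := closure Om `\` Om.

(* The outer unit normal at [x]: near [x], Omega is the half-space below the
   hyperplane through [x] orthogonal to [nu].  On the boundary of a polytopal
   domain it exists exactly in the relative interior of the facets. *)
Definition outer_normal (Om : set V) (x nu : V) : Prop :=
  enorm nu = 1 /\ \forall y \near x, Om y <-> dot (y - x) nu < 0.

Definition no_normal_flux (Om B : set V) (u : V -> V) : Prop :=
  forall x nu, B x -> outer_normal Om x nu -> dot (u x) nu = 0.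

(* The velocity space; it is only used for functions that are continuous on
   the closure of Omega, whose boundary trace is their restriction. *)
Definition in_U (Om d1 d2 : set V) (u : V -> V) : Prop :=
  [/\ forall i, H1 Om (fun x => u x 0 i),
      forall x, d1 x -> u x = 0 &
      no_normal_flux Om d2 u].

Definition in_P (Om : set V) (p : V -> R) : Prop :=
  L2 Om p /\ ips Om p (fun=> 1) = 0.

End Domain.

Section BulkMesh.
Context {R : realType} {d : nat}.
Local Notation V := 'rV[R]_d.
Variables (Om : set V) (C : connectivity d.+1) (a : 'I_(nvert C) -> V).

Definition regular_partition : Prop :=
  [/\ injective a,
      forall k, exists j i, k = simp (c := C) j i,
      forall j, nondegenerate (corners a j),
      closure Om = carrier a &
      (forall j j', j != j' ->
         osimplex (corners a j) `&` osimplex (corners a j') = set0) /\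
      (* two closed elements meet in the hull of their common vertices *)
      (forall j j' x, csimplex (corners a j) x -> csimplex (corners a j') x ->
         exists c : 'I_(nvert C) -> R,
           [/\ forall k, 0 <= c k, \sum_k c k = 1, x = \sum_k c k *: a k &
               forall k, c k != 0 ->
                 (exists i, k = simp j i) /\ (exists i, k = simp j' i)])].

Definition Sk (k : nat) (f : V -> R) : Prop :=
  {within closure Om, continuous f} /\
  forall j, poly_on k (osimplex (corners a j)) f.

Definition Sk0 (f : V -> R) : Prop :=
  forall j, exists c, forall x, osimplex (corners a j) x -> f x = c.

Definition Svec (k : nat) (u : V -> V) : Prop :=
  forall i, Sk k (fun x => u x 0 i).

Definition open_elements : set V :=
  \bigcup_(j in [set: 'I_(nsimp C)]) osimplex (corners a j).

(* Elementwise gradient, with entry (i, l) the l-th partial derivative of the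
   i-th component.  For functions in [Sk k] it is the weak gradient; it is set
   to 0 on the mesh skeleton, a null set. *)
Definition grad (u : V -> V) (x : V) : 'M[R]_d :=
  \1_open_elements x *:
    \matrix_(i, l) 'D_(delta_mx 0 l) (fun y => u y 0 i) x.

Definition div (u : V -> V) (x : V) : R := \tr (grad u x).

Definition symgrad (u : V -> V) (x : V) : 'M[R]_d :=
  2^-1 *: (grad u x + (grad u x)^T).

(* (v . nabla) u *)
Definition conv (v u : V -> V) (x : V) : V := v x *m (grad u x)^T.

Definition antisym_conv (rho : V -> R) (v u chi : V -> V) : R :=
  2^-1 * (ip Om (fun x => rho x *: conv v u x) chi
          - ip Om (fun x => rho x *: conv v chi x) u).

Definition elem_vol (j : 'I_(nsimp C)) : R := vol (osimplex (corners a j)).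

Definition max_vol : R := \big[Num.max/0]_j elem_vol j.
Definition min_vol : R := \big[Num.min/max_vol]_j elem_vol j.

Definition lambda (x : V) : R :=
  \sum_j (1 + (max_vol - min_vol) / elem_vol j) * \1_(osimplex (corners a j)) x.

Definition nodal_basis (phi : 'I_(nvert C) -> V -> R) : Prop :=
  forall k, Sk 1 (phi k) /\ forall l, phi k (a l) = (k == l)%:R.

End BulkMesh.

Section Surface.
Context {R : realType} {n : nat}.
Local Notation V := 'rV[R]_n.+1.

(* Generalised cross product of the n edge vectors in R^(n+1): for n = 2 the
   usual cross product, for n = 1 the rotation (e1, e2) |-> (e2, - e1). *)
Definition orient (q : 'I_n.+1 -> V) : V :=
  \row_i \det (col_mx (delta_mx 0 i : V) (edges q) : 'M[R]_n.+1).

Definition simp_area (q : 'I_n.+1 -> V) : R := enorm (orient q) / n`!%:R.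

Definition unit_normal (q : 'I_n.+1 -> V) : V :=
  (enorm (orient q))^-1 *: orient q.

(* The simplex at time t between the corners q at tm and q' at tm' = tm + dt. *)
Definition moving_corners (tm tm' dt : R) (q q' : 'I_n.+1 -> V) (t : R) :
    'I_n.+1 -> V :=
  fun k => ((tm' - t) / dt) *: q k + ((t - tm) / dt) *: q' k.

Definition weighted_normal (tm tm' dt : R) (q q' : 'I_n.+1 -> V) : V :=
  (dt * enorm (orient q))^-1 *:
    \row_i \int[lebesgue_measure]_(t in `[tm, tm'])
             orient (moving_corners tm tm' dt q q' t) 0 i.

Definition ref_simplex : set 'rV[R]_n :=
  [set s | (forall i, 0 < s 0 i) /\ \sum_i s 0 i < 1].

Definition sgrad_scalar (q : 'I_n.+1 -> V) (f : V -> R) (x : V) : V :=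
  let E := edges q in
  (\row_k 'D_(row k E) f x) *m invmx (E *m E^T) *m E.

(* Surface gradient on the simplex [q]; it only involves derivatives of [f] in
   directions tangent to the simplex. *)
Definition sgrad (q : 'I_n.+1 -> V) (u : V -> V) (x : V) : 'M[R]_n.+1 :=
  \matrix_(i, l) sgrad_scalar q (fun y => u y 0 i) x 0 l.

Variables (C : connectivity n.+1) (q : 'I_(nvert C) -> V).

(* Each simplex has vertices numbered 0..n; the facet opposite to vertex i
   belongs to exactly one other simplex (the surface has no boundary). *)
Definition closed_surface : Prop :=
  [/\ injective q,
      forall k, exists j i, k = simp (c := C) j i,
      forall j, nondegenerate (corners q j),
      forall j j', j != j' ->
        osimplex (corners q j) `&` osimplex (corners q j') = set0 &
      forall (j : 'I_(nsimp C)) (i : 'I_n.+1),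
        exists! j' : 'I_(nsimp C), j' != j /\
          forall i', i' != i -> exists i'', simp j' i'' = simp j i'].

Definition Vh (f : V -> R) : Prop :=
  {within carrier q, continuous f} /\
  forall j, poly_on 1 (osimplex (corners q j)) f.

Definition Vhvec (u : V -> V) : Prop := forall i, Vh (fun x => u x 0 i).

(* Piecewise functions on the surface are families [w] indexed by its
   simplices.  The surface integral is computed in the affine parametrisation
   of each simplex by the reference simplex, whose area element is the norm of
   [orient]. *)
Definition int_surf (w : 'I_(nsimp C) -> V -> R) : R :=
  \sum_j enorm (orient (corners q j)) *
    int_Rn ref_simplex
      (fun s => w j (corners q j ord0 + s *m edges (corners q j))).

Definition int_lumped (w : 'I_(nsimp C) -> V -> R) : R :=
  n.+1%:R^-1 * \sum_j simp_area (corners q j) *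
    \sum_k lim (w j @ within (osimplex (corners q j)) (nbhs (corners q j k))).

Definition area : R := int_surf (fun _ _ => 1).

(* Points outside the surface that it separates from infinity. *)
Definition enclosed : set V :=
  [set x | ~ carrier q x /\
     bounded_set (connected_component (~` carrier q) x)].

Variable Om : set V.

Definition Om_minus : set V := Om `&` enclosed.
Definition Om_plus : set V := Om `\` (carrier q `|` enclosed).

Definition phase (cm cp : R) (x : V) : R :=
  cm * \1_Om_minus x + cp * \1_Om_plus x.

Definition oriented : Prop :=
  forall j x, osimplex (corners q j) x ->
    \forall e \near 0^'+,
      Om_plus (x + e *: unit_normal (corners q j)) /\
      Om_minus (x - e *: unit_normal (corners q j)).

Variables (B : connectivity n.+2) (a : 'I_(nvert B) -> V).

Definition fitted : Prop :=
  forall j, exists (e : 'I_(nsimp B)) (f : 'I_n.+1 -> 'I_n.+2),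
    forall i, corners q j i = corners a e (f i).

Definition mesh_displacement (X psi : V -> V) : Prop :=
  [/\ Svec Om a 1 psi,
      no_normal_flux Om (bdry Om) psi,
      forall x, carrier q x -> psi x = X x - x &
      forall chi : V -> V, Svec Om a 1 chi -> no_normal_flux Om (bdry Om) chi ->
        (forall x, carrier q x -> chi x = 0) ->
        2 * ip Om (fun x => lambda a x *: symgrad a psi x) (symgrad a chi)
        + ips Om (fun x => lambda a x * div a psi x) (div a chi) = 0].

End Surface.

Inductive pressure_kind := PressS1 | PressS0 | PressS1S0 | PressS1chi.

Definition in_Pm {R : realType} {n : nat} (pk : pressure_kind)
    (Om : set 'rV[R]_n.+1)
    (B : connectivity n.+2) (a : 'I_(nvert B) -> 'rV[R]_n.+1)
    (C : connectivity n.+1) (q : 'I_(nvert C) -> 'rV[R]_n.+1)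
    (p : 'rV[R]_n.+1 -> R) : Prop :=
  in_P Om p /\
  match pk with
  | PressS1 => Sk Om a 1 p
  | PressS0 => Sk0 a p
  | PressS1S0 => exists p1 p0, [/\ Sk Om a 1 p1, Sk0 a p0 &
      forall x, Om x -> p x = p1 x + p0 x]
  | PressS1chi => exists p1 c, Sk Om a 1 p1 /\
      forall x, Om x -> p x = p1 x + c * \1_(Om_minus q Om) x
  end.

Section Scheme.
Context {R : realType} {n : nat}.
Local Notation V := 'rV[R]_n.+1.

Record problem := Problem {
  Om : set V;
  bd1 : set V;
  bd2 : set V;
  rho_minus : R;
  rho_plus : R;
  mu_minus : R;
  mu_plus : R;
  gamma : R;
  grav : V -> V;
  Tend : R;
  nstep : nat }.

Definition admissible (D : problem) : Prop :=
  [/\ polytopal_domain (Om D),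
      bdry (Om D) = bd1 D `|` bd2 D /\ bd1 D `&` bd2 D = set0,
      [/\ 0 < rho_minus D, 0 < rho_plus D, 0 < mu_minus D, 0 < mu_plus D &
          0 < gamma D],
      forall i, L2 (Om D) (fun x => grav D x 0 i) &
      0 < Tend D].

(* The sequences U^m ([vel]), P^m ([pres]), X^m ([defo]), kappa^m ([curv]) and
   W^m ([mvel]), indexed by the time level m; [pos m] and [spos m] are the
   vertices a_k^m of the bulk mesh and q_k^m of the interface.  [pres], [defo]
   and [curv] are only used for m >= 1. *)
Record discrete := Discrete {
  bulk : connectivity n.+2;
  surf : connectivity n.+1;
  pos : nat -> 'I_(nvert bulk) -> V;
  spos : nat -> 'I_(nvert surf) -> V;
  vel : nat -> V -> V;
  pres : nat -> V -> R;
  defo : nat -> V -> V;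
  curv : nat -> V -> R;
  mvel : nat -> V -> V;
  pkind : nat -> pressure_kind }.

Arguments pos : clear implicits.
Arguments spos : clear implicits.

Variables (D : problem) (H : discrete).

Definition dt : R := Tend D / (nstep D)%:R.
Definition time (m : nat) : R := m%:R * dt.

Definition rho (m : nat) : V -> R :=
  phase (spos H m) (Om D) (rho_minus D) (rho_plus D).
Definition mu (m : nat) : V -> R :=
  phase (spos H m) (Om D) (mu_minus D) (mu_plus D).

Definition in_Um (m : nat) (u : V -> V) : Prop :=
  Svec (Om D) (pos H m) 2 u /\ in_U (Om D) (bd1 D) (bd2 D) u.

(* The ALE map A^m[t_(m-1)] and its Jacobian determinant. *)
Definition ale (m : nat) (x : V) : V := x - dt *: mvel H m x.
Definition jac (m : nat) (x : V) : R := \det (grad (pos H m) (ale m) x).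

Definition nu (m : nat) (j : 'I_(nsimp (surf H))) : V :=
  unit_normal (corners (spos H m) j).
Definition nu_half (m : nat) (j : 'I_(nsimp (surf H))) : V :=
  weighted_normal (time m) (time m.+1) dt
    (corners (spos H m) j) (corners (spos H m.+1) j).

Definition valid_mesh (m : nat) : Prop :=
  [/\ closed_surface (spos H m),
      carrier (spos H m) `<=` Om D,
      oriented (spos H m) (Om D),
      regular_partition (Om D) (pos H m) &
      fitted (spos H m) (pos H m)].

Definition initialised : Prop :=
  in_Um 0 (vel H 0) /\ forall x, closure (Om D) x -> mvel H 0 x = 0.

Definition A1 (m : nat) : Prop :=
  forall chi, in_Um m chi ->
    ip (Om D)
       (fun x => (rho m x / dt) *:
          (vel H m.+1 x - Num.sqrt (jac m x) *: vel H m (ale m x))) chi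
    + antisym_conv (Om D) (pos H m) (rho m)
        (fun x => vel H m (ale m x) - mvel H m x) (vel H m.+1) chi
    + 2 * ip (Om D)
        (fun x => mu m x *: symgrad (pos H m) (vel H m.+1) x)
        (symgrad (pos H m) chi)
    - ips (Om D) (pres H m.+1) (div (pos H m) chi)
    - gamma D * int_surf (spos H m)
        (fun j x => dot (curv H m.+1 x *: nu m j) (chi x))
    = ip (Om D) (fun x => rho m x *: grav D x) chi.

Definition in_Pspace (m : nat) : (V -> R) -> Prop :=
  in_Pm (pkind H m) (Om D) (pos H m) (spos H m).

Definition A2 (m : nat) : Prop :=
  forall p, in_Pspace m p ->
    ips (Om D) (div (pos H m) (vel H m.+1)) p = 0.

Definition A3 (m : nat) : Prop :=
  forall phi, Vh (spos H m) phi ->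
    int_lumped (spos H m)
      (fun j x => dot (dt^-1 *: (defo H m.+1 x - x)) (nu_half m j) * phi x)
    - int_surf (spos H m)
        (fun j x => dot (vel H m.+1 x) (nu m j) * phi x) = 0.

Definition A4 (m : nat) : Prop :=
  forall zeta, Vhvec (spos H m) zeta ->
    int_lumped (spos H m)
      (fun j x => dot (curv H m.+1 x *: nu_half m j) (zeta x))
    + int_surf (spos H m)
        (fun j x => dot (sgrad (corners (spos H m) j) (defo H m.+1) x)
                        (sgrad (corners (spos H m) j) zeta x)) = 0.

Definition solves_step (m : nat) : Prop :=
  [/\ [/\ in_Um m (vel H m.+1), in_Pspace m (pres H m.+1),
          Vhvec (spos H m) (defo H m.+1) &
          Vh (spos H m) (curv H m.+1)],
      A1 m, A2 m, A3 m & A4 m].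

Definition moves_surface (m : nat) : Prop :=
  (forall k, spos H m.+1 k = defo H m.+1 (spos H m k)) /\
  carrier (spos H m.+1) = defo H m.+1 @` carrier (spos H m).

Definition moves_mesh (m : nat) : Prop :=
  (exists psi, mesh_displacement (spos H m) (Om D) (pos H m)
                 (defo H m.+1) psi /\
     forall k, pos H m.+1 k = pos H m k + psi (pos H m k)) /\
  (exists phi, nodal_basis (Om D) (pos H m.+1) phi /\
     forall x, closure (Om D) x -> mvel H m.+1 x =
       \sum_k phi k x *: (dt^-1 *: (pos H m.+1 k - pos H m k))).

Definition valid_ale (m : nat) : Prop :=
  [/\ set_bij (closure (Om D)) (closure (Om D)) (ale m.+1),
      forall x, open_elements (pos H m.+1) x -> 0 < jac m.+1 x,
      ale m.+1 @` Om_minus (spos H m.+1) (Om D)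
        = Om_minus (spos H m) (Om D) &
      ale m.+1 @` Om_plus (spos H m.+1) (Om D)
        = Om_plus (spos H m) (Om D)].

Definition fitted_ALE_solution : Prop :=
  [/\ forall m, (m <= nstep D)%N -> valid_mesh m,
      initialised &
      forall m, (m < nstep D)%N ->
        [/\ solves_step m, moves_surface m, moves_mesh m & valid_ale m]].

(* [energy k l]: density rho^k, velocity U^l and interface Gamma^l. *)
Definition energy (k l : nat) : R :=
  2^-1 * L2norm (Om D) (fun x => Num.sqrt (rho k x) *: vel H l x) ^+ 2
  + gamma D * area (spos H l).

Definition dissipation (m : nat) : R :=
  L2norm (Om D) (fun x => Num.sqrt (mu m x) *:
                   symgrad (pos H m) (vel H m.+1) x) ^+ 2.

Definition gravity_work (m : nat) : R :=
  ip (Om D) (fun x => rho m x *: grav D x) (vel H m.+1).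

Definition omega (m : nat) : R :=
  vol (Om_minus (spos H m) (Om D)) / vol (Om D).

End Scheme.

Arguments problem R n : clear implicits.
Arguments discrete R n : clear implicits.
Arguments pos {R n} _ _ _.
Arguments spos {R n} _ _ _.

(* Main.v *)
Require Import Defs.
From mathcomp Require Import all_boot all_order all_algebra all_fingroup.
From mathcomp Require Import all_classical all_reals all_analysis.
From mathcomp Require Import measurable_realfun.
From mathcomp Require Import ring lra.
Import Order.TTheory GRing.Theory Num.Theory.
Import numFieldNormedType.Exports.
Set Implicit Arguments.
Unset Strict Implicit.
Unset Printing Implicit Defensive.
Local Open Scope classical_set_scope.
Local Open Scope ring_scope.

(** The energy inequality is obtained by testing every equation of the scheme
    with the solution itself: the momentum equation with the new velocity, the
    divergence constraint with the pressure, the two interface equations with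
    the curvature and with the discrete interface velocity.  The convective term
    is antisymmetric and drops out, and the two lumped terms cancel.  Two
    inequalities remain.
    - [kinetic_step]: on each element the ALE map is the affine map to the old
      element with the same labels, and its Jacobian is the quotient of the
      signed element volumes ([ale_element], [jac_element]); it also respects
      the phases ([minus_step]).  Hence the factor [sqrt jac] turns the old
      kinetic energy into an integral over the new mesh, and
      (a - b) a >= (a^2 - b^2) / 2 suffices.
    - [area_growth]: with G and G' the Gram matrices of the edges of a surface
      simplex before and after the step, |A| (tr (G^-1 G') - n) / 2 >= |A'| - |A|,
      where |A|^2 = det G.  For n = 2 this is the inequality between the
      arithmetic and geometric means of the eigenvalues of G^-1 G', for n = 1 it
      is (|A'| - |A|)^2 >= 0.

    For the volume, the divergence constraint is tested with the indicator of
    the inner phase.  By the divergence theorem on each element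
    ([int_osimplex_derive]), integrals of the divergence are sums of fluxes
    through facets, and these cancel except on the interface ([flux_sum_total],
    [flux_sum_minus]); so the velocity has no net flux through the interface
    ([interface_flux0]).  The interface equation tested with 1 carries this over
    to the displacements weighted with the time-averaged normal
    ([interface_displacement0]).  While the vertices move on straight lines from
    one mesh to the next, the signed volume of an element is a polynomial in
    time; its derivative is again a sum of facet fluxes, now of the vertex
    velocities, and summed over the inner elements it only leaves the interface
    ([volume_derivative]).  Its time integral is exactly the weighted sum that
    vanishes ([volume_step]).

    Two devices keep the geometry elementary.  The vertices of a simplex are the
    rows of a square matrix, bordered by a column of ones; its determinant is
    the signed volume, and its cofactors give the barycentric coordinates and
    the area vectors of the facets ([coord_det]).  And all integrals over the
    domain are sums of integrals over the reference simplex
    ([int_Rn_elements], [int_osimplex]), because the skeleton of the mesh is a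
    null set and the product Lebesgue measure obeys the affine change of
    variables formula ([scales_by_det_unit]).

    The cancellation of fluxes rests on the combinatorics of the mesh, which
    follows from its geometry: a facet belongs to at most two elements, on
    opposite sides ([opposite_sides], [facet_at_most_two]); a facet of one
    element only lies on the boundary of the domain and has an outer normal
    there ([boundary_facet_normal]); the facets between an inner and an outer
    element are the simplices of the interface ([surface_sides],
    [surface_between]). *)

(** * Change of variables for the product Lebesgue measure *)

Section NonnegativeIntegral.
Context {R : realType}.
Local Notation RT := (measurableTypeR R).
Local Notation leb := (@lebesgue_measure R).
Local Open Scope ereal_scope.

Definition rv_measurable n (F : 'rV[R]_n -> \bar R) : Prop :=
  measurable_fun [set: n.-tuple RT] (F \o @pt R n).

Definition nnint n (F : 'rV[R]_n -> \bar R) : \bar R :=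
  \int[lebesgue_tuple n]_t F (pt t).

Lemma measurable_comp_rv n d (X : measurableType d) (g : X -> 'rV[R]_n)
    (F : 'rV[R]_n -> \bar R) :
  (forall i, measurable_fun setT (fun x => g x ord0 i : RT)) ->
  rv_measurable F -> measurable_fun setT (F \o g).
Proof.
move=> mg mF.
have -> : F \o g = (F \o @pt R n) \o (fun x => [tuple g x ord0 i | i < n]).
  apply/funext => x /=; congr F; apply/rowP => i.
  by rewrite mxE tnth_mktuple.
apply: measurableT_comp => //.
apply/measurable_fun_tnthP => i.
rewrite (_ : _ \o _ = fun x => g x ord0 i : RT) //.
by apply/funext => x /=; rewrite tnth_mktuple.
Qed.

Lemma measurable_coord n (i : 'I_n) :
  measurable_fun setT (fun t : n.-tuple RT => pt t ord0 i : RT).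
Proof.
rewrite (_ : (fun _ => _) = (fun t => tnth t i)); first exact: measurable_tnth.
by apply/funext => t; rewrite mxE.
Qed.

Lemma pt_tcons n (x : RT) (t : n.-tuple RT) :
  pt (tcons (x, t)) = row_mx (x%:M : 'rV_1) (pt t) :> 'rV[R]_(1 + n).
Proof.
apply/rowP => i; rewrite mxE; case: (split_ordP i) => j ->.
  by rewrite row_mxEl !ord1 mxE mulr1n.
have -> : rshift 1 j = lift ord0 j by apply: val_inj.
by rewrite -[LHS]/(tnth [tuple of x :: t] (lift ord0 j)) tnthS
  (_ : lift ord0 j = rshift 1 j) ?row_mxEr ?mxE //; apply: val_inj.
Qed.

Lemma measurable_slice n (F : 'rV[R]_n.+1 -> \bar R) : rv_measurable F ->
  measurable_fun [set: RT * n.-tuple RT]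
    (fun p => F (row_mx (p.1%:M : 'rV_1) (pt p.2) : 'rV[R]_(1 + n))).
Proof.
move=> mF.
have -> : (fun p : RT * n.-tuple RT =>
    F (row_mx (p.1%:M : 'rV_1) (pt p.2) : 'rV[R]_(1 + n))) =
    (F \o @pt R n.+1) \o (@tcons R n).
  by apply/funext => -[x t] /=; rewrite pt_tcons.
apply: measurableT_comp => //; exact: measurable_tcons.
Qed.

Lemma nnint_cons n (F : 'rV[R]_n.+1 -> \bar R) : rv_measurable F ->
  (forall s, 0 <= F s) ->
  nnint F = \int[leb \x lebesgue_tuple n]_p
              F (row_mx (p.1%:M : 'rV_1) (pt p.2) : 'rV[R]_(1 + n)).
Proof.
move=> mF F0; rewrite /nnint.
transitivity (\int[pushforward (leb \x lebesgue_tuple n)%E (@tcons R n)]_t F (pt t)).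
  by [].
rewrite (ge0_integral_pushforward (@measurable_tcons R n)) //=.
by apply: eq_integral => -[x t] _ /=; rewrite pt_tcons.
Qed.

Lemma nnint_head n (F : 'rV[R]_n.+1 -> \bar R) : rv_measurable F ->
  (forall s, 0 <= F s) ->
  nnint F = \int[leb]_x nnint (fun s : 'rV[R]_n => F (row_mx (x%:M : 'rV_1) s : 'rV_(1 + n))).
Proof.
move=> mF F0; rewrite nnint_cons //.
rewrite (fubini_tonelli1 (fun p : RT * n.-tuple RT => F (row_mx (p.1%:M : 'rV_1) (pt p.2) : 'rV[R]_(1 + n)))) //.
exact: measurable_slice.
Qed.

Lemma nnint_tail n (F : 'rV[R]_n.+1 -> \bar R) : rv_measurable F ->
  (forall s, 0 <= F s) ->
  nnint F = nnint (fun s : 'rV[R]_n => \int[leb]_x F (row_mx (x%:M : 'rV_1) s : 'rV_(1 + n))).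
Proof.
move=> mF F0; rewrite nnint_cons //.
rewrite (fubini_tonelli2 (fun p : RT * n.-tuple RT => F (row_mx (p.1%:M : 'rV_1) (pt p.2) : 'rV[R]_(1 + n)))) //.
exact: measurable_slice.
Qed.

Lemma measurable_slice_tail n (F : 'rV[R]_n.+1 -> \bar R) (x : R) :
  rv_measurable F ->
  rv_measurable (fun s : 'rV[R]_n => F (row_mx (x%:M : 'rV_1) s : 'rV_(1 + n))).
Proof.
move=> mF; apply: (measurable_comp_rv
  (g := fun t : n.-tuple RT => row_mx (x%:M : 'rV_1) (pt t) : 'rV_(1 + n))) => // i.
case: (split_ordP i) => j ->.
  by under eq_fun do rewrite row_mxEl; exact: measurable_cst.
under eq_fun do rewrite row_mxEr.
exact: measurable_coord.
Qed.

Lemma measurable_slice_head n (F : 'rV[R]_n.+1 -> \bar R) (s : 'rV[R]_n) :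
  rv_measurable F ->
  measurable_fun [set: RT] (fun x : RT => F (row_mx (x%:M : 'rV_1) s : 'rV_(1 + n))).
Proof.
move=> mF; apply: (measurable_comp_rv
  (g := fun x : RT => row_mx (x%:M : 'rV_1) s : 'rV_(1 + n))) => // i.
case: (split_ordP i) => j ->.
  under eq_fun do rewrite row_mxEl (ord1 j) mxE mulr1n.
  exact: measurable_id.
by under eq_fun do rewrite row_mxEr; exact: measurable_cst.
Qed.

Lemma lebesgue_affine (a b : R) (A : set RT) : a != 0%R -> measurable A ->
  leb ((fun x => (a * x + b)%R : RT) @^-1` A) = (`|a|^-1)%:E * leb A.
Proof.
move=> a0 mA.
have mphi : measurable_fun [set: RT] (fun x : RT => (a * x + b)%R : RT).
  apply: measurable_funD => //; exact: measurable_funM.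
have a0' : (0 < `|a|)%R by rewrite normr_gt0.
pose m : {measure set RT -> \bar R} :=
  mscale (NngNum (ltW a0')) (pushforward leb (fun x : RT => (a * x + b)%R : RT)).
have H : leb A = m mphi A.
  apply: (lebesgue_measure_unique (mu := m mphi)) => // _ [[u v]] _ <- /=.
  rewrite /mscale/= /pushforward.
  have [uv|uv] := ltP u v; last first.
    rewrite set_itv_ge ?bnd_simp -?leNgt // preimage_set0 !measure0 mule0 //.
  have [ap|an] : (0 < a \/ a < 0)%R by case: ltgtP a0 => //; auto.
  - rewrite (_ : _ @^-1` _ = `]((u - b) / a)%R, ((v - b) / a)%R]%classic); last first.
      apply/seteqP; split => x /=; rewrite !in_itv /=.
        by move=> /andP[? ?]; rewrite ltr_pdivrMr // ler_pdivlMr //; lra.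
      by rewrite ltr_pdivrMr // ler_pdivlMr // => /andP[? ?]; lra.
    rewrite !lebesgue_measure_itv /= !lte_fin uv ltr_pM2r ?invr_gt0 //.
    rewrite ltrD2r uv -!EFinD -EFinM gtr0_norm //; congr (_%:E).
    by field.
  - rewrite (_ : _ @^-1` _ = `[((v - b) / a)%R, ((u - b) / a)%R[%classic); last first.
      apply/seteqP; split => x /=; rewrite !in_itv /=.
        by move=> /andP[? ?]; rewrite ltr_ndivlMr // ler_ndivrMr //; lra.
      by rewrite ltr_ndivlMr // ler_ndivrMr // => /andP[? ?]; lra.
    rewrite !lebesgue_measure_itv /= !lte_fin uv ltr_nM2r ?invr_lt0 //.
    rewrite ltrD2r uv -!EFinD -EFinM ltr0_norm //; congr (_%:E).
    by field.
rewrite H /m /mscale /= muleA -EFinM mulVf ?mul1e // normr_eq0 //.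
Qed.

Lemma ge0_integral_lebesgue_affine (a b : R) (f : RT -> \bar R) : a != 0%R ->
  measurable_fun [set: RT] f -> (forall x, 0 <= f x) ->
  \int[leb]_x f (a * x + b)%R = (`|a|^-1)%:E * \int[leb]_x f x.
Proof.
move=> a0 mf f0.
have mphi : measurable_fun [set: RT] (fun x : RT => (a * x + b)%R : RT).
  apply: measurable_funD => //; exact: measurable_funM.
have a0' : (0 <= `|a|^-1)%R by rewrite invr_ge0.
transitivity (\int[pushforward leb (fun x : RT => (a * x + b)%R : RT)]_x f x).
  by rewrite ge0_integral_pushforward.
transitivity (\int[mscale (NngNum a0') leb]_x f x); last first.
  by rewrite ge0_integral_mscale.
apply: eq_measure_integral => A mA _; exact: lebesgue_affine.
Qed.

Lemma nnint_ge0 n (F : 'rV[R]_n -> \bar R) : (forall s, 0 <= F s) -> 0 <= nnint F.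
Proof. by move=> F0; exact: integral_ge0. Qed.

Lemma eq_nnint n (F G : 'rV[R]_n -> \bar R) : F =1 G -> nnint F = nnint G.
Proof. by move=> FG; apply: eq_integral => t _; rewrite FG. Qed.

Lemma rv_measurable_addr n (b : 'rV[R]_n) (F : 'rV[R]_n -> \bar R) :
  rv_measurable F -> rv_measurable (fun s => F (s + b)%R).
Proof.
move=> mF; apply: (measurable_comp_rv
  (g := fun t : n.-tuple RT => (pt t + b)%R)) => // i.
under eq_fun do rewrite mxE.
by apply: measurable_funD => //; exact: measurable_coord.
Qed.

Lemma rv_measurable_mulmx m n (M : 'M[R]_(m, n)) (F : 'rV[R]_n -> \bar R) :
  rv_measurable F -> rv_measurable (fun s => F (s *m M)%R).
Proof.
move=> mF; apply: (measurable_comp_rv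
  (g := fun t : m.-tuple RT => (pt t *m M)%R)) => // i.
under eq_fun do rewrite mxE.
apply: measurable_sum => j; apply: measurable_funM => //.
exact: measurable_coord.
Qed.

Lemma rv_measurable_int_head n (F : 'rV[R]_n.+1 -> \bar R) : rv_measurable F ->
  (forall s, 0 <= F s) ->
  rv_measurable (fun s : 'rV[R]_n => \int[leb]_x F (row_mx (x%:M : 'rV_1) s : 'rV_(1 + n))).
Proof.
move=> mF F0.
apply: (measurable_fun_fubini_tonelli_G
 (fun p : RT * n.-tuple RT => F (row_mx (p.1%:M : 'rV_1) (pt p.2) : 'rV[R]_(1 + n)))) => //.
exact: measurable_slice.
Qed.

Lemma measurable_int_tail n (F : 'rV[R]_n.+1 -> \bar R) : rv_measurable F ->
  (forall s, 0 <= F s) ->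
  measurable_fun [set: RT]
    (fun x : RT => nnint (fun s : 'rV[R]_n => F (row_mx (x%:M : 'rV_1) s : 'rV_(1 + n)))).
Proof.
move=> mF F0.
apply: (measurable_fun_fubini_tonelli_F
 (fun p : RT * n.-tuple RT => F (row_mx (p.1%:M : 'rV_1) (pt p.2) : 'rV[R]_(1 + n)))) => //.
exact: measurable_slice.
Qed.

Lemma nnint_translate n (b : 'rV[R]_n) (F : 'rV[R]_n -> \bar R) :
  rv_measurable F -> (forall s, 0 <= F s) -> nnint (fun s => F (s + b)%R) = nnint F.
Proof.
elim: n => [|n IH] in b F *.
  by move=> _ _; apply: eq_nnint => s; congr F; apply/rowP => -[].
move=> mF F0.
rewrite (nnint_tail (rv_measurable_addr b mF) (fun s => F0 (s + b)%R)) (nnint_tail mF F0).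
set G := fun s : 'rV[R]_n => \int[leb]_x F (row_mx (x%:M : 'rV_1) s : 'rV_(1 + n)).
have mG : rv_measurable G by exact: rv_measurable_int_head.
have G0 s : 0 <= G s by exact: integral_ge0.
rewrite -(IH (rsubmx (b : 'rV_(1 + n))) G mG G0).
apply: eq_nnint => s.
have mGs := measurable_slice_head (s + rsubmx (b : 'rV_(1 + n)))%R mF.
have := ge0_integral_lebesgue_affine (lsubmx (b : 'rV_(1 + n)) ord0 ord0) (oner_neq0 R) mGs.
rewrite normr1 invr1 mul1e => /(_ (fun x => F0 _)) GE.
rewrite [RHS]/G -GE.
apply: eq_integral => x _; congr F.
have -> : ((1 * x + lsubmx (b : 'rV_(1 + n)) ord0 ord0)%:M = (x%:M : 'rV_1) + lsubmx (b : 'rV_(1 + n)))%R.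
  by apply/rowP => i; rewrite mul1r !ord1 !mxE !mulr1n.
by rewrite -(@add_row_mx _ 1 1 n) (@hsubmxK _ 1 1 n b).
Qed.

(** The change of variables formula, as a property of matrices that is stable
    under products, so that elimination reduces it to triangular blocks. *)
Definition scales_by_det n (M : 'M[R]_n) : Prop :=
  forall F : 'rV[R]_n -> \bar R, rv_measurable F -> (forall s, 0 <= F s) ->
  nnint (fun s => F (s *m M)%R) = (`|\det M|^-1)%:E * nnint F.

Lemma scales_by_detM n (M N : 'M[R]_n) :
  scales_by_det M -> scales_by_det N -> scales_by_det (M *m N)%R.
Proof.
move=> hM hN F mF F0.
transitivity (nnint (fun s => F (s *m M *m N)%R)).
  by apply: eq_nnint => s; rewrite mulmxA.
rewrite (hM (fun s => F (s *m N)%R)); [|exact: rv_measurable_mulmx|by []].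
by rewrite (hN F mF F0) muleA -EFinM det_mulmx normrM invfM.
Qed.

(** Substituting in the inner variables first, then in the outer one, leaves a
    translation of the inner variables by a multiple of [b]. *)
Lemma scales_by_det_upper n (a : R) (b : 'rV[R]_n) (S : 'M[R]_n) : a != 0%R ->
  scales_by_det S ->
  scales_by_det (block_mx (a%:M : 'M[R]_1) b 0%R S : 'M[R]_(1 + n)).
Proof.
move=> a0 hS F mF F0.
set M := block_mx _ _ _ _.
have mFM := rv_measurable_mulmx M mF.
rewrite (nnint_head mFM (fun s => F0 (s *m M)%R)) (nnint_head mF F0).
rewrite (det_ublock (a%:M : 'M[R]_1)) det_scalar1 normrM invfM EFinM.
have mT := measurable_int_tail mF F0.
set T := fun x : RT => _ in mT.
have T0 x : 0 <= T x by exact: nnint_ge0.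
rewrite (_ : _ * _ * _ = (`|\det S|^-1)%:E * ((`|a|^-1)%:E * \int[leb]_x T x)); last first.
  by rewrite muleA [X in X * _ = _]muleC.
rewrite -(ge0_integral_lebesgue_affine 0 a0 mT T0).
rewrite -ge0_integralZl; last 4 first.
- by [].
- apply: (measurableT_comp mT).
  by apply: measurable_funD => //; exact: measurable_funM.
- by move=> x _; exact: T0.
- by rewrite lee_fin invr_ge0.
apply: eq_integral => x _.
have mx := measurable_slice_tail (a * x + 0)%R mF.
have mxb := rv_measurable_addr (x *: b)%R mx.
rewrite /T -(nnint_translate (x *: b)%R mx) //.
rewrite -(hS _ mxb) //.
apply: eq_nnint => s; congr F.
rewrite /M (@mul_row_block _ 1 1 n) mulmx0 addr0 -scalar_mxM mulrC mul_scalar_mx.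
by rewrite addr0 addrC.
Qed.

Lemma scales_by_det_lower n (c : 'cV[R]_n) :
  scales_by_det (block_mx (1%:M : 'M[R]_1) 0%R c 1%:M : 'M[R]_(1 + n)).
Proof.
move=> F mF F0.
set M := block_mx _ _ _ _.
have mFM := rv_measurable_mulmx M mF.
rewrite (nnint_tail mFM (fun s => F0 (s *m M)%R)) (nnint_tail mF F0).
rewrite (det_lblock (1%:M : 'M[R]_1)) !det1 mulr1 normr1 invr1 mul1e.
apply: eq_nnint => s.
have ms := measurable_slice_head s mF.
have := ge0_integral_lebesgue_affine ((s *m c)%R ord0 ord0) (oner_neq0 R) ms.
rewrite normr1 invr1 mul1e => /(_ (fun x => F0 _)) <-.
apply: eq_integral => x _; congr F.
rewrite /M (@mul_row_block _ 1 1 n) mulmx0 add0r !mulmx1 mul1r; congr row_mx.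
by apply/rowP => i; rewrite !ord1 !mxE !mulr1n.
Qed.

Lemma scales_by_det_unit n (M : 'M[R]_n) : M \in unitmx -> scales_by_det M.
Proof.
elim: n => [|n IH] in M *.
  move=> _ F mF F0; rewrite det_mx00 normr1 invr1 mul1e.
  by apply: eq_nnint => s; congr F; apply/rowP => -[].
have pivoted (N : 'M[R]_(1 + n)) : N \in unitmx -> N ord0 ord0 != 0%R -> scales_by_det N.
  move=> uN N00.
  set a := N ord0 ord0.
  pose c := (a^-1 *: dlsubmx N)%R.
  pose b := ursubmx N.
  pose S := (drsubmx N - c *m b)%R.
  have EN : N = (block_mx (1%:M : 'M[R]_1) 0 c 1%:M *m block_mx (a%:M : 'M[R]_1) b 0 S)%R.
    rewrite mulmx_block !mul1mx !mul0mx !addr0 /S addrC.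
    rewrite addrNK mul_mx_scalar scalerA divff // scale1r.
    rewrite -[LHS]submxK; congr block_mx.
    apply/matrixP => i j; rewrite !ord1 !mxE mulr1n; congr (N _ _); exact: val_inj.
  rewrite EN; apply: scales_by_detM; first exact: scales_by_det_lower.
  apply: scales_by_det_upper => //; apply: IH.
  move: uN; rewrite EN !unitmxE det_mulmx det_lblock det_ublock !det1 !mul1r.
  by rewrite unitrM => /andP[].
move=> uM.
have [M00|M00] := eqVneq (M ord0 ord0) 0%R; last exact: (pivoted M).
have [k Mk] : exists k : 'I_n, M (lift ord0 k) ord0 != 0%R.
  apply/not_existsP => M0.
  suff : \det M = 0%R by move: uM; rewrite unitmxE => /[swap] ->; rewrite unitr0.
  rewrite (expand_det_col M ord0) big_ord_recl M00 mul0r add0r big1 // => k _.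
  by have /negP := M0 k; rewrite negbK => /eqP ->; rewrite mul0r.
(* adding row [k] to the first row makes the pivot nonzero *)
pose e : 'rV[R]_n := delta_mx ord0 k.
pose U (b : 'rV[R]_n) : 'M[R]_(1 + n) := block_mx (1%:M : 'M[R]_1) b 0%R 1%:M.
have UU : (U (- e) *m (U e *m M) = M)%R.
  rewrite mulmxA /U (@mulmx_block _ 1 n 1 n 1 n) !mul1mx !mulmx0 !mul0mx !mulmx1.
  by rewrite !addr0 !add0r subrr -(scalar_mx_block 1 n) mul1mx.
rewrite -UU; apply: scales_by_detM.
  apply: scales_by_det_upper; first exact: oner_neq0.
  by apply: IH; exact: unitmx1.
apply: (pivoted (U e *m M)%R).
  by move: uM; rewrite -[in M \in _]UU unitmx_mul => /andP[].
rewrite (_ : (U e *m M)%R ord0 ord0 = M ord0 ord0 + M (lift ord0 k) ord0)%R; last first.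
  have U0 : U e ord0 ord0 = 1%R.
    rewrite !mxE; case: splitP => // i _; rewrite mxE; case: splitP => // j _.
    by rewrite !ord1 mxE.
  have Ue j : U e ord0 (lift ord0 j) = (j == k)%:R%R.
    rewrite !mxE; case: splitP => // i _; rewrite mxE ord1; case: splitP => [[[]]//|l /= jl].
    by rewrite mxE eqxx /=; congr (_ == _)%:R; exact: val_inj (esym (succn_inj jl)).
  rewrite mxE big_ord_recl U0 mul1r; congr (_ + _)%R.
  rewrite (bigD1 k) //= big1 ?addr0 ?Ue ?eqxx ?mul1r // => j jk.
  by rewrite Ue (negbTE jk) mul0r.
by rewrite M00 add0r.
Qed.

End NonnegativeIntegral.

(** * Integrals of continuous functions over bounded sets *)

Section BorelSets.
Context {R : realType}.
Local Notation RT := (measurableTypeR R).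

Lemma measurable_pt_coord n (i : 'I_n) (B : set R) : measurable (B : set RT) ->
  measurable (@pt R n @^-1` [set x | B (x ord0 i)]).
Proof.
move=> mB; rewrite -[X in measurable X]setTI.
exact: (measurable_coord i measurableT mB).
Qed.

Lemma measurable_pt_box n (B : 'I_n -> set R) :
  (forall i, measurable (B i : set RT)) ->
  measurable (@pt R n @^-1` [set x | forall i, B i (x ord0 i)]).
Proof.
move=> mB.
rewrite (_ : _ @^-1` _ = \bigcap_(i in [set: 'I_n]) (@pt R n @^-1` [set x | B i (x ord0 i)])).
  by apply: fin_bigcap_measurable => // i _; exact: measurable_pt_coord.
by apply/seteqP; split => [t Bt i _|t Bt i]; [exact: Bt|exact: (Bt i)].
Qed.

(** An open set is the countable union of the rational cubes that it contains;
    the sigma-algebra on tuples is generated by the coordinates only. *)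
Lemma measurable_pt_open n (U : set 'rV[R]_n) : open U ->
  measurable (@pt R n @^-1` U).
Proof.
move=> oU.
pose box (q : 'rV[rat]_n * rat) :=
  [set x : 'rV[R]_n | forall i, `](ratr (q.1 ord0 i) - ratr q.2), (ratr (q.1 ord0 i) + ratr q.2)[%classic (x ord0 i)].
have -> : U = \bigcup_(q : 'rV[rat]_n * rat) (if `[< box q `<=` U >] then box q else set0).
  apply/seteqP; split => [x Ux|x [q _]]; last by case: asboolP => // + ?; exact.
  have /nbhs_ballP[e /= e0 exU] : nbhs x U by exact: open_nbhs_nbhs.
  have /rat_in_itvoo[r /itvP hr] : 0 < e / 2 :> R by rewrite divr_gt0.
  have r0 : 0 < ratr r :> R by rewrite hr.
  have hc i : exists c : rat, ratr c \in `](x ord0 i - ratr r), (x ord0 i + ratr r)[.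
    have /rat_in_itvoo[c hc] : x ord0 i - ratr r < x ord0 i + ratr r by lra.
    by exists c.
  exists (\row_i (projT1 (cid (hc i))), r) => //.
  rewrite asboolT => [i /=|y /= xy].
    rewrite mxE; case: cid => c /= /itvP hci; rewrite in_itv /=.
    have h1 : x ord0 i - ratr r < ratr c by rewrite hci.
    have h2 : ratr c < x ord0 i + ratr r by rewrite hci.
    by apply/andP; split; lra.
  apply: exU; split => // i j; rewrite ord1 /ball /=.
  have := xy j; rewrite mxE; case: cid => c /= /itvP hcj.
  rewrite in_itv /= => /andP[]; have : ratr c < x ord0 j + ratr r by rewrite hcj.
  have : x ord0 j - ratr r < ratr c by rewrite hcj.
  have : ratr r < e / 2 by rewrite hr.
  by move=> *; rewrite ltr_norml; lra.
rewrite preimage_bigcup; apply: countable_bigcupT_measurable => //.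
move=> q; case: ifP => _; last by rewrite preimage_set0.
apply: (measurable_pt_box
  (B := fun i => `](ratr (q.1 ord0 i) - ratr q.2), (ratr (q.1 ord0 i) + ratr q.2)[%classic)).
by move=> i; exact: measurable_itv.
Qed.

Lemma measurable_pt_closed n (F : set 'rV[R]_n) : closed F ->
  measurable (@pt R n @^-1` F).
Proof.
move=> cF; rewrite -(setCK F) preimage_setC; apply: measurableC.
exact: measurable_pt_open (closed_openC cF).
Qed.

Lemma measurable_continuous_pt n (f : 'rV[R]_n -> R) : continuous f ->
  measurable_fun [set: n.-tuple RT] (f \o @pt R n).
Proof.
move=> /continuousP cf.
apply: (measurability _ (RGenOInfty.measurableE R)) => /= _ [_ [a ->]] <-.
rewrite setTI comp_preimage.
by apply: measurable_pt_open; apply: cf; exact: interval_open.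
Qed.

End BorelSets.

Section IntegralOnBoundedSets.
Context {R : realType}.
Local Notation RT := (measurableTypeR R).
Local Notation leb := (@lebesgue_measure R).

Definition bounded_measurable n (E : set 'rV[R]_n) : Prop :=
  measurable (@pt R n @^-1` E) /\
  exists K : R, forall x, E x -> forall i, `|x ord0 i| <= K.

Lemma lebesgue_tuple_box n (B : 'I_n -> set R) :
  (forall i, measurable (B i : set RT)) ->
  lebesgue_tuple n (@pt R n @^-1` [set x | forall i, B i (x ord0 i)]) =
  (\prod_i leb (B i))%E.
Proof.
elim: n => [|n IH] in B *.
  move=> _; rewrite big_ord0 /= diracE mem_set //.
  by move=> [].
move=> mB; rewrite big_ord_recl -(IH (fun i => B (lift ord0 i))) //.
rewrite -product_measure1E //;
  last by apply: (measurable_pt_box (B := fun i => B (lift ord0 i))).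
transitivity ((leb \x lebesgue_tuple n)%E
  (@tcons R n @^-1` (@pt R n.+1 @^-1` [set x | forall i, B i (x ord0 i)]))).
  by [].
congr ((leb \x lebesgue_tuple n)%E _).
apply/seteqP; split => -[x t] /=.
  move=> Bt; split => /= [|i]; first by have := Bt ord0; rewrite mxE.
  by have := Bt (lift ord0 i); rewrite !mxE tnthS.
move=> [/= Bx Bt] i; rewrite mxE.
case: (unliftP ord0 i) => [j ->|->] //.
by rewrite tnthS; have := Bt j; rewrite mxE.
Qed.

Lemma bounded_measurable_fin n (E : set 'rV[R]_n) : bounded_measurable E ->
  (lebesgue_tuple n (@pt R n @^-1` E) < +oo)%E.
Proof.
move=> [mE [K EK]].
have mB (i : 'I_n) : measurable (`[- K, K]%classic : set RT) by exact: measurable_itv.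
apply: (@le_lt_trans _ _
  (lebesgue_tuple n (@pt R n @^-1` [set x | forall i, `[- K, K]%classic (x ord0 i)]))).
  apply: le_measure; rewrite ?inE //.
    exact: (measurable_pt_box (B := fun=> `[- K, K]%classic)).
  by move=> t /EK Et i /=; rewrite in_itv /= -ler_norml.
rewrite (lebesgue_tuple_box (B := fun=> `[- K, K]%classic)) // ltey_eq.
apply/orP; left; apply: (big_ind (fun x => x \is a fin_num)) => // [x y ? ?|i _].
  exact: fin_numM.
by rewrite lebesgue_measure_itv /=; case: ifP.
Qed.

Lemma bounded_measurable_sub n (E F : set 'rV[R]_n) : F `<=` E ->
  measurable (@pt R n @^-1` F) -> bounded_measurable E -> bounded_measurable F.
Proof. by move=> FE mF [_ [K EK]]; split => //; exists K => x /FE; exact: EK. Qed.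

Lemma bounded_continuous n (E : set 'rV[R]_n) (f : 'rV[R]_n -> R) :
  bounded_measurable E -> continuous f -> exists M, forall x, E x -> `|f x| <= M.
Proof.
move=> [_ [K EK]] cf.
have cE : compact [set x : 'rV[R]_n | forall i, `[- K, K]%classic (x ord0 i)].
  by apply: (@rV_compact _ n (fun=> `[- K, K]%classic)) => i; exact: segment_compact.
have : compact (f @` [set x : 'rV[R]_n | forall i, `[- K, K]%classic (x ord0 i)]).
  apply: continuous_compact cE; exact: continuous_subspaceT.
move=> /compact_bounded[M [_ HM]]; exists (M + 1) => x Ex.
apply: HM; first by rewrite ltrDl.
by exists x => // i; rewrite /= in_itv /= -ler_norml; exact: EK.
Qed.

Lemma integrable_bounded_measurable n (E : set 'rV[R]_n) (f : 'rV[R]_n -> R) :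
  bounded_measurable E -> continuous f ->
  (lebesgue_tuple n).-integrable (@pt R n @^-1` E) (EFin \o (f \o @pt R n)).
Proof.
move=> bE cf; apply: measurable_bounded_integrable.
- by case: bE.
- exact: bounded_measurable_fin.
- exact: (measurable_funS measurableT (@subsetT _ _) (measurable_continuous_pt cf)).
- have [M HM] := bounded_continuous bE cf.
  exists M; split; first by rewrite num_real.
  by move=> N MN t /HM; move/le_trans; apply; exact: ltW.
Qed.

Lemma eq_int_Rn n (E : set 'rV[R]_n) f g : (forall x, E x -> f x = g x) ->
  int_Rn E f = int_Rn E g.
Proof. by move=> fg; apply: eq_Rintegral => t; rewrite inE => /fg. Qed.

Lemma int_RnD n (E : set 'rV[R]_n) f g : bounded_measurable E ->
  continuous f -> continuous g ->
  int_Rn E (fun x => f x + g x) = int_Rn E f + int_Rn E g.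
Proof.
by move=> bE cf cg; apply: RintegralD; [case: bE|exact: integrable_bounded_measurable..].
Qed.

Lemma int_RnB n (E : set 'rV[R]_n) f g : bounded_measurable E ->
  continuous f -> continuous g ->
  int_Rn E (fun x => f x - g x) = int_Rn E f - int_Rn E g.
Proof.
by move=> bE cf cg; apply: RintegralB; [case: bE|exact: integrable_bounded_measurable..].
Qed.

Lemma int_RnZ n (E : set 'rV[R]_n) (c : R) f : bounded_measurable E ->
  continuous f -> int_Rn E (fun x => c * f x) = c * int_Rn E f.
Proof.
by move=> bE cf; apply: RintegralZl; [case: bE|exact: integrable_bounded_measurable].
Qed.

Lemma int_Rn_cst n (E : set 'rV[R]_n) (c : R) : bounded_measurable E ->
  int_Rn E (fun=> c) = c * vol E.
Proof. by move=> [mE _]; exact: Rintegral_cst. Qed.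

Lemma continuous_addr (T : topologicalType) (f g : T -> R) :
  continuous f -> continuous g -> continuous (fun x => f x + g x).
Proof. by move=> cf cg x; apply: continuousD; [exact: cf|exact: cg]. Qed.

Lemma continuous_mulr (T : topologicalType) (f g : T -> R) :
  continuous f -> continuous g -> continuous (fun x => f x * g x).
Proof. by move=> cf cg x; apply: continuousM; [exact: cf|exact: cg]. Qed.

Lemma continuous_subr (T : topologicalType) (f g : T -> R) :
  continuous f -> continuous g -> continuous (fun x => f x - g x).
Proof. by move=> cf cg x; apply: continuousB; [exact: cf|exact: cg]. Qed.

Lemma continuous_cstr (T : topologicalType) (c : R) : continuous (fun _ : T => c).
Proof. exact: cst_continuous. Qed.

Lemma continuous_sumr (T : topologicalType) (I : Type) (r : seq I) (P : pred I)
    (f : I -> T -> R) : (forall i, continuous (f i)) ->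
  continuous (fun x => \sum_(i <- r | P i) f i x).
Proof.
move=> cf; elim: r => [|i r IH] x.
  by under eq_fun do rewrite big_nil; exact: cvg_cst.
under eq_fun do rewrite big_cons; case: (P i); last exact: IH.
by apply: continuousD; [exact: cf|exact: IH].
Qed.

Lemma int_Rn_sum n (E : set 'rV[R]_n) (I : Type) (r : seq I) (f : I -> 'rV[R]_n -> R) :
  bounded_measurable E -> (forall i, continuous (f i)) ->
  int_Rn E (fun x => \sum_(i <- r) f i x) = \sum_(i <- r) int_Rn E (f i).
Proof.
move=> bE cf; elim: r => [|i r IH].
  rewrite big_nil -[RHS](mul0r (vol E)) -int_Rn_cst //.
  by apply: eq_int_Rn => x _; rewrite big_nil.
rewrite big_cons -IH -int_RnD //.
  by apply: eq_int_Rn => x _; rewrite big_cons.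
exact: continuous_sumr.
Qed.

Lemma le_int_Rn n (E : set 'rV[R]_n) f g : bounded_measurable E ->
  continuous f -> continuous g -> (forall x, E x -> f x <= g x) ->
  int_Rn E f <= int_Rn E g.
Proof.
move=> bE cf cg fg; apply: le_Rintegral => [|||t Et]; last exact: fg.
- by case: bE.
- exact: integrable_bounded_measurable.
- exact: integrable_bounded_measurable.
Qed.

Lemma nnint_affine n (M : 'M[R]_n) (b : 'rV[R]_n) (F : 'rV[R]_n -> \bar R) :
  M \in unitmx -> rv_measurable F -> (forall s, (0 <= F s)%E) ->
  (nnint F = `|\det M|%:E * nnint (fun s => F (s *m M + b)%R))%E.
Proof.
move=> uM mF F0.
rewrite (scales_by_det_unit uM (F := fun s => F (s + b)%R)) //;
  last exact: rv_measurable_addr.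
rewrite nnint_translate // muleA -EFinM mulfV ?mul1e //.
by rewrite normr_eq0; rewrite unitmxE unitfE in uM.
Qed.

(** The formula for nonnegative functions, applied to the positive and negative
    parts of [f] extended by 0 outside [E']. *)
Lemma int_Rn_affine n (M : 'M[R]_n) (b : 'rV[R]_n) (E E' : set 'rV[R]_n) f :
  M \in unitmx -> bounded_measurable E' -> continuous f ->
  (forall s, E s <-> E' (s *m M + b)) ->
  int_Rn E' f = `|\det M| * int_Rn E (fun s => f (s *m M + b)).
Proof.
move=> uM bE' cf EE'.
have := integrable_bounded_measurable bE' cf.
set X := pt (n := n) @^-1` E' => intf.
have mX : measurable X by case: bE'.
pose F : 'rV[R]_n -> \bar R := (fun x : 'rV[R]_n => (f x)%:E) \_ E'.
pose Fp : 'rV[R]_n -> \bar R := (F^\+)%E; pose Fn : 'rV[R]_n -> \bar R := (F^\-)%E.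
have mF : rv_measurable F.
  rewrite /rv_measurable (_ : _ \o _ = (EFin \o (f \o @pt R n)) \_ X).
    apply/(measurable_restrictT _ _).1 => //.
    by case/integrableP : intf.
  by apply/funext => t; rewrite /F /= !patchE.
have iF : (lebesgue_tuple n).-integrable setT (F \o @pt R n).
  rewrite (_ : _ \o _ = (EFin \o (f \o @pt R n)) \_ X).
    by apply/integrable_restrict => //; rewrite setTI.
  by apply/funext => t; rewrite /F /= !patchE.
have mFp : rv_measurable Fp by rewrite /rv_measurable /Fp -funepos_comp; exact: measurable_funepos.
have mFn : rv_measurable Fn by rewrite /rv_measurable /Fn -funeneg_comp; exact: measurable_funeneg.
have Fp0 s : (0 <= Fp s)%E by exact: funepos_ge0.
have Fn0 s : (0 <= Fn s)%E by exact: funeneg_ge0.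
have FpE : int_Rn E' f = fine (nnint Fp - nnint Fn).
  rewrite /int_Rn /Rintegral integral_mkcond (_ : _ \_ _ = F \o @pt R n).
    by rewrite integralE funepos_comp funeneg_comp.
  by apply/funext => t; rewrite /F /= !patchE.
have FnE : int_Rn E (fun s => f (s *m M + b)) =
    fine (nnint (fun s => Fp (s *m M + b)%R) - nnint (fun s => Fn (s *m M + b)%R)).
  have EE (t : n.-tuple RT) : (t \in @pt R n @^-1` E) = (pt t *m M + b \in E').
    by apply/idP/idP; rewrite !inE => /EE'.
  rewrite /int_Rn /Rintegral integral_mkcond
    (_ : _ \_ _ = F \o (fun t => pt t *m M + b)).
    by rewrite integralE funepos_comp funeneg_comp.
  by apply/funext => t; rewrite /F /= !patchE EE.
have fp : nnint Fp \is a fin_num.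
  by have := integrable_pos_fin_num measurableT iF; rewrite funepos_comp.
have fn : nnint Fn \is a fin_num.
  by have := integrable_neg_fin_num measurableT iF; rewrite funeneg_comp.
have d0 : `|\det M| != 0 by rewrite normr_eq0; rewrite unitmxE unitfE in uM.
have scal G : rv_measurable G -> (forall s, (0 <= G s)%E) -> nnint G \is a fin_num ->
    nnint (fun s => G (s *m M + b)%R) = (`|\det M|^-1 * fine (nnint G))%:E.
  move=> mG G0 fG; rewrite EFinM fineK // (nnint_affine b uM mG G0) muleA -EFinM.
  by rewrite mulVf // mul1e.
rewrite FpE FnE !scal // -EFinB /= fineB // -mulrBr.
by rewrite mulrA mulfV // mul1r.
Qed.

Lemma bounded_measurable_affine n (M : 'M[R]_n) (b : 'rV[R]_n) (E E' : set 'rV[R]_n) :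
  bounded_measurable E -> measurable (@pt R n @^-1` E') ->
  (forall y, E' y -> exists2 s, E s & y = s *m M + b) -> bounded_measurable E'.
Proof.
move=> [mE [K EK]] mE' E'E; split => //.
exists (`|K| * \sum_i \sum_j `|M i j| + \sum_j `|b ord0 j|) => _ /E'E [s Es ->] j.
rewrite !mxE; apply: (le_trans (ler_normD _ _)); apply: lerD.
  apply: (le_trans (ler_norm_sum _ _ _)); rewrite mulr_sumr.
  apply: ler_sum => i _; rewrite normrM; apply: ler_pM => //.
    by apply: le_trans (EK _ Es i) (ler_norm _).
  by rewrite (bigD1 j) //= lerDl sumr_ge0.
by rewrite (bigD1 j) //= lerDl sumr_ge0.
Qed.

Lemma is_derive_line n (g : 'rV[R]_n -> R) (a v : 'rV[R]_n) (t dg : R) :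
  is_derive (a + t *: v) v g dg -> is_derive t 1 (fun t => g (a + t *: v)) dg.
Proof.
have E : (fun h : R => h^-1 *: ((fun t => g (a + t *: v)) (h *: 1 + t) - g (a + t *: v))) =
         (fun h : R => h^-1 *: (g (h *: v + (a + t *: v)) - g (a + t *: v))).
  apply/funext => h; congr (_ *: (g _ - _)).
  by rewrite scalerDl addrCA /GRing.scale /= mulr1.
by move=> [dg1 dg2]; split; [rewrite /derivable E|rewrite /derive E].
Qed.

Lemma continuous_affine_line n (a v : 'rV[R]_n) : continuous (fun t : R => a + t *: v).
Proof.
by move=> t; apply: cvgD; [exact: cvg_cst|apply: cvgZr_tmp; exact: cvg_id].
Qed.

Lemma row_mx_head n (x : R) (s : 'rV[R]_n) :
  (row_mx (x%:M : 'rV_1) s : 'rV_n.+1) ord0 ord0 = x.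
Proof. by rewrite mxE; case: splitP => // j _; rewrite (ord1 j) mxE mulr1n. Qed.

Lemma row_mx_tail n (x : R) (s : 'rV[R]_n) j :
  (row_mx (x%:M : 'rV_1) s : 'rV_n.+1) ord0 (lift ord0 j) = s ord0 j.
Proof.
rewrite mxE; case: splitP => [[[]]//|k /= kj].
by congr (s _ _); apply: val_inj; case: kj.
Qed.

Lemma row_mx_line n (x : R) (s : 'rV[R]_n) :
  row_mx (x%:M : 'rV_1) s =
  row_mx ((0 : R)%:M : 'rV_1) s + x *: (delta_mx ord0 ord0 : 'rV[R]_n.+1) :> 'rV_n.+1.
Proof.
apply/rowP => i; rewrite [in RHS]mxE [X in _ + X]mxE [X in _ * X]mxE eqxx /=.
case: (unliftP ord0 i) => [j ->|->].
  by rewrite !row_mx_tail mulr0 addr0.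
by rewrite !row_mx_head add0r mulr1.
Qed.

Lemma continuous_rV (T : topologicalType) n (f : T -> 'rV[R]_n) :
  (forall i, continuous (fun x => f x ord0 i)) -> continuous f.
Proof.
move=> cf x A [P fP PA].
have : \forall y \near x, forall i, P ord0 i (f y ord0 i).
  by apply: filter_forall => i; exact: cf (fP ord0 i).
by apply: filterS => y Py; apply: PA => i j; rewrite (ord1 i).
Qed.

Lemma continuous_mulmx_add m n (M : 'M[R]_(m, n)) (b : 'rV[R]_n) :
  continuous (fun s : 'rV[R]_m => s *m M + b).
Proof.
apply: continuous_rV => i.
have -> : (fun s : 'rV[R]_m => (s *m M + b) ord0 i) =
  (fun s => \sum_j s ord0 j * M j i + b ord0 i) by apply/funext => s; rewrite !mxE.
apply: (continuous_addr (f := fun s : 'rV[R]_m => \sum_j s ord0 j * M j i)).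
  apply: (continuous_sumr (f := fun j (s : 'rV[R]_m) => s ord0 j * M j i)) => j.
  apply: (continuous_mulr (f := fun s : 'rV[R]_m => s ord0 j)).
    exact: coord_continuous.
  exact: continuous_cstr.
exact: continuous_cstr.
Qed.

Lemma ref_simplex_bounded_measurable n : bounded_measurable (@ref_simplex R n).
Proof.
have cc (i : 'I_n) : continuous (fun s : 'rV[R]_n => s ord0 i) by exact: coord_continuous.
split.
  rewrite (_ : ref_simplex = [set s : 'rV[R]_n | forall i, `]0, +oo[%classic (s ord0 i)]
     `&` (fun s : 'rV[R]_n => \sum_i s ord0 i) @^-1` `]-oo, 1[%classic).
    apply: measurableI.
      by apply: (measurable_pt_box (B := fun=> `]0, +oo[%classic)).
    apply: (measurable_pt_open (U := (fun s : 'rV[R]_n => \sum_i s ord0 i) @^-1` `]-oo, 1[%classic)).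
    apply: open_comp; last exact: interval_open.
    by move=> s _; exact: (continuous_sumr (f := fun i (s : 'rV[R]_n) => s ord0 i)).
  apply/seteqP; split => s [/= s0 s1]; split => //=.
  - by move=> i; rewrite in_itv /= s0.
  - by move=> i; have := s0 i; rewrite in_itv /= andbT.
exists 1 => s [s0 s1] i; rewrite gtr0_norm //; apply: ltW (le_lt_trans _ s1).
by rewrite (bigD1 i) //= lerDl sumr_ge0 // => j _; exact: ltW.
Qed.

Lemma ref_simplex_cons n (x : R) (s : 'rV[R]_n) :
  ref_simplex (row_mx (x%:M : 'rV_1) s : 'rV_n.+1) <->
  ref_simplex s /\ 0 < x < 1 - \sum_i s ord0 i.
Proof.
have e0 := row_mx_head x s; have e1 := row_mx_tail x s.
have eS : \sum_i (row_mx (x%:M : 'rV_1) s : 'rV_n.+1) ord0 i = x + \sum_i s ord0 i.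
  by rewrite big_ord_recl e0; congr (_ + _); apply: eq_bigr => j _.
split => [[/= s0]|[[s0 s1] /andP[x0 x1]]].
  rewrite eS => s1.
  have x0 : 0 < x by rewrite -e0.
  have S0 j : 0 < s ord0 j by rewrite -e1.
  split; last by rewrite x0 /=; lra.
  by split => //; lra.
split; last by rewrite /= eS; lra.
by move=> i; case: (unliftP ord0 i) => [j ->|->]; rewrite ?e0 ?e1.
Qed.

(** Fubini: over each point of the lower-dimensional reference simplex the first
    variable runs through an interval, on which the fundamental theorem of
    calculus applies. *)
Lemma int_ref_partial0 n (g g' : 'rV[R]_n.+1 -> R) :
  continuous g -> continuous g' ->
  (forall x, is_derive x (delta_mx ord0 ord0) g (g' x)) ->
  int_Rn ref_simplex g' =
  int_Rn ref_simplex (fun s : 'rV[R]_n =>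
    g (row_mx ((1 - \sum_i s ord0 i)%:M : 'rV_1) s) - g (row_mx ((0 : R)%:M : 'rV_1) s)).
Proof.
move=> cg cg' dg.
have bE := @ref_simplex_bounded_measurable n.+1.
have mE : measurable (@pt R n.+1 @^-1` ref_simplex) by case: bE.
set X := @pt R n.+1 @^-1` ref_simplex in mE.
set f := EFin \o (g' \o @pt R n.+1).
have mf : measurable_fun setT f.
  by apply/measurable_EFinP; exact: measurable_continuous_pt.
have mtc := @measurable_tcons R n.
have mX' : measurable (@tcons R n @^-1` X).
  by rewrite -[X in measurable X]setTI; exact: mtc.
have intf : (leb \x lebesgue_tuple n)%E.-integrable (@tcons R n @^-1` X) (f \o @tcons R n).
  apply: measurable_bounded_integrable => //.
  - exact: (bounded_measurable_fin bE).
  - apply: (measurable_funS measurableT (@subsetT _ _)).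
    by apply: measurableT_comp mtc => //; exact: measurable_continuous_pt.
  - have [M HM] := bounded_continuous bE cg'.
    exists M; split; first by rewrite num_real.
    by move=> N MN t /HM; move/le_trans; apply; exact: ltW.
rewrite /int_Rn /Rintegral.
transitivity (fine (\int[pushforward (leb \x lebesgue_tuple n)%E (@tcons R n)]_(t in X) f t)).
  by [].
rewrite (integral_pushforward mtc mf intf mE).
rewrite integral_mkcond -integral21_prod_meas1; last first.
  by apply/integrable_restrict => //; rewrite setTI.
rewrite [in RHS]integral_mkcond; congr fine; apply: eq_integral => t _.
rewrite /fubini_G /= patchE.
set h := fun x : R => g' (row_mx (x%:M : 'rV_1) (pt t)).
set G := fun x : R => g (row_mx (x%:M : 'rV_1) (pt t)).
set b := 1 - \sum_i pt t ord0 i.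
have crow : continuous (fun x : R => row_mx (x%:M : 'rV_1) (pt t) : 'rV[R]_n.+1).
  under eq_fun do rewrite row_mx_line.
  exact: continuous_affine_line.
have ch : continuous h by move=> x; apply: continuous_comp; [exact: crow|exact: cg'].
have cG : continuous G by move=> x; apply: continuous_comp; [exact: crow|exact: cg].
have dG (x : R) : is_derive x 1 G (h x).
  rewrite (_ : G = fun x : R => g (row_mx ((0 : R)%:M : 'rV_1) (pt t) + x *: delta_mx ord0 ord0));
    last by apply/funext => y; rewrite /G row_mx_line.
  by apply: is_derive_line; rewrite -row_mx_line; exact: dg.
have mh A : measurable_fun A (EFin \o h).
  by apply/measurable_EFinP; apply: (measurable_funS measurableT) => //; exact: continuous_measurable_fun.
have [tE|tE] := boolP (t \in _); last first.
  apply: integral0_eq => x _; rewrite patchE ifF //; apply/negP; rewrite inE /X /= pt_tcons.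
  by move=> /ref_simplex_cons[/mem_set]; rewrite -[pt t \in _]/(t \in @pt R n @^-1` _) (negbTE tE).
have b0 : 0 < b by move: tE; rewrite inE /= => -[_]; rewrite /b subr_gt0.
transitivity (\int[leb]_(x in `]0%R, b[) (h x)%:E)%E.
  rewrite [RHS]integral_mkcond; apply: eq_integral => x _.
  rewrite !patchE /= (_ : f (tcons (x, t)) = (h x)%:E); last first.
    by rewrite /f /h /= pt_tcons.
  suff -> : ((x, t) \in @tcons R n @^-1` X) = (x \in `]0, b[%classic) by [].
  apply/idP/idP; rewrite !inE /X /= pt_tcons in_itv /=.
    by move=> /ref_simplex_cons[].
  by move=> xb; apply/ref_simplex_cons; split=> //; move: tE; rewrite inE.
rewrite integral_itv_bndo_bndc // integral_itv_obnd_cbnd //.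
rewrite (@continuous_FTC2 _ h G) //.
- exact: continuous_subspaceT.
- split=> [x _| |]; first by have [] := dG x.
  + by apply: cvg_at_right_filter; exact: cG.
  + by apply: cvg_at_left_filter; exact: cG.
- by move=> x _; rewrite derive1E; have [] := dG x.
Qed.

End IntegralOnBoundedSets.

(** * Barycentric coordinates *)

Section SumDelta.
Context {R : realType}.

Lemma sum_delta (I : finType) (W : lmodType R) (F : I -> W) a :
  \sum_l (l == a)%:R *: F l = F a.
Proof.
by rewrite (bigD1 a) //= eqxx scale1r big1 ?addr0 // => l /negbTE ->; rewrite scale0r.
Qed.

Lemma sum_deltaM (I : finType) (F : I -> R) a : \sum_l (l == a)%:R * F l = F a.
Proof. exact: (sum_delta (W := R^o)). Qed.

Lemma sum_delta1 (I : finType) (a : I) : \sum_l ((l == a)%:R : R) = 1.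
Proof. by rewrite -[RHS](sum_deltaM (fun=> 1) a); apply: eq_bigr => l _; rewrite mulr1. Qed.

Lemma csimplex_corner d m (p : 'I_m -> 'rV[R]_d) k : csimplex p (p k).
Proof.
exists (fun l => (l == k)%:R); split => [l||]; first exact: ler0n.
  exact: sum_delta1.
by rewrite sum_delta.
Qed.

End SumDelta.

Section BorderedDeterminants.
Context {R : realType}.

(** Locked, lest conversion unfold the block matrix in large goals. *)
Definition border d (a : R) (x : 'rV[R]_d) : 'rV[R]_d.+1 :=
  locked (row_mx (a%:M : 'rV_1) x).

Lemma border_head d a (x : 'rV[R]_d) : border a x ord0 ord0 = a.
Proof. by rewrite /border -lock; exact: row_mx_head. Qed.

Lemma border_tail d a (x : 'rV[R]_d) j : border a x ord0 (lift ord0 j) = x ord0 j.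
Proof. by rewrite /border -lock; exact: row_mx_tail. Qed.

Lemma border_inj d a b (x y : 'rV[R]_d) : border a x = border b y -> a = b /\ x = y.
Proof.
move=> E; split; first by rewrite -(border_head a x) E border_head.
by apply/rowP => j; rewrite -(border_tail a x) E border_tail.
Qed.

Lemma borderD d a b (x y : 'rV[R]_d) : border (a + b) (x + y) = border a x + border b y.
Proof.
apply/rowP => i; rewrite mxE.
by case: (unliftP ord0 i) => [j ->|->]; rewrite ?border_tail ?border_head ?mxE.
Qed.

Lemma borderZ d c a (x : 'rV[R]_d) : border (c * a) (c *: x) = c *: border a x.
Proof.
apply/rowP => i; rewrite mxE.
by case: (unliftP ord0 i) => [j ->|->]; rewrite ?border_tail ?border_head ?mxE.
Qed.

Lemma border_sum d (I : Type) (r : seq I) (a : I -> R) (x : I -> 'rV[R]_d) :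
  \sum_(i <- r) border (a i) (x i) = border (\sum_(i <- r) a i) (\sum_(i <- r) x i).
Proof.
elim: r => [|i r IH]; last by rewrite !big_cons IH -borderD.
rewrite !big_nil; apply/rowP => i; rewrite mxE.
by case: (unliftP ord0 i) => [j ->|->]; rewrite ?border_tail ?border_head ?mxE.
Qed.

Definition bordered m d (p : 'I_m -> 'rV[R]_d) : 'M[R]_(m, d.+1) :=
  \matrix_i border 1 (p i).

Lemma mul_bordered m d (p : 'I_m -> 'rV[R]_d) (c : 'rV[R]_m) :
  c *m bordered p = border (\sum_i c ord0 i) (\sum_i c ord0 i *: p i).
Proof.
rewrite mulmx_sum_row -border_sum; apply: eq_bigr => i _.
by rewrite rowK -{2}(mulr1 (c ord0 i)) borderZ.
Qed.

Definition set_row m d (i : 'I_m) (r : 'rV[R]_d) (A : 'M[R]_(m, d)) : 'M[R]_(m, d) :=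
  \matrix_k (if k == i then r else row k A).

(** The determinant of the bordered vertex matrix with row [i] replaced by [r].
    For [r = border 1 x] it is a multiple of a barycentric coordinate of [x];
    for [r = border 0 w] it is, up to sign and a constant, the product of [w]
    with the area vector of the facet opposite to [i]. *)
Definition coord_det d (p : 'I_d.+1 -> 'rV[R]_d) (i : 'I_d.+1) (r : 'rV[R]_d.+1) : R :=
  (r *m \adj (bordered p)) ord0 i.

Lemma coord_detE d (p : 'I_d.+1 -> 'rV[R]_d) i r :
  coord_det p i r = \det (set_row i r (bordered p)).
Proof.
rewrite /coord_det mxE (expand_det_row _ i); apply: eq_bigr => j _.
rewrite !mxE eqxx; congr (_ * _); rewrite /cofactor; congr (_ * \det _).
apply/matrixP => k l; rewrite !mxE.
by rewrite eq_sym (negbTE (neq_lift _ _)) !mxE.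
Qed.

Lemma coord_detD d (p : 'I_d.+1 -> 'rV[R]_d) i r r' :
  coord_det p i (r + r') = coord_det p i r + coord_det p i r'.
Proof. by rewrite /coord_det mulmxDl mxE. Qed.

Lemma coord_detZ d (p : 'I_d.+1 -> 'rV[R]_d) i c r :
  coord_det p i (c *: r) = c * coord_det p i r.
Proof. by rewrite /coord_det -scalemxAl mxE. Qed.

Lemma coord_det_mul d (p : 'I_d.+1 -> 'rV[R]_d) i (c : 'rV[R]_d.+1) :
  coord_det p i (c *m bordered p) = c ord0 i * \det (bordered p).
Proof. by rewrite /coord_det -mulmxA mul_mx_adj mul_mx_scalar mxE mulrC. Qed.

Lemma coord_det_sum d (p : 'I_d.+1 -> 'rV[R]_d) i (I : Type) (s : seq I) (r : I -> 'rV[R]_d.+1) :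
  coord_det p i (\sum_(k <- s) r k) = \sum_(k <- s) coord_det p i (r k).
Proof.
elim: s => [|k s IH]; last by rewrite !big_cons coord_detD IH.
by rewrite !big_nil /coord_det mul0mx mxE.
Qed.

Lemma coord_det_vertex d (p : 'I_d.+1 -> 'rV[R]_d) i k :
  coord_det p i (border 1 (p k)) = (i == k)%:R * \det (bordered p).
Proof.
have -> : border 1 (p k) = delta_mx ord0 k *m bordered p by rewrite -rowE rowK.
by rewrite coord_det_mul mxE eqxx /= eq_sym.
Qed.

Lemma det_bordered d (p : 'I_d.+1 -> 'rV[R]_d) : \det (bordered p) = \det (edges p).
Proof.
have e0 : lshift d (ord0 : 'I_1) = ord0 by exact: val_inj.
have e1 (j : 'I_d) : rshift 1 j = lift ord0 j by exact: val_inj.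
pose U : 'M[R]_(1 + d) := block_mx (1%:M : 'M[R]_1) 0 (const_mx (-1)) 1%:M.
have E : U *m bordered p = block_mx (1%:M : 'M[R]_1) (p ord0) 0 (edges p) :> 'M[R]_(1 + d).
  rewrite -[bordered p](@submxK _ 1 d 1 d) /U (@mulmx_block _ 1 d 1 d 1 d).
  rewrite !mul1mx !mul0mx !addr0; congr (@block_mx _ 1 d 1 d _ _ _ _).
  - apply/matrixP => i j; rewrite !ord1 !mxE /= e0 border_head //.
  - by apply/rowP => j; rewrite !mxE e1 border_tail e0.
  - by apply/matrixP => i j; rewrite !ord1 !mxE big_ord1 !mxE e0 !border_head mulr1 addNr.
  - apply/matrixP => i j; rewrite !mxE big_ord1 !mxE !e1 border_tail e0.
    by rewrite border_tail mulN1r addrC.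
have := congr1 determinant E.
by rewrite det_mulmx (det_lblock (1%:M : 'M[R]_1)) (det_ublock (1%:M : 'M[R]_1)) !det1 !mul1r.
Qed.

Lemma nondegenerateE d (p : 'I_d.+1 -> 'rV[R]_d) :
  Defs.nondegenerate p = (\det (bordered p) != 0).
Proof. by rewrite det_bordered /Defs.nondegenerate row_free_unit unitmxE unitfE. Qed.

(** Barycentric coordinates, by Cramer's rule. *)
Definition bcoord d (p : 'I_d.+1 -> 'rV[R]_d) (i : 'I_d.+1) (x : 'rV[R]_d) : R :=
  coord_det p i (border 1 x) / \det (bordered p).

Lemma bcoord_unique d (p : 'I_d.+1 -> 'rV[R]_d) (c : 'I_d.+1 -> R) i :
  \det (bordered p) != 0 -> \sum_i c i = 1 -> bcoord p i (\sum_i c i *: p i) = c i.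
Proof.
move=> p0 c1; rewrite /bcoord.
have -> : border 1 (\sum_i c i *: p i) = (\row_i c i) *m bordered p.
  rewrite mul_bordered -c1; congr border; apply: eq_bigr => k _; by rewrite mxE.
by rewrite coord_det_mul mxE mulfK.
Qed.

Lemma bcoordE d (p : 'I_d.+1 -> 'rV[R]_d) x : \det (bordered p) != 0 ->
  \sum_i bcoord p i x = 1 /\ x = \sum_i bcoord p i x *: p i.
Proof.
move=> p0.
have : border 1 x = (\row_i bcoord p i x) *m bordered p.
  rewrite (_ : \row_i _ = (\det (bordered p))^-1 *: (border 1 x *m \adj (bordered p))).
    by rewrite -scalemxAl -mulmxA mul_adj_mx mul_mx_scalar scalerA mulVf // scale1r.
  by apply/rowP => i; rewrite !mxE /bcoord /coord_det mulrC mxE.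
rewrite mul_bordered => /border_inj[e1 e2]; split.
  by rewrite [RHS]e1; apply: eq_bigr => i _; rewrite mxE.
by rewrite [LHS]e2; apply: eq_bigr => i _; rewrite mxE.
Qed.

Lemma bcoord_vertex d (p : 'I_d.+1 -> 'rV[R]_d) i k : \det (bordered p) != 0 ->
  bcoord p i (p k) = (i == k)%:R.
Proof. by move=> p0; rewrite /bcoord coord_det_vertex mulfK. Qed.

Lemma bcoord_line d (p : 'I_d.+1 -> 'rV[R]_d) i x w (t : R) :
  bcoord p i (x + t *: w) = bcoord p i x + t * (coord_det p i (border 0 w) / \det (bordered p)).
Proof.
rewrite /bcoord (_ : border 1 _ = border 1 x + t *: border 0 w).
  by rewrite coord_detD coord_detZ mulrDl mulrA.
by rewrite -borderZ -borderD mulr0 addr0.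
Qed.

Lemma bcoord_affine d (p : 'I_d.+1 -> 'rV[R]_d) i (I : Type) (r : seq I) (c : I -> R) (x : I -> 'rV[R]_d) :
  \sum_(k <- r) c k = 1 ->
  bcoord p i (\sum_(k <- r) c k *: x k) = \sum_(k <- r) c k * bcoord p i (x k).
Proof.
move=> c1; rewrite /bcoord.
have -> : border 1 (\sum_(k <- r) c k *: x k) = \sum_(k <- r) c k *: border 1 (x k).
  rewrite -{1}c1 -border_sum; apply: eq_bigr => k _.
  by rewrite -{1}(mulr1 (c k)) borderZ.
rewrite coord_det_sum mulr_suml; apply: eq_bigr => k _.
by rewrite coord_detZ mulrA.
Qed.

Lemma osimplexE d (p : 'I_d.+1 -> 'rV[R]_d) x : \det (bordered p) != 0 ->
  osimplex p x <-> forall i, 0 < bcoord p i x.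
Proof.
move=> p0; split => [[c [c0 c1 ->]] i|x0]; first by rewrite bcoord_unique.
by exists (fun i => bcoord p i x); split => //; case: (bcoordE x p0).
Qed.

Lemma csimplexE d (p : 'I_d.+1 -> 'rV[R]_d) x : \det (bordered p) != 0 ->
  csimplex p x <-> forall i, 0 <= bcoord p i x.
Proof.
move=> p0; split => [[c [c0 c1 ->]] i|x0]; first by rewrite bcoord_unique.
by exists (fun i => bcoord p i x); split => //; case: (bcoordE x p0).
Qed.

Lemma osimplex_csimplex m d (p : 'I_m -> 'rV[R]_d) : osimplex p `<=` csimplex p.
Proof. by move=> x [c [c0 c1 ->]]; exists c; split => // i; exact: ltW. Qed.

Lemma continuous_coord_det d (p : 'I_d.+1 -> 'rV[R]_d) i :
  continuous (fun x => coord_det p i (border 1 x)).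
Proof.
have -> : (fun x => coord_det p i (border 1 x)) =
  (fun x => coord_det p i (border 1 0) + \sum_j x ord0 j * coord_det p i (border 0 (delta_mx ord0 j))).
  apply/funext => x; rewrite {1}(_ : border 1 x = border 1 0 + \sum_j x ord0 j *: border 0 (delta_mx ord0 j)).
    rewrite coord_detD coord_det_sum; congr (_ + _); apply: eq_bigr => j _.
    by rewrite coord_detZ.
  under eq_bigr do rewrite -borderZ mulr0.
  by rewrite border_sum big1 // -borderD addr0 add0r -row_sum_delta.
apply: continuous_addr; first exact: (@cst_continuous _ _ (coord_det p i (border 1 0))).
apply: (continuous_sumr (f := fun j (x : 'rV[R]_d) => x ord0 j * coord_det p i (border 0 (delta_mx ord0 j)))) => j.
apply: (continuous_mulr (f := fun x : 'rV[R]_d => x ord0 j)); first exact: coord_continuous.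
exact: (@cst_continuous _ _ (coord_det p i (border 0 (delta_mx ord0 j)))).
Qed.

Lemma continuous_bcoord d (p : 'I_d.+1 -> 'rV[R]_d) i : continuous (bcoord p i).
Proof.
apply: (continuous_mulr (f := fun x => coord_det p i (border 1 x))).
  exact: continuous_coord_det.
exact: (@cst_continuous _ _ ((\det (bordered p))^-1)).
Qed.

Lemma near_bcoord_gt0 d (p : 'I_d.+1 -> 'rV[R]_d) i x : 0 < bcoord p i x ->
  \forall y \near x, 0 < bcoord p i y.
Proof.
move=> px.
have N : nbhs (bcoord p i x) [set u : R | 0 < u].
  by apply: open_nbhs_nbhs; split => //; exact: open_gt.
exact: (@continuous_bcoord _ p i x _ N).
Qed.

Lemma near_bcoord_lt0 d (p : 'I_d.+1 -> 'rV[R]_d) i x : bcoord p i x < 0 ->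
  \forall y \near x, bcoord p i y < 0.
Proof.
move=> px.
have N : nbhs (bcoord p i x) [set u : R | u < 0].
  by apply: open_nbhs_nbhs; split => //; exact: open_lt.
exact: (@continuous_bcoord _ p i x _ N).
Qed.

Lemma open_osimplex d (p : 'I_d.+1 -> 'rV[R]_d) : \det (bordered p) != 0 -> open (osimplex p).
Proof.
move=> p0; rewrite openE => x /(osimplexE _ p0) px.
have : \forall y \near x, forall i, 0 < bcoord p i y.
  by apply: (@filter_forall _ _ (fun i y => 0 < bcoord p i y) (nbhs x) _) => i; exact: near_bcoord_gt0.
by apply: filterS => y ?; apply/osimplexE.
Qed.

Lemma closed_csimplex d (p : 'I_d.+1 -> 'rV[R]_d) : \det (bordered p) != 0 -> closed (csimplex p).
Proof.
move=> p0 x cx; apply/(csimplexE _ p0) => i; rewrite leNgt; apply/negP => xi.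
have [y [/(csimplexE _ p0) py]] := cx _ (near_bcoord_lt0 xi).
by rewrite /= ltNge py.
Qed.

(** ** Parametrisation by the reference simplex *)

Definition bary n (s : 'rV[R]_n) : 'rV[R]_n.+1 := border (1 - \sum_i s ord0 i) s.

Lemma bary_head n (s : 'rV[R]_n) : bary s ord0 ord0 = 1 - \sum_i s ord0 i.
Proof. exact: border_head. Qed.

Lemma bary_tail n (s : 'rV[R]_n) j : bary s ord0 (lift ord0 j) = s ord0 j.
Proof. exact: border_tail. Qed.

Lemma bary_sum n (s : 'rV[R]_n) : \sum_i bary s ord0 i = 1.
Proof.
rewrite big_ord_recl bary_head -[RHS](subrK (\sum_i s ord0 i)); congr (_ + _).
by apply: eq_bigr => j _; exact: bary_tail.
Qed.

Lemma bary_gt0 n (s : 'rV[R]_n) : ref_simplex s <-> forall i, 0 < bary s ord0 i.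
Proof.
split => [[s0 s1] i|s0].
  by case: (unliftP ord0 i) => [j ->|->]; rewrite ?bary_tail ?bary_head ?subr_gt0.
split => [i|]; first by have := s0 (lift ord0 i); rewrite bary_tail.
by have := s0 ord0; rewrite bary_head subr_gt0.
Qed.

Definition spt n d (p : 'I_n.+1 -> 'rV[R]_d) (s : 'rV[R]_n) : 'rV[R]_d :=
  \sum_i bary s ord0 i *: p i.

Lemma sptE n d (p : 'I_n.+1 -> 'rV[R]_d) s : spt p s = p ord0 + s *m edges p.
Proof.
rewrite /spt big_ord_recl bary_head scalerBl scale1r scaler_suml -addrA; congr (_ + _).
rewrite mulmx_sum_row addrC -sumrB; apply: eq_bigr => i _.
by rewrite bary_tail -scalerBr; congr (_ *: _); apply/rowP => j; rewrite !mxE.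
Qed.

Lemma continuous_spt n d (p : 'I_n.+1 -> 'rV[R]_d) : continuous (spt p).
Proof.
rewrite (_ : spt p = fun s => s *m edges p + p ord0); first exact: continuous_mulmx_add.
by apply/funext => s; rewrite sptE addrC.
Qed.

Lemma osimplex_spt n d (p : 'I_n.+1 -> 'rV[R]_d) x :
  osimplex p x <-> exists2 s, ref_simplex s & x = spt p s.
Proof.
split=> [[c [c0 c1 ->]]|[s /bary_gt0 s0 ->]]; last first.
  by exists (fun i => bary s ord0 i); split => //; exact: bary_sum.
have bE i : bary (\row_(j < n) c (lift ord0 j)) ord0 i = c i.
  case: (unliftP ord0 i) => [j ->|->]; first by rewrite bary_tail mxE.
  rewrite bary_head -c1 big_ord_recl; under [X in _ - X]eq_bigr do rewrite mxE.
  by rewrite addrK.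
exists (\row_(j < n) c (lift ord0 j)); first by apply/bary_gt0 => i; rewrite bE.
by apply: eq_bigr => i _; rewrite bE.
Qed.

Lemma bcoord_spt d (p : 'I_d.+1 -> 'rV[R]_d) i s : \det (bordered p) != 0 ->
  bcoord p i (spt p s) = bary s ord0 i.
Proof. by move=> p0; rewrite bcoord_unique // bary_sum. Qed.

Lemma osimplex_spt_iff d (p : 'I_d.+1 -> 'rV[R]_d) s : \det (bordered p) != 0 ->
  ref_simplex s <-> osimplex p (spt p s).
Proof.
move=> p0; rewrite bary_gt0 (osimplexE _ p0).
by split => h i; have := h i; rewrite bcoord_spt.
Qed.

Lemma osimplex_bounded_measurable d (p : 'I_d.+1 -> 'rV[R]_d) :
  \det (bordered p) != 0 -> bounded_measurable (osimplex p).
Proof.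
move=> p0; apply: (bounded_measurable_affine (M := edges p) (b := p ord0)
  (@ref_simplex_bounded_measurable R d)).
  exact: measurable_pt_open (open_osimplex p0).
by move=> y /osimplex_spt[s rs ->]; exists s => //; rewrite sptE addrC.
Qed.

Lemma int_osimplex d (p : 'I_d.+1 -> 'rV[R]_d) (f : 'rV[R]_d -> R) :
  \det (bordered p) != 0 -> continuous f ->
  int_Rn (osimplex p) f = `|\det (bordered p)| * int_Rn ref_simplex (f \o spt p).
Proof.
move=> p0 cf.
have uE : edges p \in unitmx by rewrite unitmxE unitfE -det_bordered.
rewrite (int_Rn_affine (E := ref_simplex) uE (b := p ord0) (osimplex_bounded_measurable p0) cf).
  by rewrite det_bordered; congr (_ * _); apply: eq_int_Rn => s _; rewrite /= sptE addrC.
by move=> s; rewrite addrC -sptE; exact: osimplex_spt_iff.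
Qed.

(** ** Relabelling the vertices *)

Lemma bordered_perm m d (p : 'I_m -> 'rV[R]_d) (s : 'S_m) :
  bordered (p \o s) = row_perm s (bordered p).
Proof. by apply/matrixP => i j; rewrite !mxE. Qed.

Lemma det_row_perm m (s : 'S_m) (A : 'M[R]_m) : \det (row_perm s A) = (-1) ^+ s * \det A.
Proof. by rewrite row_permE det_mulmx det_perm. Qed.

Lemma osimplex_perm m d (p : 'I_m -> 'rV[R]_d) (s : 'S_m) : osimplex (p \o s) = osimplex p.
Proof.
have sub (q : 'I_m -> 'rV[R]_d) (t : 'S_m) : osimplex (q \o t) `<=` osimplex q.
  move=> x [c [c0 c1 ->]]; exists (fun i => c (invg t i)); split => [i| |]; first exact: c0.
    by rewrite -c1 [RHS](reindex_inj (@perm_inj _ (invg t))).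
  rewrite [RHS](reindex_inj (@perm_inj _ t)); apply: eq_bigr => i _ /=.
  by rewrite permK.
apply/seteqP; split; first exact: sub.
have := sub (p \o s) (invg s); congr (_ `<=` _); congr osimplex.
by apply/funext => i /=; rewrite permKV.
Qed.

Definition ref_vertex n (i : 'I_n.+1) : 'rV[R]_n :=
  if unlift ord0 i is Some j then delta_mx ord0 j else 0.

Lemma edges_ref_vertex n : edges (@ref_vertex n) = 1%:M.
Proof.
apply/matrixP => i j; rewrite !mxE /ref_vertex liftK unlift_none !mxE subr0.
by rewrite eqxx /= eq_sym.
Qed.

Lemma spt_ref_vertex n (s : 'rV[R]_n) : spt (@ref_vertex n) s = s.
Proof. by rewrite sptE edges_ref_vertex mulmx1 /ref_vertex unlift_none add0r. Qed.

Lemma osimplex_ref_vertex n : osimplex (@ref_vertex n) = ref_simplex.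
Proof.
apply/seteqP; split => [x /osimplex_spt[s rs ->]|s rs]; first by rewrite spt_ref_vertex.
by apply/osimplex_spt; exists s => //; rewrite spt_ref_vertex.
Qed.

Lemma spt_comp n d (p : 'I_n.+1 -> 'rV[R]_d) (q : 'I_n.+1 -> 'I_n.+1) s :
  spt (p \o q) s = spt p (spt (@ref_vertex n \o q) s).
Proof.
have vE (i : 'I_n.+1) : p i = p ord0 + ref_vertex i *m edges p.
  rewrite /ref_vertex; case: unliftP => [j ->|->]; last by rewrite mul0mx addr0.
  rewrite -rowE; apply/rowP => k; rewrite !mxE addrC subrK //.
rewrite [RHS]sptE /spt mulmx_suml.
under eq_bigr => i _ do rewrite /= vE scalerDr.
rewrite big_split /= -scaler_suml bary_sum scale1r; congr (_ + _).
by apply: eq_bigr => i _; rewrite scalemxAl.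
Qed.

(** Permuting the vertices is an affine map of the reference simplex onto itself,
    of determinant 1 or -1. *)
Lemma int_ref_perm n d (p : 'I_n.+1 -> 'rV[R]_d) (s : 'S_n.+1) (f : 'rV[R]_d -> R) :
  continuous f ->
  int_Rn ref_simplex (f \o spt (p \o s)) = int_Rn ref_simplex (f \o spt p).
Proof.
move=> cf.
have d1 : \det (bordered (@ref_vertex n \o s)) = (-1) ^+ s.
  by rewrite bordered_perm det_row_perm det_bordered edges_ref_vertex det1 mulr1.
have d0 : \det (bordered (@ref_vertex n \o s)) != 0 by rewrite d1 signr_eq0.
have cfp : continuous (f \o spt p).
  by move=> x; apply: continuous_comp; [exact: continuous_spt|exact: cf].
have := int_osimplex d0 cfp.
rewrite osimplex_perm osimplex_ref_vertex d1 normr_sign mul1r => ->.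
by apply: eq_int_Rn => x _ /=; rewrite [in LHS]spt_comp.
Qed.

End BorderedDeterminants.

(** * The divergence theorem on a simplex *)

Section DivergenceOnSimplex.
Context {R : realType}.

Definition smooth d (g : 'rV[R]_d -> R) : Prop :=
  (forall x, differentiable g x) /\ forall v, continuous (fun x => 'D_v g x).

Lemma smooth_continuous d (g : 'rV[R]_d -> R) : smooth g -> continuous g.
Proof. by move=> [dg _] x; exact: differentiable_continuous. Qed.

Lemma continuous_comp_spt n d (p : 'I_n.+1 -> 'rV[R]_d) (f : 'rV[R]_d -> R) :
  continuous f -> continuous (f \o spt p).
Proof. by move=> cf x; apply: continuous_comp; [exact: continuous_spt|exact: cf]. Qed.

Lemma is_derive_spt n d (p : 'I_n.+1 -> 'rV[R]_d) (g : 'rV[R]_d -> R) s (v : 'rV[R]_n) :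
  differentiable g (spt p s) ->
  is_derive s v (g \o spt p) ('D_(v *m edges p) g (spt p s)).
Proof.
move=> dg.
have E : (fun h : R => h^-1 *: ((g \o spt p) (h *: v + s) - (g \o spt p) s)) =
         (fun h : R => h^-1 *: (g (h *: (v *m edges p) + spt p s) - g (spt p s))).
  apply/funext => h /=; congr (_ *: (g _ - _)).
  by rewrite !sptE mulmxDl scalemxAl addrCA.
have dd : derivable g (spt p s) (v *m edges p) by exact: diff_derivable.
by split; [rewrite /derivable E|rewrite /derive E].
Qed.

Lemma int_edge_derivative01 n d (p : 'I_n.+2 -> 'rV[R]_d) (g : 'rV[R]_d -> R) : smooth g ->
  int_Rn ref_simplex (fun s : 'rV[R]_n.+1 => 'D_(p (lift ord0 ord0) - p ord0) g (spt p s)) =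
  int_Rn ref_simplex (g \o spt (p \o lift ord0)) -
  int_Rn ref_simplex (g \o spt (p \o lift (lift ord0 ord0))).
Proof.
move=> sg; have cg := smooth_continuous sg; case: sg => dg cdg.
have eE : (delta_mx ord0 ord0 : 'rV[R]_n.+1) *m edges p = p (lift ord0 ord0) - p ord0.
  by rewrite -rowE; apply/rowP => j; rewrite !mxE.
have dd (x : 'rV[R]_n.+1) : is_derive x (delta_mx ord0 ord0 : 'rV[R]_n.+1) (g \o spt p)
    ('D_(p (lift ord0 ord0) - p ord0) g (spt p x)).
  by rewrite -eE; exact: is_derive_spt.
have := int_ref_partial0 (continuous_comp_spt (p := p) cg) (continuous_comp_spt (p := p) (cdg _)) dd.
rewrite /comp => ->.
rewrite -int_RnB; last 3 first.
- exact: ref_simplex_bounded_measurable.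
- exact: (continuous_comp_spt (p := p \o lift ord0) cg).
- exact: (continuous_comp_spt (p := p \o lift (lift ord0 ord0)) cg).
apply: eq_int_Rn => s _ /=.
have b2 c : bary (row_mx (c%:M : 'rV_1) s : 'rV_n.+1) ord0 ord0 = 1 - c - \sum_i s ord0 i.
  rewrite bary_head big_ord_recl row_mx_head; under eq_bigr do rewrite row_mx_tail.
  by rewrite opprD addrA.
have b1 c : bary (row_mx (c%:M : 'rV_1) s : 'rV_n.+1) ord0 (lift ord0 ord0) = c.
  by rewrite bary_tail row_mx_head.
have bt c j : bary (row_mx (c%:M : 'rV_1) s : 'rV_n.+1) ord0 (lift ord0 (lift ord0 j)) = s ord0 j.
  by rewrite bary_tail row_mx_tail.
have sE c : spt p (row_mx (c%:M : 'rV_1) s) = (1 - c - \sum_i s ord0 i) *: p ord0 +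
   (c *: p (lift ord0 ord0) + \sum_j s ord0 j *: p (lift ord0 (lift ord0 j))).
  rewrite /spt !big_ord_recl b2 b1; congr (_ + (_ + _)).
  by apply: eq_bigr => j _; rewrite bt.
congr (g _ - g _); rewrite sE /spt big_ord_recl bary_head.
  rewrite subKr subrr scale0r add0r; congr (_ + _).
  by apply: eq_bigr => j _; rewrite bary_tail.
rewrite scale0r add0r subr0 /=; congr (_ *: p _ + _); first exact: val_inj.
apply: eq_bigr => j _; rewrite bary_tail; congr (_ *: p _); exact: val_inj.
Qed.

Lemma enum_perm m (T : eqType) (f g : 'I_m -> T) : injective g ->
  (forall i, exists k, f i = g k) -> injective f -> exists s : 'S_m, f =1 g \o s.
Proof.
move=> gI fg fI; have [h hE] := choice fg.
have hI : injective h by move=> i j hij; apply: fI; rewrite !hE hij.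
by exists (perm hI) => i /=; rewrite permE.
Qed.

Definition face_int n d (p : 'I_n.+2 -> 'rV[R]_d) (i : 'I_n.+2) (g : 'rV[R]_d -> R) : R :=
  int_Rn ref_simplex (g \o spt (p \o lift i)).

(** A renumbering moves the edge to the first coordinate axis of the reference
    simplex. *)
Lemma int_edge_derivative n d (p : 'I_n.+2 -> 'rV[R]_d) (g : 'rV[R]_d -> R) a b : smooth g ->
  int_Rn ref_simplex (fun s : 'rV[R]_n.+1 => 'D_(p b - p a) g (spt p s)) =
  face_int p a g - face_int p b g.
Proof.
move=> sg; have cg := smooth_continuous sg.
have [->|ab] := eqVneq a b.
  rewrite !subrr.
  transitivity (int_Rn (@ref_simplex R n.+1) (fun=> 0)).
    by apply: eq_int_Rn => s _; rewrite derive0.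
  by rewrite int_Rn_cst ?mul0r //; exact: ref_simplex_bounded_measurable.
pose i1 : 'I_n.+2 := lift ord0 ord0.
have [s s0 s1] : exists2 s : 'S_n.+2, s ord0 = a & s i1 = b.
  pose t := tperm ord0 a.
  exists (t * tperm (t i1) b)%g.
    rewrite permM tpermL tpermD // 1?eq_sym //.
    by rewrite -{1}(tpermL ord0 a : t ord0 = a) (inj_eq perm_inj) neq_lift.
  by rewrite permM tpermL.
have cD : continuous (fun x => 'D_(p b - p a) g x) by case: sg.
have := int_ref_perm p s cD; rewrite /comp => <-.
have := int_edge_derivative01 (p \o s) sg; rewrite /= s0 s1 => ->.
have faces c k : s k = c -> int_Rn ref_simplex (g \o spt ((p \o s) \o lift k)) = face_int p c g.
  move=> sk.
  have [u uE] : exists u : 'S_n.+1, s \o lift k =1 lift c \o u.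
    apply: enum_perm; first exact: lift_inj.
      move=> i; have : c != s (lift k i) by rewrite -sk (inj_eq perm_inj) neq_lift.
      by move=> /unlift_some[j jE _]; exists j.
    by move=> i j /perm_inj /lift_inj.
  rewrite /face_int -(int_ref_perm (p \o lift c) u cg).
  apply: eq_int_Rn => x _ /=; congr (g (spt _ x)).
  by apply/funext => i /=; have := uE i; rewrite /= => ->.
by rewrite (faces a) // (faces b).
Qed.

(** The direction [w] is a combination of edges with coefficients that sum up to
    0, and along an edge the integral of the derivative is the difference of two
    face integrals. *)
Lemma int_osimplex_derive n (p : 'I_n.+2 -> 'rV[R]_n.+1) (g : 'rV[R]_n.+1 -> R) w :
  \det (bordered p) != 0 -> smooth g ->
  int_Rn (osimplex p) (fun x => 'D_w g x) =
  - Num.sg (\det (bordered p)) * \sum_i coord_det p i (border 0 w) * face_int p i g.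
Proof.
move=> p0 sg; have [dg cdg] := sg.
rewrite int_osimplex //.
pose c := (\det (bordered p))^-1 *: (border 0 w *m \adj (bordered p)).
have cE i : coord_det p i (border 0 w) = \det (bordered p) * c ord0 i.
  by rewrite /c mxE mulrA mulfV // mul1r.
have [c0 wE] : 0 = \sum_i c ord0 i /\ w = \sum_i c ord0 i *: p i.
  by apply: border_inj; rewrite -mul_bordered /c -scalemxAl -mulmxA mul_adj_mx
    mul_mx_scalar scalerA mulVf // scale1r.
have wE' : w = \sum_i c ord0 i *: (p i - p ord0).
  by under eq_bigr do rewrite scalerBr; rewrite sumrB -scaler_suml -c0 scale0r subr0.
have -> : int_Rn ref_simplex ((fun x => 'D_w g x) \o spt p) =
  \sum_i c ord0 i * (face_int p ord0 g - face_int p i g).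
  transitivity (int_Rn ref_simplex (fun s : 'rV[R]_n.+1 =>
      \sum_i c ord0 i * 'D_(p i - p ord0) g (spt p s))).
    apply: eq_int_Rn => s _ /=; rewrite [in LHS]wE' deriveE // linear_sum /=.
    by apply: eq_bigr => i _; rewrite linearZ /= -deriveE.
  have bE := @ref_simplex_bounded_measurable R n.+1.
  have cD i : continuous (fun s : 'rV[R]_n.+1 => 'D_(p i - p ord0) g (spt p s)).
    exact: (continuous_comp_spt (p := p) (cdg (p i - p ord0))).
  rewrite (int_Rn_sum _ bE (f := fun i (s : 'rV[R]_n.+1) => c ord0 i * 'D_(p i - p ord0) g (spt p s))).
    by apply: eq_bigr => i _; rewrite int_RnZ // int_edge_derivative.
  by move=> i; apply: continuous_mulr (cD i); exact: continuous_cstr.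
under eq_bigr do rewrite mulrBr.
rewrite sumrB -mulr_suml -c0 mul0r sub0r mulrN mulNr; congr (- _).
under [in RHS]eq_bigr do rewrite cE -mulrA.
rewrite -mulr_sumr mulrA; congr (_ * _).
by rewrite normrEsg.
Qed.

End DivergenceOnSimplex.

(** * Facets of a regular partition *)

Section EuclideanProduct.
Context {R : realType}.

Lemma dotC p q (A B : 'M[R]_(p, q)) : dot A B = dot B A.
Proof. by apply: eq_bigr => i _; apply: eq_bigr => j _; rewrite mulrC. Qed.

Lemma dotBr p q (A B C : 'M[R]_(p, q)) : dot A (B - C) = dot A B - dot A C.
Proof.
rewrite -sumrB; apply: eq_bigr => i _; rewrite -sumrB; apply: eq_bigr => j _.
by rewrite !mxE mulrBr.
Qed.

Lemma dotZr p q (A B : 'M[R]_(p, q)) c : dot A (c *: B) = c * dot A B.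
Proof.
rewrite mulr_sumr; apply: eq_bigr => i _; rewrite mulr_sumr; apply: eq_bigr => j _.
by rewrite mxE mulrCA.
Qed.

Lemma dotZ p q (A B : 'M[R]_(p, q)) s t : dot (s *: A) (t *: B) = s * t * dot A B.
Proof. by rewrite dotZr dotC dotZr dotC mulrA [t * s]mulrC. Qed.

Lemma dot_ge0 p q (A : 'M[R]_(p, q)) : 0 <= dot A A.
Proof. by apply: sumr_ge0 => i _; apply: sumr_ge0 => j _; exact: sqr_ge0. Qed.

Lemma enorm_sqr p q (A : 'M[R]_(p, q)) : enorm A ^+ 2 = dot A A.
Proof. by rewrite /enorm sqr_sqrtr // dot_ge0. Qed.

Lemma enormZ p q (A : 'M[R]_(p, q)) c : enorm (c *: A) = `|c| * enorm A.
Proof. by rewrite /enorm dotZ -expr2 sqrtrM ?sqr_ge0 // sqrtr_sqr. Qed.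

End EuclideanProduct.

Section SimplexFacets.
Context {R : realType}.

Lemma ray_osimplex d (p : 'I_d.+1 -> 'rV[R]_d) i x w : \det (bordered p) != 0 ->
  (forall k, k != i -> 0 < bcoord p k x) -> bcoord p i x = 0 ->
  0 < coord_det p i (border 0 w) / \det (bordered p) ->
  \forall t \near 0^'+, osimplex p (x + t *: w).
Proof.
move=> p0 xk xi wi.
have : \forall t \near 0^'+, forall k, 0 < bcoord p k (x + t *: w).
  apply: (@filter_forall _ _ (fun k t => 0 < bcoord p k (x + t *: w)) (0^'+) _) => k.
  have [->|ki] := eqVneq k i.
    near=> t; rewrite bcoord_line xi add0r mulr_gt0 //; near: t; exact: nbhs_right_gt.
  apply: cvg_at_right_filter; first exact: cvg_id.
  have c : {for (0 : R), continuous (fun t : R => x + t *: w)}.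
    exact: continuous_affine_line.
  have N : nbhs (x + 0 *: w) [set y | 0 < bcoord p k y].
    by rewrite scale0r addr0; exact: near_bcoord_gt0 (xk k ki).
  exact: (c _ N).
by apply: filterS => t ?; apply/osimplexE.
Unshelve. all: by end_near. Qed.

(** The normal of the facet opposite to [i], neither normalised nor oriented. *)
Definition facet_normal d (p : 'I_d.+1 -> 'rV[R]_d) (i : 'I_d.+1) : 'rV[R]_d :=
  \row_l coord_det p i (border 0 (delta_mx ord0 l)).

Lemma dot_rV d (u v : 'rV[R]_d) : dot u v = \sum_l u ord0 l * v ord0 l.
Proof. by rewrite /dot big_ord1. Qed.

Lemma dot_facet_normal d (p : 'I_d.+1 -> 'rV[R]_d) i w :
  dot w (facet_normal p i) = coord_det p i (border 0 w).
Proof.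
rewrite dot_rV [in RHS](row_sum_delta w).
have -> : border 0 (\sum_j w ord0 j *: delta_mx ord0 j) =
  \sum_j w ord0 j *: border 0 (delta_mx ord0 j) :> 'rV[R]_d.+1.
  under [RHS]eq_bigr do rewrite -borderZ mulr0.
  by rewrite border_sum big1_eq.
rewrite coord_det_sum; apply: eq_bigr => l _.
by rewrite coord_detZ mxE.
Qed.

Lemma coord_det_edge d (p : 'I_d.+1 -> 'rV[R]_d) i x y :
  coord_det p i (border 0 (y - x)) = coord_det p i (border 1 y) - coord_det p i (border 1 x).
Proof.
by apply/eqP; rewrite eq_sym subr_eq -coord_detD -borderD add0r subrK.
Qed.

Lemma bcoord_sub d (p : 'I_d.+1 -> 'rV[R]_d) i x y :
  coord_det p i (border 0 (y - x)) / \det (bordered p) = bcoord p i y - bcoord p i x.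
Proof. by rewrite coord_det_edge mulrBl. Qed.

(** The vertex opposite to the facet is the one whose row gets replaced, so that
    its position does not matter. *)
Lemma coord_det_shared d (p p' : 'I_d.+1 -> 'rV[R]_d) (s : 'S_d.+1) i i' r :
  s i' = i -> (forall k, k != i' -> p' k = p (s k)) ->
  coord_det p' i' r = (-1) ^+ s * coord_det p i r.
Proof.
move=> si pp; rewrite !coord_detE -det_row_perm; congr (\det _).
apply/matrixP => k l; rewrite !mxE -si (inj_eq perm_inj).
by case: eqVneq => // ki; rewrite !mxE pp.
Qed.

End SimplexFacets.

Section LocalGeometry.
Context {R : realType} {n : nat}.
Local Notation V := 'rV[R]_n.+1.
Variables (Om : set V) (C : connectivity n.+2) (a : 'I_(nvert C) -> V).
Hypothesis reg : regular_partition Om a.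
Implicit Types (e f : 'I_(nsimp C)) (i k : 'I_n.+2) (x y : V).

Local Notation P e := (corners a e).

Lemma element_det e : \det (bordered (P e)) != 0.
Proof. by case: reg => _ _ nd _ _; rewrite -nondegenerateE; exact: nd. Qed.

Lemma simp_inj e : injective (simp (c := C) e).
Proof.
move=> i k ik; apply/eqP; apply: contraT => nik.
have := bcoord_vertex i i (element_det e); rewrite eqxx /corners ik.
rewrite -/(corners a e k) bcoord_vertex ?element_det // (negbTE nik) => /eqP.
by rewrite eq_sym oner_eq0.
Qed.

Lemma sum_simp (W : lmodType R) e (c : 'I_(nvert C) -> R) (F : 'I_(nvert C) -> W) :
  (forall l, c l != 0 -> exists i, l = simp e i) ->
  \sum_l c l *: F l = \sum_i c (simp e i) *: F (simp e i).
Proof.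
move=> supp.
transitivity (\sum_(l in simp (c := C) e @: [set: 'I_n.+2]%SET) c l *: F l).
  rewrite [LHS](bigID (mem (simp (c := C) e @: [set: 'I_n.+2]%SET))) /= [X in _ + X]big1 ?addr0 //.
  move=> l lN; have [->|/supp[i li]] := eqVneq (c l) 0; first by rewrite scale0r.
  by move: lN; rewrite li imset_f.
rewrite big_imset /=; first by apply: eq_bigl => i; rewrite inE.
by move=> i k _ _; exact: simp_inj.
Qed.

(** A point of two closed elements is a combination of their common vertices. *)
Lemma bcoord_shared e f x i : csimplex (P e) x -> csimplex (P f) x ->
  bcoord (P e) i x != 0 ->
  exists2 k, simp f k = simp e i & bcoord (P f) k x = bcoord (P e) i x.
Proof.
move=> ex fx; case: reg => _ _ _ _ [_ /(_ e f x ex fx)[c [c0 c1 xE supp]]].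
have bE g : (forall l, c l != 0 -> exists j, l = simp g j) ->
    forall j, bcoord (P g) j x = c (simp g j).
  move=> sg j; rewrite xE (sum_simp a sg) (bcoord_unique (c := c \o simp g)) ?element_det //.
  rewrite -c1; have := sum_simp (fun=> 1 : R^o) sg; rewrite /GRing.scale /=.
  by under eq_bigr do rewrite mulr1; move=> ->; under [in RHS]eq_bigr do rewrite mulr1.
have eb := bE e (fun l cl => (supp l cl).1).
have fb := bE f (fun l cl => (supp l cl).2).
rewrite eb => /supp[_ [k kE]]; exists k => //.
by rewrite fb -kE.
Qed.

(** Facets are compared by their vertex labels, which do not move. *)
Definition facet e i : {set 'I_(nvert C)} := simp e @: [set~ i]%SET.

Definition in_facet e i x : Prop :=
  (forall k, k != i -> 0 < bcoord (P e) k x) /\ bcoord (P e) i x = 0.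

Lemma in_facet_csimplex e i x : in_facet e i x -> csimplex (P e) x.
Proof.
move=> [xk xi]; apply/csimplexE; first exact: element_det.
by move=> k; have [->|/xk/ltW//] := eqVneq k i; rewrite xi.
Qed.

Lemma facet_center e i : exists x, in_facet e i x.
Proof.
pose c (k : 'I_n.+2) : R := if k == i then 0 else n.+1%:R^-1.
have c1 : \sum_k c k = 1.
  rewrite (bigD1 i) //= {1}/c eqxx add0r (eq_bigr (fun=> n.+1%:R^-1)) => [|k /negbTE ki].
    by rewrite sumr_const cardC1 card_ord /= -[LHS]mulr_natl mulfV // pnatr_eq0.
  by rewrite /c ki.
exists (\sum_k c k *: P e k); split => [k ki|]; rewrite bcoord_unique ?element_det // /c.
  by rewrite (negbTE ki) invr_gt0 ltr0n.
by rewrite eqxx.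
Qed.

Lemma facet_perm e i f k : facet e i = facet f k ->
  exists s : 'S_n.+2, s k = i /\ forall l, l != k -> simp e (s l) = simp f l.
Proof.
move=> ef.
have ex (l : 'I_n.+2) : exists j, if l == k then j = i else j != i /\ simp e j = simp f l.
  case: eqVneq => [_|lk]; first by exists i.
  have : simp f l \in facet e i by rewrite ef imset_f // !inE.
  by case/imsetP => j; rewrite !inE => ji ->; exists j.
have [h hE] := choice ex.
have hI : injective h.
  move=> l l' hh; have := hE l; have := hE l'; rewrite hh.
  case: (eqVneq l' k) => [->|lk']; case: (eqVneq l k) => [->|lk] //.
  - by move=> -> [/eqP].
  - by move=> [/eqP + _] ?.
  - by move=> [_ ->] [_] /simp_inj.
exists (perm hI); split; first by rewrite permE; have := hE k; rewrite eqxx.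
by move=> l lk; rewrite permE; have := hE l; rewrite (negbTE lk) => -[].
Qed.

Lemma in_facet_shared e i f k x : facet e i = facet f k -> in_facet e i x -> in_facet f k x.
Proof.
move=> ef xF; have [xk xi] := xF.
have [s [si sE]] := facet_perm ef.
pose c l := bcoord (P e) (s l) x.
have e1 := bcoordE x (element_det e).
have c1 : \sum_l c l = 1 by rewrite -[RHS]e1.1 [RHS](reindex_inj (@perm_inj _ s)).
have xE : x = \sum_l c l *: P f l.
  rewrite [LHS]e1.2 [LHS](reindex_inj (@perm_inj _ s)); apply: eq_bigr => l _.
  rewrite /c; have [->|lk] := eqVneq l k; first by rewrite si xi !scale0r.
  by rewrite /corners sE.
have cE l : bcoord (P f) l x = c l by rewrite [in LHS]xE bcoord_unique ?element_det.
split => [l lk|]; rewrite cE /c ?si //.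
by apply: xk; rewrite -si (inj_eq perm_inj).
Qed.

(** Otherwise a point of the common facet, moved a little towards the vertex of
    [f] opposite to it, would lie in both open elements. *)
Lemma opposite_sides e i f k : e != f -> facet e i = facet f k ->
  bcoord (P e) i (P f k) < 0.
Proof.
move=> ef eF; rewrite ltNge; apply/negP; rewrite le_eqVlt => /orP[/eqP v0|v0].
  have [s [si sE]] := facet_perm eF.
  have e1 := bcoordE (P f k) (element_det e).
  have := bcoord_vertex k k (element_det f); rewrite eqxx e1.2.
  rewrite bcoord_affine ?e1.1 // big1 => [/eqP|l _]; first by rewrite eq_sym oner_eq0.
  have [->|li] := eqVneq l i; first by rewrite -v0 mul0r.
  have lE : l = s (invg s l) by rewrite permKV.
  have lk : invg s l != k by apply: contra li => /eqP lk; rewrite lE lk si.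
  by rewrite {2}lE /corners sE // -/(corners a f _) bcoord_vertex ?element_det // eq_sym (negbTE lk) mulr0.
have [x xF] := facet_center e i.
have [[xk xi] [yk yi]] := (xF, in_facet_shared eF xF).
pose w := P f k - x.
have he : \forall t \near 0^'+, osimplex (P e) (x + t *: w).
  by apply: (ray_osimplex (element_det e) xk xi); rewrite bcoord_sub xi subr0.
have hf : \forall t \near 0^'+, osimplex (P f) (x + t *: w).
  apply: (ray_osimplex (element_det f) yk yi); rewrite bcoord_sub yi subr0.
  by rewrite bcoord_vertex ?element_det // eqxx ltr01.
have [t [te tf]] := @filter_ex _ (0 : R)^'+ _ _ (filterI he hf).
case: reg => _ _ _ _ [/(_ e f ef) + _].
by move=> /seteqP[h _]; exact: h _ (conj te tf).
Qed.

Lemma facet_inj e i k : facet e i = facet e k -> i = k.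
Proof.
move=> ik; apply/eqP; apply: contraT => nik.
have : simp e i \in facet e k by rewrite imset_f // !inE.
rewrite -ik => /imsetP[l]; rewrite !inE => li /simp_inj il.
by rewrite il eqxx in li.
Qed.

(** All vertices of the facet of [e] are vertices of [f], by [bcoord_shared];
    exactly one vertex of [f] is left over. *)
Lemma in_facet_element e i f x : in_facet e i x -> csimplex (P f) x ->
  exists k, facet f k = facet e i.
Proof.
move=> xF fx; have [xk xi] := xF.
have ex := in_facet_csimplex xF.
pose Q := [set l : 'I_n.+2 | simp f l \in facet e i]%SET.
have QE : simp f @: Q = facet e i.
  apply/setP => v; apply/imsetP/idP => [[l]|/imsetP[l]].
    by rewrite inE => ? ->.
  rewrite !inE => li ->.
  have [|j jE _] := @bcoord_shared e f x l ex fx; first by rewrite gt_eqF // xk.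
  by exists j; rewrite ?inE jE // imset_f // !inE.
have : #|~: Q| = 1%N.
  have := cardsC Q; rewrite -(card_imset Q (@simp_inj f)) QE card_imset; last exact: simp_inj.
  by rewrite cardsC1 card_ord -[X in _ = X]addn1 => /addnI.
move=> /eqP/cards1P[k kE]; exists k.
by rewrite -QE /facet -kE finset.setCK.
Qed.

Lemma near_csimplex x : \forall y \near x, forall f, csimplex (P f) y -> csimplex (P f) x.
Proof.
apply: (@filter_forall _ _ (fun f y => csimplex (P f) y -> csimplex (P f) x) (nbhs x) _) => f.
have [fx|fx] := pselect (csimplex (P f) x); first by near=> y.
have : nbhs x (~` csimplex (P f)).
  by apply: open_nbhs_nbhs; split=> //; exact/closed_openC/closed_csimplex/element_det.
by apply: filterS => y ? ?.
Unshelve. all: by end_near. Qed.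

Lemma osimplex_unique e f x : osimplex (P e) x -> osimplex (P f) x -> e = f.
Proof.
move=> ex fx; apply/eqP; apply: contraT => ef.
case: reg => _ _ _ _ [/(_ e f ef) + _].
by move=> /seteqP[h _]; have := h x (conj ex fx).
Qed.

Hypothesis poly : polytopal_domain Om.

Lemma polytopal_interior_closure : Om = (closure Om)°.
Proof.
case: poly => oOm _ _ _ [C0 [a0 [nd0 OmE]]].
apply/seteqP; split => [x Ox|].
  have : nbhs x Om by exact: open_nbhs_nbhs.
  by apply: filterS; exact: subset_closure.
rewrite {2}OmE; apply: interiorS.
have cl : closed (carrier a0).
  apply: closed_bigcup; first exact: finite_finset.
  move=> j _; apply: closed_csimplex; rewrite -nondegenerateE; exact: nd0.
move=> x cx; apply: cl => B /cx[y [Oy By]]; exists y; split => //.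
by move: Oy; rewrite OmE => /interior_subset.
Qed.

Lemma osimplex_domain e : osimplex (P e) `<=` Om.
Proof.
rewrite polytopal_interior_closure => x ex.
have : nbhs x (osimplex (P e)) by apply: open_nbhs_nbhs; split => //; exact/open_osimplex/element_det.
apply: filterS => y /osimplex_csimplex ey.
by case: reg => _ _ _ -> _; exists e.
Qed.

Lemma csimplex_closure e : csimplex (P e) `<=` closure Om.
Proof. by move=> x ex; case: reg => _ _ _ -> _; exists e. Qed.

Lemma near_facet_side e i x : in_facet e i x ->
  \forall y \near x, 0 < bcoord (P e) i y -> osimplex (P e) y.
Proof.
move=> [xk xi].
have : \forall y \near x, forall k, k != i -> 0 < bcoord (P e) k y.
  apply: (@filter_forall _ _ (fun k y => k != i -> 0 < bcoord (P e) k y) (nbhs x) _) => k.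
  have [->|ki] := eqVneq k i; first by near=> y.
  by have := near_bcoord_gt0 (xk k ki); apply: filterS => y ? _.
apply: filterS => y yk yi; apply/(osimplexE _ (element_det e)) => k.
by have [->//|/yk] := eqVneq k i.
Unshelve. all: by end_near. Qed.

(** All barycentric coordinates opposite to one facet are proportional, so that
    a third element would lie on the same side as one of the first two. *)
Lemma facet_at_most_two e i f k g l : e != f -> f != g -> e != g ->
  facet e i = facet f k -> facet e i = facet g l -> False.
Proof.
move=> ef fg eg EF EG.
have FG : facet f k = facet g l by rewrite -EF.
have [s [si sE]] := facet_perm EF.
have prop r : coord_det (P f) k r = (-1) ^+ s * coord_det (P e) i r.
  by apply: coord_det_shared si _ => j jk; rewrite /corners sE.
have p2 y : bcoord (P f) k y = bcoord (P f) k (P e i) * bcoord (P e) i y.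
  rewrite /bcoord !prop coord_det_vertex eqxx mul1r.
  rewrite -!mulrA; congr (_ * _).
  by rewrite [RHS]mulrCA [X in _ = _ * X]mulrCA mulfV ?element_det // mulr1 mulrC.
have h1 := opposite_sides eg EG.
have h2 := opposite_sides fg FG.
have h3 : bcoord (P f) k (P e i) < 0 by apply: opposite_sides; rewrite 1?eq_sym.
by have := nmulr_rgt0 (bcoord (P e) i (P g l)) h3; rewrite -p2 h1 ltNge (ltW h2).
Qed.

Definition has_partner e i := exists f k, f != e /\ facet f k = facet e i.

Lemma facet_normal_neq0 e i : facet_normal (P e) i != 0.
Proof.
apply/eqP => N0.
have [k ki] : exists k : 'I_n.+2, k != i.
  by exists (lift i ord0); rewrite eq_sym neq_lift.
have := dot_facet_normal (P e) i (P e i - P e k).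
rewrite N0 coord_det_edge !coord_det_vertex eqxx eq_sym (negbTE ki) mul0r subr0 mul1r.
rewrite dot_rV big1 => [/esym/eqP|l _]; last by rewrite !mxE mulr0.
by rewrite (negbTE (element_det e)).
Qed.

Lemma enorm_gt0 (w : V) : w != 0 -> 0 < enorm w.
Proof.
move=> w0; rewrite sqrtr_gt0 dot_rV lt_neqAle; apply/andP; split; last first.
  by apply: sumr_ge0 => i _; exact: sqr_ge0.
apply: contra w0; rewrite eq_sym psumr_eq0 => [|i _]; last exact: sqr_ge0.
move=> /allP h; apply/eqP/rowP => i; rewrite mxE; apply/eqP.
by have := h i (mem_index_enum _); rewrite mulf_eq0 orbb.
Qed.

(** Near a point of the facet, elements other than [e] are absent, so that the
    domain lies on the side of [e]; and it avoids the facet itself, because a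
    nonconstant affine function has no interior minimum. *)
Lemma boundary_facet_normal e i x : in_facet e i x -> ~ has_partner e i ->
  outer_normal Om x
    ((- Num.sg (\det (bordered (P e))) / enorm (facet_normal (P e) i)) *: facet_normal (P e) i).
Proof.
move=> xF np; set N := facet_normal _ _; set D := \det _.
have D0 : D != 0 := element_det e.
have N0 : 0 < enorm N by apply: enorm_gt0; exact: facet_normal_neq0.
have [xk xi] := xF.
split.
  by rewrite enormZ mulNr normrN normrM normr_sg D0 mul1r normfV gtr0_norm // mulVf // gt_eqF.
have dotE y : dot (y - x) ((- Num.sg D / enorm N) *: N) = - (`|D| / enorm N) * bcoord (P e) i y.
  rewrite dotZr dot_facet_normal.
  have -> : coord_det (P e) i (border 0 (y - x)) = D * bcoord (P e) i y.
    have := bcoord_sub (P e) i x y; rewrite xi subr0 => <-.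
    by rewrite mulrCA mulfV // mulr1.
  by rewrite (normrEsg D); ring.
have dotlt y : dot (y - x) ((- Num.sg D / enorm N) *: N) < 0 <-> 0 < bcoord (P e) i y.
  rewrite dotE mulNr oppr_lt0 pmulr_rgt0 //.
  by rewrite divr_gt0 // normr_gt0.
have only_e : \forall y \near x, closure Om y -> 0 <= bcoord (P e) i y.
  have := near_csimplex x; apply: filterS => y h.
  case: (reg) => _ _ _ -> _ [f _ fy].
  suff fe : f = e by move: fy; rewrite fe => /(csimplexE _ (element_det e)).
  apply: contrapT => /eqP fe; apply: np.
  by have [k kE] := in_facet_element xF (h f fy); exists f, k.
have inside : \forall y \near x, 0 < bcoord (P e) i y -> Om y.
  have := near_facet_side xF; apply: filterS => y h /h; exact: osimplex_domain.
have outside : \forall y \near x, Om y -> 0 < bcoord (P e) i y.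
  have := nbhs_interior only_e; apply: filterS => y hy Oy.
  have oOm : open Om by case: poly.
  have Ny : nbhs y (fun z => 0 <= bcoord (P e) i z).
    have : nbhs y Om by exact: open_nbhs_nbhs.
    move=> Oy'; apply: (filterS _ (filterI Oy' (hy : nbhs y _))) => z [Oz h].
    by apply: h; exact: subset_closure.
  rewrite lt_neqAle (nbhs_singleton Ny) andbT eq_sym; apply/eqP => y0.
  (* a zero of a nonconstant affine function is not a local minimum *)
  pose w := P e i - x.
  have sl : coord_det (P e) i (border 0 w) / D = 1.
    by rewrite bcoord_sub xi subr0 bcoord_vertex // eqxx.
  have : \forall t \near (0 : R)^'-, 0 <= bcoord (P e) i (y + t *: w).
    apply: cvg_at_left_filter; first exact: cvg_id.
    have N' : nbhs (y + 0 *: w) (fun z => 0 <= bcoord (P e) i z) by rewrite scale0r addr0.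
    exact: (@continuous_affine_line _ _ y w 0 _ N').
  move=> /(filterI (nbhs_left_lt (0 : R)))/filter_ex[t [t0]].
  by rewrite bcoord_line y0 add0r sl mulr1 leNgt => /negP.
apply: (filterS _ (filterI inside outside)) => y [h1 h2].
by rewrite dotlt; split; [exact: h2|exact: h1].
Qed.

End LocalGeometry.

(** * The interface inside the bulk mesh *)

Section Orientation.
Context {R : realType}.

Lemma orient_dot n (q : 'I_n.+1 -> 'rV[R]_n.+1) w :
  dot w (orient q) = \det (col_mx w (edges q) : 'M[R]_n.+1).
Proof.
rewrite dot_rV (expand_det_row (col_mx w (edges q) : 'M[R]_n.+1) ord0).
apply: eq_bigr => i _; congr (_ * _).
  rewrite (_ : ord0 = lshift n (ord0 : 'I_1)); last exact: val_inj.
  by rewrite (@col_mxEu _ 1 n).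
rewrite mxE (expand_det_row (col_mx (delta_mx 0 i : 'rV[R]_n.+1) (edges q) : 'M[R]_n.+1) ord0).
rewrite (bigD1 i) //= big1 ?addr0 => [|j ji].
  rewrite {1}(_ : ord0 = lshift n (ord0 : 'I_1)); last exact: val_inj.
  rewrite (@col_mxEu _ 1 n) mxE !eqxx mul1r /cofactor; congr (_ * \det _).
  apply/matrixP => k l; rewrite !mxE (_ : lift ord0 k = rshift 1 k); last exact: val_inj.
  by case: splitP => // [[[]]//].
rewrite {1}(_ : ord0 = lshift n (ord0 : 'I_1)); last exact: val_inj.
by rewrite (@col_mxEu _ 1 n) mxE (negbTE ji) andbF mul0r.
Qed.

Definition cons_vertex n (y : 'rV[R]_n.+1) (q : 'I_n.+1 -> 'rV[R]_n.+1) (k : 'I_n.+2) : 'rV[R]_n.+1 :=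
  if unlift ord0 k is Some j then q j else y.

(** A relabelling of the rows turns the bordered matrix into the one of which the
    orientation vector is the cofactor expansion. *)
Lemma dot_orient_coord_det n (q : 'I_n.+1 -> 'rV[R]_n.+1) y w :
  dot w (orient q) = - coord_det (cons_vertex y q) ord0 (border 0 w).
Proof.
pose p1 := cons_vertex (q ord0 + w) q.
have E : coord_det (cons_vertex y q) ord0 (border 0 w) = \det (bordered p1).
  have C0 z r : coord_det (cons_vertex y q) ord0 r = coord_det (cons_vertex z q) ord0 r.
    rewrite !coord_detE; congr (\det _); apply/matrixP => k l; rewrite !mxE.
    case: eqVneq => // k0; rewrite !mxE /cons_vertex.
    by case: unliftP k0 => // ->; rewrite eqxx.
  have vE z : coord_det (cons_vertex y q) ord0 (border 1 z) = \det (bordered (cons_vertex z q)).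
    have {1}-> : z = cons_vertex z q ord0 by rewrite /cons_vertex unlift_none.
    by rewrite (C0 z) coord_det_vertex eqxx mul1r.
  have -> : border 0 w = border 1 (q ord0 + w) - border 1 (q ord0) :> 'rV[R]_n.+2.
    by apply/eqP; rewrite eq_sym subr_eq -borderD add0r addrC.
  rewrite coord_detD -scaleN1r coord_detZ !vE.
  rewrite (determinant_alternate (i1 := ord0) (i2 := lift ord0 ord0)
     (A := bordered (cons_vertex (q ord0) q))) ?mulr0 ?addr0 //.
  by move=> l; rewrite !mxE /cons_vertex unlift_none liftK.
rewrite E orient_dot.
pose t : 'S_n.+2 := tperm ord0 (lift ord0 ord0).
have -> : \det (bordered p1) = - \det (bordered (p1 \o t)).
  by rewrite bordered_perm det_row_perm odd_tperm neq_lift expr1 mulN1r opprK.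
rewrite opprK det_bordered; congr (\det _).
apply/matrixP => k l; rewrite !mxE /= /t tpermL.
have t0 : p1 (lift ord0 ord0) = q ord0 by rewrite /p1 /cons_vertex liftK.
rewrite t0; case: splitP => [j|j] kj.
  have -> : k = ord0 by apply: ord_inj; rewrite kj (ord1 j).
  by rewrite tpermR /p1 /cons_vertex unlift_none !mxE (ord1 j) addrAC subrr add0r.
have -> : k = lift ord0 j by apply: ord_inj; rewrite kj.
rewrite tpermD ?neq_lift // ?(inj_eq lift_inj) //.
by rewrite /p1 /cons_vertex liftK !mxE.
Qed.

(** With [i] put in front, the numbering [h] is a permutation of all vertices,
    whose signature is the sign. *)
Lemma dot_orient_facet n (h : 'I_n.+1 -> 'I_n.+2) (i : 'I_n.+2) : injective h ->
  (forall k, h k != i) ->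
  exists b : bool, forall (p : 'I_n.+2 -> 'rV[R]_n.+1) w,
    dot w (orient (p \o h)) = (-1) ^+ b * coord_det p i (border 0 w).
Proof.
move=> hI hi.
pose g (k : 'I_n.+2) : 'I_n.+2 := if unlift ord0 k is Some j then h j else i.
have gI : injective g.
  move=> k l; rewrite /g; case: unliftP => [k' ->|->]; case: unliftP => [l' ->|->] //.
  - by move/hI => ->.
  - by move=> E; have := hi k'; rewrite E eqxx.
  - by move=> E; have := hi l'; rewrite -E eqxx.
exists (~~ odd_perm (perm gI)) => p w.
rewrite (dot_orient_coord_det (p \o h) 0).
rewrite (coord_det_shared (p := p) (s := perm gI) (i := i)).
- by case: (odd_perm _); rewrite ?expr1 ?expr0 ?mulN1r ?mul1r ?opprK.
- by rewrite permE /g unlift_none.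
- move=> k k0; rewrite permE /g /cons_vertex.
  by case: unliftP k0 => // ->; rewrite eqxx.
Qed.

Lemma involution_sum0 (X : finType) (A : pred X) (g : X -> X) (F : X -> R) :
  (forall x, A x -> [/\ A (g x), g (g x) = x & F (g x) = - F x]) -> \sum_(x | A x) F x = 0.
Proof.
move=> gA.
have E : \sum_(x | A x) F x = - \sum_(x | A x) F x.
  rewrite {1}(reindex_onto g g) => [|x /gA[]//].
  rewrite -sumrN; apply: eq_big => [x|x /andP[Agx /eqP ggx]].
    apply/andP/idP => [[Agx /eqP ggx]|Ax].
      by have [+ _ _] := gA _ Agx; rewrite ggx.
    by have [? -> _] := gA _ Ax; split.
  by have [Ax _ _] := gA _ Agx; rewrite ggx in Ax; have [] := gA x Ax.
by move/eqP: E; rewrite -addr_eq0 -mulr2n mulrn_eq0 /= => /eqP.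
Qed.

End Orientation.

Section SurfaceInMesh.
Context {R : realType} {n : nat}.
Local Notation V := 'rV[R]_n.+1.
Variables (Om : set V) (B : connectivity n.+2) (a : 'I_(nvert B) -> V).
Variables (C : connectivity n.+1) (q : 'I_(nvert C) -> V).
Hypothesis reg : regular_partition Om a.
Hypothesis poly : polytopal_domain Om.
Hypothesis clo : closed_surface q.
Hypothesis sub : carrier q `<=` Om.
Hypothesis ori : oriented q Om.
Hypothesis fit : fitted q a.
Implicit Types (e f : 'I_(nsimp B)) (i k : 'I_n.+2) (j : 'I_(nsimp C)) (x y : V).

Local Notation P e := (corners a e).
Local Notation Q j := (corners q j).
Let edet := element_det reg.

(** The numbering [h] is part of the relation, because orientation vectors
    depend on it through their sign. *)
Definition facet_of j e i (h : 'I_n.+1 -> 'I_n.+2) : Prop :=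
  [/\ injective h, forall k : 'I_n.+1, h k != i &
      forall k : 'I_n.+1, Q j k = P e (h k)].

Lemma surface_corners_inj j : injective (Q j).
Proof.
case: clo => _ _ /(_ j) nd _ _.
have inj1 (k l : 'I_n) : Q j (lift ord0 k) = Q j (lift ord0 l) -> k = l.
  move=> kl.
  have : delta_mx (ord0 : 'I_1) k *m edges (Q j) = delta_mx ord0 l *m edges (Q j).
    by rewrite -!rowE; apply/rowP => m; rewrite !mxE kl.
  move/(row_free_inj nd)/rowP/(_ k); rewrite !mxE !eqxx /=.
  by case: eqVneq => // _ /eqP; rewrite oner_eq0.
have inj0 (k : 'I_n) : Q j (lift ord0 k) <> Q j ord0.
  move=> k0.
  have : delta_mx (ord0 : 'I_1) k *m edges (Q j) = 0 *m edges (Q j).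
    by rewrite mul0mx -rowE; apply/rowP => m; rewrite !mxE k0 subrr.
  move/(row_free_inj nd)/rowP/(_ k); rewrite !mxE !eqxx /= => /eqP.
  by rewrite oner_eq0.
move=> k l; case: (unliftP ord0 k) => [k' ->|->]; case: (unliftP ord0 l) => [l' ->|->] //.
- by move/inj1 => ->.
- by move/inj0.
- by move/esym/inj0.
Qed.

Lemma fitted_facet j : exists e i h, facet_of j e i h.
Proof.
have [e [h hE]] := fit j.
have hI : injective h by move=> k l kl; apply: (surface_corners_inj (j := j)); rewrite !hE kl.
have : ~~ [forall i, i \in codom h].
  apply/negP => /forallP hS; have := card_codom hI; rewrite card_ord.
  have -> : #|codom h| = #|'I_n.+2| by apply: eq_card => i; rewrite hS.
  by rewrite card_ord => /eqP; rewrite eqn_leq ltnn.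
rewrite negb_forall => /existsP[i iN]; exists e, i, h; split => // k.
by apply: contra iN => /eqP <-; exact: codom_f.
Qed.

Lemma facet_of_image j e i h k : facet_of j e i h -> k != i -> exists l, h l = k.
Proof.
move=> [hI hi _] ki.
have : [set h l | l in [set: 'I_n.+1]]%SET = [set~ i]%SET.
  apply/eqP; rewrite eqEcard; apply/andP; split.
    by apply/fintype.subsetP => _ /imsetP[l _ ->]; rewrite !inE.
  by rewrite card_imset // cardsT cardsC1 !card_ord.
move/setP/(_ k); rewrite !inE ki => /imsetP[l _ ->]; by exists l.
Qed.

Lemma facet_of_bcoord j e i h x (c : 'I_n.+1 -> R) : facet_of j e i h ->
  \sum_l c l = 1 -> x = \sum_l c l *: Q j l ->
  bcoord (P e) i x = 0 /\ forall l, bcoord (P e) (h l) x = c l.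
Proof.
move=> fo c1 ->; have [hI hi hE] := fo.
have bE k : bcoord (P e) k (\sum_l c l *: Q j l) = \sum_l c l * (k == h l)%:R.
  rewrite bcoord_affine //; apply: eq_bigr => l _.
  by rewrite hE bcoord_vertex ?edet.
split => [|l]; rewrite bE.
  by apply: big1 => l _; rewrite eq_sym (negbTE (hi l)) mulr0.
rewrite (bigD1 l) //= eqxx mulr1 big1 ?addr0 // => l' l'l.
by rewrite (inj_eq hI) eq_sym (negbTE l'l) mulr0.
Qed.

Lemma sum_facet (W : lmodType R) j e i h x (F : 'I_n.+2 -> W) : facet_of j e i h ->
  bcoord (P e) i x = 0 ->
  \sum_k bcoord (P e) k x *: F k = \sum_l bcoord (P e) (h l) x *: F (h l).
Proof.
move=> fo xi; have [hI hi hE] := fo.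
rewrite (bigD1 i) //= xi scale0r add0r.
rewrite (reindex_onto h (fun k => odflt ord0 [pick l | h l == k])) /=.
  apply: eq_bigl => l; rewrite hi /=.
  by case: pickP => [l' /eqP/hI ->|/(_ l)]; rewrite ?eqxx.
move=> k /(facet_of_image fo)[l <-]; case: pickP => [l' /eqP //|/(_ l)].
by rewrite eqxx.
Qed.

Lemma facet_point j e i h x : facet_of j e i h -> bcoord (P e) i x = 0 ->
  \sum_l bcoord (P e) (h l) x = 1 /\ x = \sum_l bcoord (P e) (h l) x *: Q j l.
Proof.
move=> fo xi; have [hI hi hE] := fo; have [b1 bx] := bcoordE x (edet e); split.
  have := sum_facet (fun=> 1 : R^o) fo xi; rewrite /GRing.scale /=.
  by under eq_bigr do rewrite mulr1; rewrite b1 => ->; apply: eq_bigr => l _; rewrite mulr1.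
by rewrite [LHS]bx (sum_facet _ fo) //; apply: eq_bigr => l _; rewrite hE.
Qed.

Lemma osimplex_facet j e i h x : facet_of j e i h ->
  osimplex (Q j) x <-> in_facet a e i x.
Proof.
move=> fo; have [hI hi hE] := fo; split => [[c [c0 c1 xE]]|[xk xi]].
  have [bi bl] := facet_of_bcoord fo c1 xE.
  by split => // k /(facet_of_image fo)[l <-]; rewrite bl.
have [b1 bx] := facet_point fo xi.
by exists (fun l => bcoord (P e) (h l) x); split => // l; exact: xk.
Qed.

Lemma csimplex_facet j e i h x : facet_of j e i h -> csimplex (Q j) x ->
  csimplex (P e) x /\ bcoord (P e) i x = 0.
Proof.
move=> fo [c [c0 c1 xE]]; have [bi bl] := facet_of_bcoord fo c1 xE.
split=> //; apply/(csimplexE _ (edet e)) => k.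
by have [->|/(facet_of_image fo)[l <-]] := eqVneq k i; rewrite ?bi // bl.
Qed.

Lemma facet_of_labels j e i h : facet_of j e i h ->
  facet (C := B) e i = [set l | [exists k, a l == Q j k]]%SET.
Proof.
move=> fo; have [hI hi hE] := fo; case: (reg) => aI _ _ _ _.
apply/setP => l; rewrite inE; apply/imsetP/existsP => [[k]|[k /eqP lk]].
  by rewrite !inE => /(facet_of_image fo)[m <-] ->; exists m; rewrite hE.
by exists (h k); rewrite ?inE ?hi //; apply: aI; rewrite lk hE.
Qed.

(** A surface point has a vanishing barycentric coordinate in some element, and
    nonzero coordinates are shared between elements. *)
Lemma osimplex_off_surface e x : osimplex (P e) x -> ~ carrier q x.
Proof.
move=> ex [j _ jx]; have [f [i [h fo]]] := fitted_facet j.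
have [fx fi] := csimplex_facet fo jx.
have ek k : bcoord (P e) k x != 0 by rewrite gt_eqF //; exact: (osimplexE _ (edet e)).1 ex k.
have H k : exists l, simp f l = simp e k /\ bcoord (P f) l x = bcoord (P e) k x.
  by have [l ? ?] := bcoord_shared reg (osimplex_csimplex ex) fx (ek k); exists l.
have [g gE] := choice H.
have gI : injective g.
  by move=> k l kl; apply: (simp_inj reg (e := e)); rewrite -(gE k).1 -(gE l).1 kl.
have [g' _ g'K] := injF_bij gI.
have := (gE (g' i)).2; rewrite g'K fi => /esym/eqP.
by rewrite (negbTE (ek _)).
Qed.

Lemma near_off_surface x : ~ carrier q x -> \forall y \near x, ~ carrier q y.
Proof.
move=> xN.
have : \forall y \near x, forall j, ~ csimplex (Q j) y.
  apply: (@filter_forall _ _ (fun j y => ~ csimplex (Q j) y) (nbhs x) _) => j.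
  have [e [i [h fo]]] := fitted_facet j.
  have [ex|ex] := pselect (csimplex (P e) x); last first.
    have : nbhs x (~` csimplex (P e)).
      by apply: open_nbhs_nbhs; split=> //; exact/closed_openC/closed_csimplex/edet.
    by apply: filterS => y ye /(csimplex_facet fo)[].
  have xi : 0 < bcoord (P e) i x.
    rewrite lt_neqAle ((csimplexE _ (edet e)).1 ex) andbT; apply/eqP => xi.
    apply: xN; exists j => //; have [hI hi hE] := fo.
    exists (fun l => bcoord (P e) (h l) x).
    have [b1 bx] := facet_point fo (esym xi).
    by split => // l; exact: (csimplexE _ (edet e)).1 ex (h l).
  have := near_bcoord_gt0 xi; apply: filterS => y yi /(csimplex_facet fo)[_ yi0].
  by rewrite yi0 ltxx in yi.
by apply: filterS => y h [j _ jy]; exact: h jy.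
Qed.

Lemma enclosed_segment x y : (forall t, 0 <= t <= 1 -> ~ carrier q (x + t *: (y - x))) ->
  enclosed q x <-> enclosed q y.
Proof.
move=> off.
have xy : connected_component (~` carrier q) x y.
  exists ((fun t : R => x + t *: (y - x)) @` `[0, 1]).
    split.
    - by exists 0; rewrite ?scale0r ?addr0 //= in_itv /= lexx ler01.
    - by move=> _ [t /= t01 <-]; apply: off; move: t01; rewrite in_itv.
    - apply: connected_continuous_connected; first exact: segment_connected.
      by apply: continuous_subspaceT; exact: continuous_affine_line.
  by exists 1; rewrite ?scale1r 1?addrC ?subrK //= in_itv /= lexx ler01.
have E := same_connected_component xy.
have x0 : ~ carrier q x by have := off 0; rewrite scale0r addr0; apply; rewrite lexx ler01.
have y0 : ~ carrier q y by have := off 1; rewrite scale1r addrC subrK; apply; rewrite lexx ler01.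
by rewrite /enclosed /= E; split=> -[_ ?]; split.
Qed.

Lemma osimplex_segment e x y t : osimplex (P e) x -> osimplex (P e) y -> 0 <= t <= 1 ->
  osimplex (P e) (x + t *: (y - x)).
Proof.
move=> /(osimplexE _ (edet e)) ex /(osimplexE _ (edet e)) ey /andP[t0 t1].
apply/(osimplexE _ (edet e)) => k; rewrite bcoord_line bcoord_sub.
have [->|tn0] := eqVneq t 0; first by rewrite mul0r addr0.
rewrite (_ : _ + _ = (1 - t) * bcoord (P e) k x + t * bcoord (P e) k y); last by ring.
apply: ltr_wpDl; first by apply: mulr_ge0; [rewrite subr_ge0|exact: ltW].
by apply: mulr_gt0 => //; rewrite lt_neqAle eq_sym tn0.
Qed.

Definition minus_element e : bool := `[< osimplex (P e) `<=` Om_minus q Om >].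

(** An open element is convex and avoids the surface, so that it lies on one side. *)
Lemma element_phase e x : osimplex (P e) x ->
  (Om_minus q Om x <-> minus_element e) /\ (Om_plus q Om x <-> ~~ minus_element e).
Proof.
move=> ex.
have all_enc y : osimplex (P e) y -> enclosed q x <-> enclosed q y.
  move=> ey; apply: enclosed_segment => t t01; apply: (osimplex_off_surface (e := e)).
  exact: osimplex_segment.
have xO : Om x := osimplex_domain reg poly ex.
have xN : ~ carrier q x := osimplex_off_surface ex.
have mE : minus_element e <-> enclosed q x.
  split=> [/asboolP h|xe]; first by have [] := h x ex.
  apply/asboolP => y ey; split; first exact: osimplex_domain ey.
  exact/(all_enc y ey).
split; first by rewrite mE; split=> [[]//|?]; split.
split=> [[_ xe]|/negP xe]; first by apply/negP => /mE ?; apply: xe; right.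
by split => // -[//|/mE].
Qed.

Lemma two_sided_facet e i f k x w : e != f -> facet e i = facet f k -> in_facet a e i x ->
  (coord_det (P f) k (border 0 w) / \det (bordered (P f)) < 0 <->
   0 < coord_det (P e) i (border 0 w) / \det (bordered (P e))).
Proof.
move=> ef EF xF.
have [s [si sE]] := facet_perm reg EF.
have prop r : coord_det (P f) k r = (-1) ^+ s * coord_det (P e) i r.
  by apply: coord_det_shared si _ => j jk; rewrite /corners sE.
have h3 := opposite_sides reg ef EF.
pose c := bcoord (P e) i (P f k).
have cE : c * ((-1) ^+ s * \det (bordered (P e))) = \det (bordered (P f)).
  have := prop (border 1 (P f k)); rewrite coord_det_vertex eqxx mul1r => ->.
  by rewrite /c /bcoord mulrCA divfK ?edet.
have s0 : (-1) ^+ s != 0 :> R by rewrite signr_eq0.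
have frac (u X c' D : R) : u != 0 -> c' != 0 -> D != 0 -> u * X / (c' * (u * D)) = c'^-1 * (X / D).
  by move=> u0 c0 D0; field; rewrite u0 c0 D0.
have c0 : c != 0 by rewrite lt_eqF.
rewrite prop -cE frac ?edet //.
by rewrite nmulr_rlt0 // invr_lt0.
Qed.

Lemma facet_of_shared j e i f k h : facet_of j e i h -> facet e i = facet f k ->
  exists h', facet_of j f k h'.
Proof.
move=> [hI hi hE] EF; have [s [si sE]] := facet_perm reg EF.
exists (fun m => invg s (h m)); split => [m m' /perm_inj /hI //|m|m].
  by rewrite -(inj_eq (@perm_inj _ s)) permKV si.
rewrite hE /corners -sE ?permKV //.
by rewrite -(inj_eq (@perm_inj _ s)) permKV si.
Qed.

Lemma orient_facet_of j e i h : facet_of j e i h ->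
  exists b : bool, forall w, dot w (orient (Q j)) = (-1) ^+ b * coord_det (P e) i (border 0 w).
Proof.
move=> [hI hi hE]; have [b bE] := dot_orient_facet (R := R) hI hi.
exists b => w; rewrite -bE; congr (dot _ (orient _)).
by apply/funext.
Qed.

Lemma orient_surface_gt0 j : 0 < enorm (orient (Q j)).
Proof.
have [e [i [h fo]]] := fitted_facet j.
apply: enorm_gt0; apply/eqP => o0.
have [b bE] := orient_facet_of fo.
have [k ki] : exists k : 'I_n.+2, k != i by exists (lift i ord0); rewrite eq_sym neq_lift.
have := bE (P e i - P e k).
rewrite o0 dot_rV big1 => [|l _]; last by rewrite [X in _ * X]mxE mulr0.
rewrite coord_det_edge !coord_det_vertex eqxx eq_sym (negbTE ki) mul0r subr0 mul1r.
by move/esym/eqP; rewrite mulf_eq0 signr_eq0 (negbTE (edet e)).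
Qed.

(** A surface simplex lies inside the domain, hence between two elements; a small
    step along the unit normal enters the outer one, a step back the inner one. *)
Lemma surface_sides j : exists e i f k h, [/\ facet_of j e i h, e != f, facet e i = facet f k,
   minus_element e /\ ~~ minus_element f &
   coord_det (P e) i (border 0 (orient (Q j))) / \det (bordered (P e)) < 0].
Proof.
have [e0 [i0 [h0 fo0]]] := fitted_facet j.
have [x xF] := facet_center reg e0 i0.
have xq : osimplex (Q j) x by exact/(osimplex_facet _ fo0).
have xO : Om x by apply: sub; exists j => //; exact: osimplex_csimplex.
have [e1 [i1 [e1e0 EF]]] : has_partner e0 i0.
  apply: contrapT => np; have [_] := boundary_facet_normal reg poly xF np.
  by move/nbhs_singleton; rewrite subrr dot_rV big1 ?ltxx => [[/(_ xO)]|l _]; rewrite ?mxE ?mul0r.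
have x1F : in_facet a e1 i1 x by apply: (in_facet_shared reg _ xF); rewrite EF.
have A0 := orient_surface_gt0 j.
set A := orient (Q j) in A0 *.
have claim e i f k : e != f -> facet e i = facet f k -> in_facet a e i x -> in_facet a f k x ->
    coord_det (P e) i (border 0 A) / \det (bordered (P e)) < 0 ->
    minus_element e /\ ~~ minus_element f.
  move=> ef EFk xe xf se.
  have borderN (w : V) c : border 0 (c *: w) = c *: border 0 w by rewrite -borderZ mulr0.
  have sf : 0 < coord_det (P f) k (border 0 A) / \det (bordered (P f)).
    by apply/(two_sided_facet A (e := f) (f := e) _ (esym EFk) xf); rewrite // eq_sym.
  have [[xek xei] [xfk xfi]] := (xe, xf).
  have re : \forall t \near 0^'+, osimplex (P e) (x + t *: (- unit_normal (Q j))).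
    apply: (ray_osimplex (edet e) xek xei).
    rewrite /unit_normal -scaleNr borderN coord_detZ -mulrA mulNr oppr_gt0.
    by rewrite pmulr_rlt0 // invr_gt0.
  have rf : \forall t \near 0^'+, osimplex (P f) (x + t *: unit_normal (Q j)).
    apply: (ray_osimplex (edet f) xfk xfi).
    by rewrite /unit_normal borderN coord_detZ -mulrA pmulr_rgt0 // invr_gt0.
  have [t [[te tf] [tp tm]]] := @filter_ex _ (0 : R)^'+ _ _ (filterI (filterI re rf) (ori xq)).
  split.
    by apply/(element_phase te).1; rewrite scalerN.
  by apply/(element_phase tf).2.
have [b bE] := orient_facet_of fo0.
have se0 : coord_det (P e0) i0 (border 0 A) / \det (bordered (P e0)) != 0.
  rewrite mulf_eq0 invr_eq0 (negbTE (edet e0)) orbF; apply/eqP => c0.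
  have := bE A; rewrite c0 mulr0 => AA0.
  by move: A0; rewrite /enorm AA0 sqrtr0 ltxx.
have [sneg|spos] : coord_det (P e0) i0 (border 0 A) / \det (bordered (P e0)) < 0 \/
   0 < coord_det (P e0) i0 (border 0 A) / \det (bordered (P e0)).
- by case: ltgtP se0 => //; auto.
- have e01 : e0 != e1 by rewrite eq_sym.
  exists e0, i0, e1, i1, h0; split => //.
  exact: (claim e0 i0 e1 i1 e01 (esym EF) xF x1F sneg).
have [h1 fo1] := facet_of_shared fo0 (esym EF).
exists e1, i1, e0, i0, h1.
have s1 : coord_det (P e1) i1 (border 0 A) / \det (bordered (P e1)) < 0.
  by apply/(two_sided_facet A (e := e0) (f := e1) _ (esym EF) xF); rewrite // eq_sym.
by split => //; exact: (claim e1 i1 e0 i0 e1e0 EF x1F xF s1).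
Qed.

(** The phase can only change across the surface; and a surface simplex that
    meets the relative interior of a facet is that facet. *)
Lemma surface_between e i f k : minus_element e -> ~~ minus_element f -> e != f ->
  facet e i = facet f k -> exists j h, facet_of j e i h.
Proof.
move=> me mf ef EF.
have [x xF] := facet_center reg e i.
have xf : in_facet a f k x := in_facet_shared reg EF xF.
have [[xk xi] [yk yi]] := (xF, xf).
(* a short segment from one element to the other through the facet would
   otherwise stay away from the surface *)
have xq : carrier q x.
  apply: contrapT => xN.
  have walk g l : in_facet a g l x -> exists y, osimplex (P g) y /\ (enclosed q x <-> enclosed q y).
    move=> [zk zl]; pose w := P g l - x.
    have r : \forall t \near 0^'+, osimplex (P g) (x + t *: w).
      apply: (ray_osimplex (edet g) zk zl).
      by rewrite bcoord_sub zl subr0 bcoord_vertex ?edet // eqxx ltr01.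
    have N : nbhs (x + (0 : R) *: w) (fun y => ~ carrier q y).
      by rewrite scale0r addr0; exact: near_off_surface.
    have /nbhs_ballP[d /= d0 hd] := @continuous_affine_line _ _ x w 0 _ N.
    have [t [[t0 td] tg]] := @filter_ex _ (0 : R)^'+ _ _
      (filterI (filterI (nbhs_right_gt (0 : R)) (nbhs_right_lt d0)) r).
    exists (x + t *: w); split => //.
    apply: enclosed_segment => u /andP[u0 u1].
    rewrite addrAC subrr add0r scalerA; apply: hd.
    rewrite /ball /= sub0r normrN ger0_norm ?mulr_ge0 ?(ltW t0) //.
    by apply: le_lt_trans td; rewrite ler_piMl // ltW.
  have [y [ye exy]] := walk e i xF; have [z [zf fxz]] := walk f k xf.
  have [mE _] := element_phase ye; have [mF _] := element_phase zf.
  have [_ ey] : Om_minus q Om y by exact/mE.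
  have : Om_minus q Om z.
    split; first exact: osimplex_domain zf.
    exact/fxz/exy.
  by move/mF; rewrite (negbTE mf).
case: xq => j _ jx.
have [e0 [i0 [h0 fo0]]] := fitted_facet j.
have [e0x i0x] := csimplex_facet fo0 jx.
have inc : facet e i \subset facet e0 i0.
  apply/fintype.subsetP => _ /imsetP[l + ->]; rewrite !inE => li.
  have ex := in_facet_csimplex reg xF.
  have [|m mE mb] := bcoord_shared reg ex e0x (i := l); first by rewrite gt_eqF // xk.
  rewrite -mE imset_f // !inE; apply/eqP => mi0.
  by have := xk l li; rewrite -mb mi0 i0x ltxx.
have EF0 : facet e0 i0 = facet e i.
  apply/esym/eqP; rewrite eqEcard inc /= !card_imset; [|exact: (simp_inj reg)..].
  by rewrite !cardsC1.
have [h fo] := facet_of_shared fo0 EF0.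
by exists j, h.
Qed.

Section FluxSums.
Variables (b : 'I_(nvert B) -> V) (qb : 'I_(nvert C) -> V).
Variables (w : 'I_(nsimp B) -> 'I_n.+2 -> V) (wS : 'I_(nsimp C) -> V).
Hypothesis w_shared : forall e i f k, facet e i = facet f k -> w e i = w f k.
Hypothesis w_bdry : forall e i, ~ has_partner (C := B) e i ->
  coord_det (corners b e) i (border 0 (w e i)) = 0.
Hypothesis w_surf : forall j e i h, facet_of j e i h ->
  w e i = wS j /\ corners qb j = corners b e \o h.

(** The outward flux of [w] through a facet of the mesh with vertex positions
    [b].  The sign is read off the mesh [a]: along a mesh motion the elements
    keep their orientation. *)
Definition flux e i : R :=
  - Num.sg (\det (bordered (P e))) * coord_det (corners b e) i (border 0 (w e i)).

Lemma flux_opposite e i f k : e != f -> facet e i = facet f k -> flux e i = - flux f k.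
Proof.
move=> ef EF.
have [s [si sE]] := facet_perm reg EF.
have prop (c : 'I_(nvert B) -> V) r : coord_det (corners c f) k r = (-1) ^+ s * coord_det (corners c e) i r.
  by apply: coord_det_shared si _ => j jk; rewrite /corners sE.
have h3 := opposite_sides reg ef EF.
have sg : Num.sg (\det (bordered (P f))) = - ((-1) ^+ s * Num.sg (\det (bordered (P e)))).
  have := prop a (border 1 (P f k)); rewrite coord_det_vertex eqxx mul1r => ->.
  have -> : coord_det (P e) i (border 1 (P f k)) = bcoord (P e) i (P f k) * \det (bordered (P e)).
    by rewrite /bcoord divfK ?edet.
  move: h3; generalize (bcoord (P e) i (P f k)) => c h3.
  by rewrite !sgrM (ltr0_sg h3) sgrX sgrN1 mulN1r mulrN.
rewrite /flux (w_shared EF) sg prop opprK mulNr; congr (- _).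
rewrite mulrACA -signr_addb addbb expr0 mul1r //.
Qed.

Let facet_index := ('I_(nsimp B) * 'I_n.+2)%type.

Let partner (x : 'I_(nsimp B) * 'I_n.+2) : 'I_(nsimp B) * 'I_n.+2 :=
  odflt x [pick y | (y.1 != x.1) && (facet y.1 y.2 == facet x.1 x.2)].

Let paired (x : 'I_(nsimp B) * 'I_n.+2) : bool :=
  [exists y : 'I_(nsimp B) * 'I_n.+2, (y.1 != x.1) && (facet y.1 y.2 == facet x.1 x.2)].

Let partnerP (x : facet_index) : paired x -> (partner x).1 != x.1 /\ facet (partner x).1 (partner x).2 = facet x.1 x.2.
Proof.
rewrite /partner => /existsP[y yx]; case: pickP => [z /andP[? /eqP]//|/(_ y)].
by rewrite yx.
Qed.

Let partner_unique (x y : facet_index) : paired x -> y.1 != x.1 -> facet y.1 y.2 = facet x.1 x.2 -> y = partner x.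
Proof.
move=> /partnerP[px pF] yx yF.
have [yp|yp] := eqVneq y.1 (partner x).1; last first.
  have xy : x.1 != y.1 by rewrite eq_sym.
  have xp : x.1 != (partner x).1 by rewrite eq_sym.
  by case: (facet_at_most_two reg xy yp xp (esym yF) (esym pF)).
have E : facet y.1 y.2 = facet y.1 (partner x).2 by rewrite yF yp pF.
have {E} := facet_inj reg E.
by move: yp; case: y {yx yF} => ? ?; case: (partner x) => ? ? /= -> ->.
Qed.

Let partnerK (x : facet_index) : paired x -> paired (partner x) /\ partner (partner x) = x.
Proof.
move=> hx; have [px pF] := partnerP hx.
have hp : paired (partner x).
  by apply/existsP; exists x; rewrite eq_sym px pF eqxx.
by split=> //; apply/esym/partner_unique => //; rewrite eq_sym.
Qed.

Let flux_partner (x : facet_index) : paired x -> flux (partner x).1 (partner x).2 = - flux x.1 x.2.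
Proof. by move=> /partnerP[px pF]; apply: flux_opposite. Qed.

Let flux_unpaired (x : facet_index) : ~~ paired x -> flux x.1 x.2 = 0.
Proof.
move=> /negP hx; rewrite /flux w_bdry ?mulr0 // => -[f [k [fx fF]]].
by apply: hx; apply/existsP; exists (f, k); rewrite /= fx fF eqxx.
Qed.

(** Facets between two elements cancel in pairs, boundary facets carry no flux. *)
Lemma flux_sum_total : \sum_e \sum_i flux e i = 0.
Proof.
rewrite pair_bigA /= (bigID paired) /= [X in _ + X]big1 ?addr0; last by move=> x /flux_unpaired.
apply: (involution_sum0 (g := partner)) => x hx.
by have [? ?] := partnerK hx; split => //; exact: flux_partner.
Qed.

(** Of the facets of inner elements, those between two inner elements cancel; the
    remaining ones are in bijection with the surface simplices. *)
Lemma flux_sum_minus :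
  \sum_(e | minus_element e) \sum_i flux e i = \sum_j dot (wS j) (orient (corners qb j)).
Proof.
rewrite [LHS]pair_big /=.
rewrite (eq_bigl (fun x : 'I_(nsimp B) * 'I_n.+2 => minus_element x.1)); last by move=> x; rewrite andbT.
rewrite (bigID paired) /= [X in _ + X]big1 ?addr0; last by move=> x /andP[_ /flux_unpaired].
rewrite (bigID (fun x : facet_index => minus_element (partner x).1)) /= [X in X + _](_ : _ = 0); last first.
  apply: (involution_sum0 (g := partner)) => x /andP[/andP[mx hx] mp].
  have [hp pK] := partnerK hx; split => //; last exact: flux_partner.
  by rewrite mp hp pK mx.
rewrite add0r.
have [phi phiP] : exists phi : 'I_(nsimp C) -> 'I_(nsimp B) * 'I_n.+2, forall j,
    exists f k h, [/\ facet_of j (phi j).1 (phi j).2 h, (phi j).1 != f,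
      facet (phi j).1 (phi j).2 = facet f k, minus_element (phi j).1 /\ ~~ minus_element f &
      coord_det (P (phi j).1) (phi j).2 (border 0 (orient (Q j))) / \det (bordered (P (phi j).1)) < 0].
  have H j : exists x : 'I_(nsimp B) * 'I_n.+2, exists f k h,
    [/\ facet_of j x.1 x.2 h, x.1 != f, facet x.1 x.2 = facet f k,
        minus_element x.1 /\ ~~ minus_element f &
      coord_det (P x.1) x.2 (border 0 (orient (Q j))) / \det (bordered (P x.1)) < 0].
    have [e [i [f [k [h H]]]]] := surface_sides j.
    by exists (e, i), f, k, h.
  by have [phi ?] := choice H; exists phi.
have phiI : injective phi.
  move=> j j' jj'; have [f [k [h [fo _ _ _ _]]]] := phiP j.
  have [f' [k' [h' [fo' _ _ _ _]]]] := phiP j'; rewrite -jj' in fo'.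
  have [x xF] := facet_center reg (phi j).1 (phi j).2.
  apply/eqP; apply: contraT => nj; case: clo => _ _ _ dis _.
  have /seteqP[disj _] := dis j j' nj; exfalso; apply: (disj x).
  by split; [exact/(osimplex_facet _ fo)|exact/(osimplex_facet _ fo')].
transitivity (\sum_(x in [set phi j | j in [set: 'I_(nsimp C)]]%SET) flux x.1 x.2).
  apply: eq_bigl => -[e i] /=; apply/idP/imsetP => [/andP[/andP[me he] mp]|[j _ jE]].
    have [px pF] := partnerP he.
    have ep : e != (partner (e, i)).1 by rewrite eq_sym.
    have [j [h fo]] := surface_between me mp ep (esym pF).
    exists j; rewrite ?inE //.
    have [f [k [h' [fo' ef EF [mj mf] _]]]] := phiP j.
    have FF : facet e i = facet (phi j).1 (phi j).2.
      by rewrite (facet_of_labels fo) (facet_of_labels fo').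
    have [Ee|ne] := eqVneq e (phi j).1.
      move: FF; rewrite -Ee => /(facet_inj reg) ->.
      by rewrite Ee; case: (phi j).
    exfalso; have fe : f != e by apply: contraNneq mf => ->.
    apply: (facet_at_most_two reg (e := e) (f := (phi j).1) (g := f) (i := i) (k := (phi j).2) (l := k)) => //.
    - by rewrite eq_sym.
    - by rewrite FF.
  have [f [k [h [fo ef EF [mj mf] _]]]] := phiP j.
  rewrite -jE /= in fo ef EF mj; rewrite mj /=.
  have he : paired (e, i).
    by apply/existsP; exists (f, k); rewrite /= eq_sym ef EF eqxx.
  rewrite he /= -(partner_unique (y := (f, k)) he) //=.
  by rewrite eq_sym.
rewrite big_imset /=; last by move=> j j' _ _; exact: phiI.
apply: eq_big => [j|j _]; first by rewrite inE.
have [f [k [h [fo ef EF _ sl]]]] := phiP j.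
have [wE qE] := w_surf fo.
have [hI hi hE] := fo; have [c cE] := dot_orient_facet (R := R) hI hi.
have QE : Q j = P (phi j).1 \o h by exact/funext.
rewrite /flux wE qE cE; congr (_ * _).
have AA : 0 < dot (orient (Q j)) (orient (Q j)).
  by have := orient_surface_gt0 j; rewrite /enorm sqrtr_gt0.
move: AA; rewrite {2}QE cE.
have -> : coord_det (P (phi j).1) (phi j).2 (border 0 (orient (Q j))) =
  (coord_det (P (phi j).1) (phi j).2 (border 0 (orient (Q j))) / \det (bordered (P (phi j).1)))
  * \det (bordered (P (phi j).1)) by rewrite divfK ?edet.
rewrite mulrCA (nmulr_rgt0 _ sl) => lt0.
have D0 := edet (phi j).1.
case: c lt0 cE => [|] + _; rewrite ?expr1 ?expr0 ?mulN1r ?mul1r ?oppr_lt0 => h0.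
  by rewrite gtr0_sg.
by rewrite ltr0_sg // opprK.
Qed.

End FluxSums.

End SurfaceInMesh.

(** * Piecewise polynomial functions *)

Section NullSets.
Local Open Scope ereal_scope.
Context d (T : measurableType d) (R : realType) (mu : {measure set T -> \bar R}).
Import HBNNSimple.

(** A simple function below [f], set to 0 on [N], lies below [g] and keeps its
    integral. *)
Lemma ge0_integral_eq_null (N : set T) (f g : T -> \bar R) : measurable N -> mu N = 0 ->
  (forall x, 0 <= f x) -> (forall x, 0 <= g x) -> (forall x, ~ N x -> f x = g x) ->
  \int[mu]_x f x = \int[mu]_x g x.
Proof.
move=> mN N0.
suff le f' g' : (forall x, 0 <= f' x) -> (forall x, 0 <= g' x) -> (forall x, ~ N x -> f' x = g' x) ->
    \int[mu]_x f' x <= \int[mu]_x g' x.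
  move=> f0 g0 fg; apply/eqP; rewrite eq_le !le // => x /fg //.
move=> f0 g0 fg.
rewrite (ge0_integralTE _ f0) (ge0_integralTE _ g0).
apply: ub_ereal_sup => _ [h hf <-].
have mNC : measurable (~` N) by exact: measurableC.
apply: ereal_sup_ubound; exists (proj_nnsfun h mNC).
  move=> x /=; rewrite mindicE.
  have [Nx|Nx] := pselect (N x).
    by rewrite memNset ?mulr0 //=; apply; exact: Nx.
  by rewrite mem_set //= mulr1 -fg.
rewrite -!integralT_nnsfun.
have -> : \int[mu]_x (h x)%:E = \int[mu]_(x in setT `\` N) (h x)%:E.
  apply: (ge0_negligible_integral mN) => //.
    by apply/measurable_EFinP; exact: measurable_funP.
  by move=> x _; rewrite lee_fin; exact: fun_ge0.
rewrite setTD [RHS]integral_mkcond; apply: eq_integral => x _.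
rewrite patchE /= mindicE; case: ifPn => xN; first by rewrite /= mulr1.
by rewrite /= mulr0.
Qed.

Lemma integral_eq_null (N : set T) (f g : T -> \bar R) : measurable N -> mu N = 0 ->
  (forall x, ~ N x -> f x = g x) -> \int[mu]_x f x = \int[mu]_x g x.
Proof.
move=> mN N0 fg; rewrite integralE [RHS]integralE; congr (_ - _);
  apply: (ge0_integral_eq_null mN N0) => // x Nx; by rewrite !(funeposE, funenegE) fg.
Qed.

End NullSets.

Section Polynomials.
Context {R : realType} {d : nat}.
Local Notation V := 'rV[R]_d.

(** Polynomial functions as an inductive closure, to prove regularity by
    induction. *)
Inductive polyfun : (V -> R) -> Prop :=
| polyfun_cst c : polyfun (fun=> c)
| polyfun_coord i : polyfun (fun x => x ord0 i)
| polyfunD f g : polyfun f -> polyfun g -> polyfun (fun x => f x + g x)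
| polyfunM f g : polyfun f -> polyfun g -> polyfun (fun x => f x * g x).

Lemma polyfun_sum (I : Type) (r : seq I) (p : pred I) (f : I -> V -> R) :
  (forall i, polyfun (f i)) -> polyfun (fun x => \sum_(i <- r | p i) f i x).
Proof.
move=> pf; elim: r => [|i r IH].
  by under eq_fun do rewrite big_nil; exact: polyfun_cst.
under eq_fun do rewrite big_cons; case: (p i) => //; exact: polyfunD.
Qed.

Lemma polyfun_prod (I : Type) (r : seq I) (f : I -> V -> R) :
  (forall i, polyfun (f i)) -> polyfun (fun x => \prod_(i <- r) f i x).
Proof.
move=> pf; elim: r => [|i r IH].
  by under eq_fun do rewrite big_nil; exact: polyfun_cst.
under eq_fun do rewrite big_cons; exact: polyfunM.
Qed.

Lemma polyfunX (f : V -> R) k : polyfun f -> polyfun (fun x => f x ^+ k).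
Proof.
move=> pf; elim: k => [|k IH].
  by under eq_fun do rewrite expr0; exact: polyfun_cst.
under eq_fun do rewrite exprS; exact: polyfunM.
Qed.

Lemma poly_on_polyfun k (E : set V) (f : V -> R) : poly_on k E f ->
  exists2 g, polyfun g & forall x, E x -> f x = g x.
Proof.
move=> [c fE]; eexists; last exact: fE.
apply: polyfun_sum => al; apply: polyfunM; first exact: polyfun_cst.
by apply: polyfun_prod => i; apply: polyfunX; exact: polyfun_coord.
Qed.

Lemma polyfun_differentiable f : polyfun f -> forall x, differentiable f x.
Proof.
elim=> [c x|i x|g h _ IHg _ IHh x|g h _ IHg _ IHh x].
- exact: differentiable_cst.
- exact: differentiable_coord.
- exact: differentiableD.
- exact: differentiableM.
Qed.

Lemma polyfun_derive f v : polyfun f -> polyfun (fun x => 'D_v f x).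
Proof.
have dd g x : polyfun g -> derivable g x v.
  by move=> pg; apply: diff_derivable; exact: polyfun_differentiable.
elim=> [c|i|g h pg IHg ph IHh|g h pg IHg ph IHh].
- under eq_fun do rewrite derive_cst; exact: polyfun_cst.
- have -> : (fun x : V => 'D_v (fun y : V => y ord0 i) x) = (fun=> v ord0 i).
    apply/funext => x; rewrite /derive; apply/cvg_lim => //.
    apply: cvg_near_cst; near=> h.
    rewrite /= !mxE addrK /GRing.scale /= mulKf //.
    by near: h; exact: nbhs_dnbhs_neq.
  exact: polyfun_cst.
- have -> : (fun x => 'D_v (fun y => g y + h y) x) = (fun x => 'D_v g x + 'D_v h x).
    by apply/funext => x; rewrite (deriveD (dd g x pg) (dd h x ph)).
  exact: polyfunD.
- have -> : (fun x => 'D_v (fun y => g y * h y) x) = (fun x => g x * 'D_v h x + h x * 'D_v g x).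
    by apply/funext => x; rewrite (deriveM (dd g x pg) (dd h x ph)).
  by apply: polyfunD; apply: polyfunM.
Unshelve. all: by end_near. Qed.

Lemma polyfun_smooth f : polyfun f -> smooth f.
Proof.
move=> pf; split; first exact: polyfun_differentiable.
move=> v x; apply: differentiable_continuous; apply: polyfun_differentiable.
exact: polyfun_derive.
Qed.

Definition affine_fun (g : V -> R) : Prop :=
  forall m (c : 'I_m -> R) (x : 'I_m -> V), \sum_k c k = 1 ->
  g (\sum_k c k *: x k) = \sum_k c k * g (x k).

(** A monomial of degree at most 1 is constant or a single coordinate. *)
Lemma poly_on1_affine (E : set V) (f : V -> R) : poly_on 1 E f ->
  exists g, [/\ polyfun g, affine_fun g & forall x, E x -> f x = g x].
Proof.
move=> [c fE]; eexists; split; last exact: fE.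
  apply: polyfun_sum => al; apply: polyfunM; first exact: polyfun_cst.
  by apply: polyfun_prod => i; apply: polyfunX; exact: polyfun_coord.
move=> m w x w1.
rewrite (eq_bigr (fun al => \sum_k w k * (c al * \prod_i x k ord0 i ^+ al i))).
  rewrite exchange_big /=; apply: eq_bigr => k _; by rewrite mulr_sumr.
move=> al al1.
under [RHS]eq_bigr do rewrite mulrCA.
rewrite -mulr_sumr; congr (_ * _).
have [|[i0 ali0]] : (forall i, al i = ord0) \/ exists i0, al i0 != ord0.
- have [/forallP h|] := boolP [forall i, al i == ord0]; first by left=> i; exact/eqP.
  by rewrite negb_forall => /existsP[i ?]; right; exists i.
- move=> al0; transitivity (\sum_k w k).
    by rewrite w1; apply: big1 => i _; rewrite al0 expr0.
  apply: eq_bigr => k _; rewrite -[LHS]mulr1; congr (_ * _).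
  by rewrite big1 // => i _; rewrite al0 expr0.
have ali1 : al i0 = 1%N :> nat.
  by apply/eqP; rewrite eqn_leq -ltnS ltn_ord lt0n.
have alo i : i != i0 -> al i = 0%N :> nat.
  move=> ii0; apply/eqP; rewrite -leqn0 -(leq_add2l 1) addn0; apply: leq_trans al1.
  by rewrite (bigD1 i0) //= (bigD1 i) //= ali1 addnA leq_addr.
have pE (y : V) : \prod_i y ord0 i ^+ al i = y ord0 i0.
  rewrite (bigD1 i0) //= ali1 expr1 big1 ?mulr1 // => i ii0.
  by rewrite alo // expr0.
rewrite pE summxE; apply: eq_bigr => k _; by rewrite pE mxE.
Qed.

(** The segment towards the barycentre enters the open simplex at once. *)
Lemma csimplex_closure_osimplex m (p : 'I_m.+1 -> V) : csimplex p `<=` closure (osimplex p).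
Proof.
move=> x px.
pose c : V := \sum_(i < m.+1) m.+1%:R^-1 *: p i.
have inner t : 0 < t <= 1 -> osimplex p (x + t *: (c - x)).
  move=> /andP[t0 t1]; case: px => w [w0 w1 ->].
  exists (fun i => (1 - t) * w i + t * m.+1%:R^-1); split => [i||].
  - by apply: ltr_wpDl; [apply: mulr_ge0; [rewrite subr_ge0|]|rewrite mulr_gt0 // invr_gt0 ltr0n].
  - rewrite big_split /= -!mulr_sumr w1 sumr_const card_ord.
    by rewrite -[_^-1 *+ _]mulr_natr mulVf ?pnatr_eq0 // !mulr1 subrK.
  - under [RHS]eq_bigr do rewrite scalerDl -!scalerA.
    rewrite big_split /= -!scaler_sumr scalerBr scalerBl scale1r.
    by rewrite {1}/c -scaler_sumr addrA addrAC.
have line : x + t *: (c - x) @[t --> (0 : R)^'+] --> x.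
  apply: cvg_at_right_filter.
  by have := @continuous_affine_line R d x (c - x) 0; rewrite /continuous_at scale0r addr0.
move=> A /line /=; rewrite /nbhs /= => nA.
have [t [t01 At]] : exists t, 0 < t <= 1 /\ A (x + t *: (c - x)).
  near ((0 : R)^'+) => t; exists t; split; last by near: t.
  apply/andP; split; near: t; first exact: nbhs_right_gt.
  by apply: nbhs_right_le; exact: ltr01.
by exists (x + t *: (c - x)); split => //; exact: inner.
Unshelve. all: by end_near. Qed.

Lemma cvg_within_osimplex (W : set V) m (p : 'I_m.+1 -> V) (f : V -> R) x :
  {within W, continuous f} -> osimplex p `<=` W -> W x ->
  f y @[y --> within (osimplex p) (nbhs x)] --> f x.
Proof.
move=> cf pW Wx.
have := proj1 (subspace_continuousP W f) cf x Wx.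
apply: cvg_trans => A; rewrite /nbhs /= /within /=.
by apply: filterS => y h py; apply: h; exact: pW.
Qed.

Lemma csimplex_extension (W : set V) m (p : 'I_m.+1 -> V) (f g : V -> R) :
  {within W, continuous f} -> continuous g -> csimplex p `<=` W ->
  (forall x, osimplex p x -> f x = g x) -> forall x, csimplex p x -> f x = g x.
Proof.
move=> cf cg pW fg x px.
have pF : ProperFilter (within (osimplex p) (nbhs x)).
  by apply: within_nbhs_proper; exact: csimplex_closure_osimplex.
have cfx := cvg_within_osimplex cf (subset_trans (@osimplex_csimplex _ _ _ p) pW) (pW x px).
have cgx : g y @[y --> within (osimplex p) (nbhs x)] --> f x.
  apply: cvg_trans cfx => A; rewrite /nbhs /= /within /=.
  by apply: filterS => y h py; rewrite /= -fg //; exact: h.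
have cgx' : g y @[y --> within (osimplex p) (nbhs x)] --> g x.
  by apply: cvg_within_filter; exact: cg.
by rewrite -(cvg_lim (@Rhausdorff R) cgx) (cvg_lim (@Rhausdorff R) cgx').
Qed.

End Polynomials.

(** * Integrals as sums over the elements *)

Section SkeletonNull.
Context {R : realType}.
Local Notation RT := (measurableTypeR R).

Lemma csimplex_bounded_measurable d (p : 'I_d.+1 -> 'rV[R]_d) :
  \det (bordered p) != 0 -> bounded_measurable (csimplex p).
Proof.
move=> dp; split; first by apply: measurable_pt_closed; exact: closed_csimplex.
exists (\sum_k \sum_l `|p k ord0 l|) => _ [c [c0 c1 ->]] i.
rewrite summxE (le_trans (ler_norm_sum _ _ _)) //; apply: ler_sum => k _.
rewrite mxE normrM (ger0_norm (c0 k)).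
have ck1 : c k <= 1 by rewrite -c1 (bigD1 k) //= lerDl; apply: sumr_ge0 => j _.
rewrite (le_trans (ler_wpM2r (normr_ge0 _) ck1)) // mul1r.
by rewrite (bigD1 i) //= lerDl; apply: sumr_ge0 => j _.
Qed.

(** The closed simplex fits into dilations of the open one by factors
    arbitrarily close to 1, so that both have the same volume. *)
Lemma vol_csimplex_le d (p : 'I_d.+1 -> 'rV[R]_d) : \det (bordered p) != 0 ->
  vol (csimplex p) <= vol (osimplex p).
Proof.
move=> dp; have bo := osimplex_bounded_measurable dp.
have bc := csimplex_bounded_measurable dp.
have main e : 0 < e -> vol (csimplex p) <= (1 + d.+1%:R * e) ^+ d * vol (osimplex p).
  (* [x *m k%:M + b] is the dilation by [k] about the barycentre *)
  move=> e0; pose k : R := 1 + d.+1%:R * e; pose b := - e *: \sum_i p i.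
  have k0 : 0 < k by rewrite addr_gt0 // mulr_gt0 // ltr0n.
  pose E' : set 'rV[R]_d := [set x | forall i, - e < bcoord p i x].
  have kb x i : bcoord p i (x *m k%:M + b) = k * bcoord p i x - e.
    have -> : x *m k%:M + b = \sum_(j < d.+2)
        (if unlift ord0 j is Some l then - e else k) *:
        (if unlift ord0 j is Some l then p l else x).
      rewrite big_ord_recl unlift_none mul_mx_scalar; congr (_ + _).
      by rewrite /b scaler_sumr; apply: eq_bigr => l _; rewrite liftK.
    rewrite bcoord_affine; last first.
      rewrite big_ord_recl unlift_none (eq_bigr (fun=> - e)); last by move=> l _; rewrite liftK.
      by rewrite sumr_const card_ord /k mulNrn -[e *+ _]mulr_natl addrK.
    rewrite big_ord_recl unlift_none; congr (_ + _).
    rewrite (bigD1 i) //= liftK bcoord_vertex // eqxx mulr1 big1 ?addr0 // => l li.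
    by rewrite liftK bcoord_vertex // eq_sym (negbTE li) mulr0.
  have EE x : osimplex p x <-> E' (x *m k%:M + b).
    rewrite osimplexE //; split => h i; have := h i; rewrite kb.
      by move=> ?; rewrite ltrBDl subrr mulr_gt0.
    by rewrite ltrBDl subrr pmulr_rgt0.
  have oE' : open E'.
    rewrite openE => x Ex; apply: (@filter_forall _ _ (fun i y => - e < bcoord p i y) (nbhs x) _).
    move=> i; have := @continuous_bcoord R d p i x.
    by move/cvgr_gt; apply; exact: Ex.
  have mE' := measurable_pt_open oE'.
  have bE' : bounded_measurable E'.
    apply: (bounded_measurable_affine (M := k%:M) (b := b) bo mE') => y Ey.
    exists ((k^-1) *: (y - b)); last by rewrite mul_mx_scalar scalerA mulfV ?gt_eqF // scale1r subrK.
    by apply/EE; rewrite mul_mx_scalar scalerA mulfV ?gt_eqF // scale1r subrK.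
  have vE' : vol E' = k ^+ d * vol (osimplex p).
    have uk : (k%:M : 'M[R]_d) \in unitmx by rewrite unitmxE det_scalar unitrX // unitfE gt_eqF.
    have := int_Rn_affine uk bE' (f := fun=> 1) (@cst_continuous _ _ _) EE.
    by rewrite !int_Rn_cst // !mul1r det_scalar ger0_norm // exprn_ge0 // ltW.
  rewrite -vE'; apply: fine_le; rewrite ?ge0_fin_numE //; try exact: bounded_measurable_fin.
  apply: le_measure; rewrite ?inE //; first by case: bc.
  by move=> t /(proj1 (csimplexE _ dp)) h i; apply: lt_le_trans (h i); rewrite oppr_lt0.
have cv : (fun e : R => (1 + d.+1%:R * e) ^+ d * vol (osimplex p)) @ (0 : R)^'+ --> vol (osimplex p).
  apply: cvg_at_right_filter.
  have cf : continuous (fun e : R => (1 + d.+1%:R * e) ^+ d * vol (osimplex p)).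
    move=> e; apply: cvgM; last exact: cvg_cst.
    apply: (@cvg_comp _ _ _ (fun e : R => 1 + d.+1%:R * e) (fun y : R => y ^+ d)).
      by apply: cvgD; [exact: cvg_cst|apply: cvgM; [exact: cvg_cst|exact: cvg_id]].
    exact: exprn_continuous.
  by have := cf 0; rewrite /continuous_at mulr0 addr0 expr1n mul1r.
apply: (cvgr_to_ge cv); near=> e; apply: main; near: e; exact: nbhs_right_gt.
Unshelve. all: by end_near. Qed.

Lemma simplex_boundary_null d (p : 'I_d.+1 -> 'rV[R]_d) : \det (bordered p) != 0 ->
  measurable (@pt R d @^-1` (csimplex p `\` osimplex p)) /\
  lebesgue_tuple d (@pt R d @^-1` (csimplex p `\` osimplex p)) = 0%E.
Proof.
move=> dp; have bo := osimplex_bounded_measurable dp.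
have bc := csimplex_bounded_measurable dp.
have mc := proj1 bc; have mo := proj1 bo.
rewrite (_ : _ @^-1` _ = (@pt R d @^-1` csimplex p) `\` (@pt R d @^-1` osimplex p)) //.
split; first exact: measurableD.
rewrite measureD //; last exact: bounded_measurable_fin.
rewrite (setIidr _); last by apply: preimage_subset; exact: osimplex_csimplex.
apply/eqP; rewrite sube_eq ?add0e; last 2 first.
- by rewrite ge0_fin_numE //; exact: bounded_measurable_fin.
- by rewrite fin_num_adde_defr.
rewrite eq_le; apply/andP; split.
  have := vol_csimplex_le dp; rewrite /vol -lee_fin !fineK //;
    by rewrite ge0_fin_numE //; exact: bounded_measurable_fin.
apply: le_measure; rewrite ?inE //.
by apply: preimage_subset; exact: osimplex_csimplex.
Qed.

Section Elements.
Context {d : nat}.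
Local Notation V := 'rV[R]_d.
Variables (C : connectivity d.+1) (a : 'I_(nvert C) -> V).
Local Notation P e := (corners a e).
Hypothesis edet : forall e, \det (bordered (P e)) != 0.
Hypothesis euniq : forall e f x, osimplex (P e) x -> osimplex (P f) x -> e = f.

(** Integrals only see the open elements, since the mesh skeleton is a null
    set; on each element the integrand may be replaced by a continuous function
    on the whole space. *)
Lemma int_Rn_elements (W : set V) (K : pred 'I_(nsimp C)) (f : V -> R)
    (h : 'I_(nsimp C) -> V -> R) :
  W `<=` carrier a -> (forall e x, osimplex (P e) x -> W x <-> K e) ->
  (forall e, continuous (h e)) ->
  (forall e x, K e -> osimplex (P e) x -> f x = h e x) ->
  int_Rn W f = \sum_(e | K e) int_Rn (osimplex (P e)) (h e).
Proof.
move=> Wa WK ch fh.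
pose S e := @pt R d @^-1` (csimplex (P e) `\` osimplex (P e)).
pose N := \bigcup_(e in [set: 'I_(nsimp C)]) S e.
have mN : measurable N.
  apply: fin_bigcup_measurable => // e _; by case: (simplex_boundary_null (edet e)).
have N0 : lebesgue_tuple d N = 0%E.
  apply/negligibleP => //.
  rewrite /N (_ : \bigcup_(e in _) S e = \big[setU/set0]_e S e).
    elim/big_ind : _ => //; [exact: negligible_set0|exact: negligibleU|].
    move=> e _; case: (simplex_boundary_null (edet e)) => mS S0.
    by apply/negligibleP.
  rewrite -bigcup_seq; apply/seteqP; split => t [e _ te]; exists e => //=.
  exact: mem_index_enum.
pose g e : V -> \bar R := (EFin \o h e) \_ (osimplex (P e)).
have ge e t : g e (pt t) = ((EFin \o (h e \o @pt R d)) \_ (@pt R d @^-1` osimplex (P e))) t.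
  by rewrite /g !patchE.
rewrite /int_Rn /Rintegral integral_mkcond.
rewrite (integral_eq_null mN N0 (g := fun t => \sum_(e | K e) g e (pt t))%E); last first.
  move=> t Nt; rewrite patchE; set x := pt t.
  have -> : (t \in @pt R d @^-1` W) = (x \in W) by apply/idP/idP; rewrite !inE.
  have [[e ex]|no] := pselect (exists e, osimplex (P e) x).
    have go e' : e' != e -> g e' x = 0%E.
      move=> e'e; rewrite /g patchE; case: ifPn => //; rewrite inE => e'x.
      by move: e'e; rewrite (euniq e'x ex) eqxx.
    have [Ke|nKe] := boolP (K e).
      rewrite (bigD1 e) //= big1 ?adde0; last by move=> e' /andP[_ /go].
      rewrite (mem_set (proj2 (WK e x ex) Ke)) /g patchE mem_set //=.
      by congr EFin; exact: fh.
    rewrite big1; last by move=> e' Ke'; apply: go; apply: contraNneq nKe => <-.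
    by rewrite memNset // => /(WK e x ex); apply/negP.
  rewrite big1; last first.
    move=> e _; rewrite /g patchE memNset // => ex; apply: no; by exists e.
  rewrite memNset // => /Wa [e _ ex]; apply: Nt; exists e => //; rewrite /S; split => // ox.
  by apply: no; exists e.
have ig e : (lebesgue_tuple d).-integrable setT (fun t => g e (pt t)).
  under eq_fun do rewrite ge.
  apply: (proj1 (integrable_mkcond _ (proj1 (osimplex_bounded_measurable (edet e))))).
  by apply: integrable_bounded_measurable => //; exact: osimplex_bounded_measurable.
rewrite integral_sum //.
rewrite (eq_bigr (fun e => (int_Rn (osimplex (P e)) (h e))%:E)); first by rewrite sumEFin.
move=> e _; rewrite /int_Rn /Rintegral fineK; last first.
  apply: integrable_fin_num; first by case: (osimplex_bounded_measurable (edet e)).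
  by apply: integrable_bounded_measurable => //; exact: osimplex_bounded_measurable.
by rewrite [RHS]integral_mkcond; apply: eq_integral => t _; rewrite ge.
Qed.

End Elements.

End SkeletonNull.

Section ElementMaps.
Context {R : realType}.

Lemma derive_increment d (f : 'rV[R]_d -> R) x w (L : R) :
  (forall h : R, f (x + h *: w) = f x + h * L) -> 'D_w f x = L.
Proof.
move=> fL; rewrite /derive; apply/cvg_lim => //.
apply: cvg_near_cst; near=> h.
have -> : (f \o shift x) (h *: w) = f x + h * L by rewrite /= addrC fL.
rewrite [f x + _]addrC addrK /GRing.scale /= mulKf //.
by near: h; exact: nbhs_dnbhs_neq.
Unshelve. all: by end_near. Qed.

Definition elem_map d (p p' : 'I_d.+1 -> 'rV[R]_d) (x : 'rV[R]_d) : 'rV[R]_d :=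
  \sum_k bcoord p k x *: p' k.

Lemma elem_map_spt d (p p' : 'I_d.+1 -> 'rV[R]_d) s : \det (bordered p) != 0 ->
  elem_map p p' (spt p s) = spt p' s.
Proof. by move=> p0; apply: eq_bigr => k _; rewrite bcoord_spt. Qed.

Lemma continuous_elem_map d (p p' : 'I_d.+1 -> 'rV[R]_d) : continuous (elem_map p p').
Proof.
apply: continuous_rV => i.
have -> : (fun x => elem_map p p' x ord0 i) = (fun x => \sum_k bcoord p k x * p' k ord0 i).
  by apply/funext => x; rewrite summxE; apply: eq_bigr => k _; rewrite mxE.
apply: continuous_sumr => k; apply: continuous_mulr; first exact: continuous_bcoord.
exact: continuous_cstr.
Qed.

Lemma elem_map_osimplex d (p p' : 'I_d.+1 -> 'rV[R]_d) x : \det (bordered p) != 0 ->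
  osimplex p x -> osimplex p' (elem_map p p' x).
Proof. by move=> p0 /osimplex_spt[s s0 ->]; rewrite elem_map_spt //; apply/osimplex_spt; exists s. Qed.

Lemma derive_elem_map d (p p' : 'I_d.+1 -> 'rV[R]_d) i w x :
  'D_w (fun y => elem_map p p' y ord0 i) x =
  \sum_k coord_det p k (border 0 w) / \det (bordered p) * p' k ord0 i.
Proof.
apply: derive_increment => h; rewrite !summxE mulr_sumr -big_split /=.
by apply: eq_bigr => k _; rewrite mxE [in RHS]mxE bcoord_line; ring.
Qed.

(** The gradient maps edges to edges. *)
Lemma det_grad_elem_map d (p p' : 'I_d.+1 -> 'rV[R]_d) x : \det (bordered p) != 0 ->
  \det (\matrix_(i, l) 'D_(delta_mx ord0 l) (fun y => elem_map p p' y ord0 i) x) =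
  \det (bordered p') / \det (bordered p).
Proof.
move=> p0; set M := \matrix_(_, _) _.
have EM : edges p *m M^T = edges p'.
  apply/matrixP => j i; rewrite !mxE.
  transitivity (\sum_k (\sum_l edges p j l * (coord_det p k (border 0 (delta_mx ord0 l)) /
     \det (bordered p))) * p' k ord0 i).
    under [RHS]eq_bigr do rewrite mulr_suml.
    rewrite exchange_big /=; apply: eq_bigr => l _; rewrite !mxE derive_elem_map mulr_sumr.
    by apply: eq_bigr => k _; rewrite mulrA.
  have cE k : \sum_l edges p j l * (coord_det p k (border 0 (delta_mx ord0 l)) /
     \det (bordered p)) = (k == lift ord0 j)%:R - (k == ord0)%:R.
    rewrite -(bcoord_vertex k (lift ord0 j) p0) -(bcoord_vertex k ord0 p0) -bcoord_sub.
    under eq_bigr do rewrite mulrA; rewrite -mulr_suml; congr (_ / _).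
    rewrite -dot_facet_normal dot_rV; apply: eq_bigr => l _.
    by rewrite !mxE.
  by under eq_bigr do rewrite cE mulrBl; rewrite sumrB !sum_deltaM.
rewrite !det_bordered -EM det_mulmx det_tr.
by rewrite -det_bordered mulrAC mulfV // mul1r.
Qed.

End ElementMaps.

Section ElementwiseFunctions.
Context {R : realType} {n : nat}.
Local Notation V := 'rV[R]_n.+1.
Variables (Om : set V) (C : connectivity n.+2) (a : 'I_(nvert C) -> V).
Hypothesis reg : regular_partition Om a.
Hypothesis poly : polytopal_domain Om.
Local Notation P e := (corners a e).
Let edet := element_det reg.

Lemma Sk_smooth k f : Sk Om a k f -> forall e, exists g, smooth g /\
  forall x, csimplex (P e) x -> f x = g x.
Proof.
move=> [cf pf] e; have [g pg fg] := poly_on_polyfun (pf e).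
have sg := polyfun_smooth pg; exists g; split => //.
apply: (csimplex_extension cf) => //; first exact: smooth_continuous.
exact: csimplex_closure.
Qed.

Lemma Svec_smooth k (u : V -> V) : Svec Om a k u ->
  exists G : 'I_(nsimp C) -> 'I_n.+1 -> V -> R, (forall e i, smooth (G e i)) /\
  forall e i x, csimplex (P e) x -> u x ord0 i = G e i x.
Proof.
move=> Su.
have [G GE] := choice (fun ei : 'I_(nsimp C) * 'I_n.+1 => Sk_smooth (Su ei.2) ei.1).
exists (fun e i => G (e, i)); split => [e i|e i x ex]; first by case: (GE (e, i)).
by case: (GE (e, i)) => _ /(_ _ ex).
Qed.

Lemma Sk1_affine f e (c : 'I_n.+2 -> R) : Sk Om a 1 f ->
  (forall i, 0 <= c i) -> \sum_i c i = 1 ->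
  f (\sum_i c i *: P e i) = \sum_i c i * f (P e i).
Proof.
move=> [cf pf] c0 c1; have [g [pg ag fg]] := poly_on1_affine (pf e).
have ext : forall x, csimplex (P e) x -> f x = g x.
  apply: (csimplex_extension cf) => //; first exact/smooth_continuous/polyfun_smooth.
  exact: csimplex_closure.
rewrite ext; last by exists c.
rewrite ag //; apply: eq_bigr => i _; rewrite ext //.
exact: csimplex_corner.
Qed.

Lemma int_domain f (h : 'I_(nsimp C) -> V -> R) : (forall e, continuous (h e)) ->
  (forall e x, osimplex (P e) x -> f x = h e x) ->
  int_Rn Om f = \sum_e `|\det (bordered (P e))| * int_Rn ref_simplex (h e \o spt (P e)).
Proof.
move=> ch fh; rewrite (int_Rn_elements (a := a) edet _ (K := predT) (h := h)) //.
- by apply: eq_bigr => e _; rewrite int_osimplex.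
- by move=> e f' x; apply: (osimplex_unique reg).
- by case: reg => _ _ _ <- _; exact: subset_closure.
- by move=> e x ex; split => // _; apply: (osimplex_domain reg poly ex).
- by move=> e x _; exact: fh.
Qed.

Lemma derive_on_element e (f g : V -> R) x w : osimplex (P e) x ->
  (forall y, osimplex (P e) y -> f y = g y) -> 'D_w f x = 'D_w g x.
Proof.
move=> ex fg; apply: near_eq_derive.
have : nbhs x (osimplex (P e)) by apply: open_nbhs_nbhs; split => //; exact: open_osimplex.
by apply: filterS.
Qed.

Lemma grad_on_element e (u : V -> V) (G : 'I_n.+1 -> V -> R) x : osimplex (P e) x ->
  (forall i y, osimplex (P e) y -> u y ord0 i = G i y) ->
  grad a u x = \matrix_(i, l) 'D_(delta_mx ord0 l) (G i) x.
Proof.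
move=> ex uG; rewrite /grad indicE mem_set; last by exists e.
rewrite scale1r; apply/matrixP => i l; rewrite !mxE.
by apply: derive_on_element ex _ => y; exact: uG.
Qed.

Lemma div_on_element e (u : V -> V) (G : 'I_n.+1 -> V -> R) x : osimplex (P e) x ->
  (forall i y, osimplex (P e) y -> u y ord0 i = G i y) ->
  div a u x = \sum_i 'D_(delta_mx ord0 i) (G i) x.
Proof.
move=> ex uG; rewrite /div (grad_on_element ex uG) /mxtrace.
by apply: eq_bigr => i _; rewrite mxE.
Qed.

End ElementwiseFunctions.

(** * Kinetic energy *)

Section DiscreteSolution.
Context {R : realType} {n : nat} (D : problem R n) (H : discrete R n).
Local Notation V := 'rV[R]_n.+1.
Hypothesis adm : admissible D.
Hypothesis sol : fitted_ALE_solution D H.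
Local Notation P m e := (corners (pos H m) e).
Local Notation Q m j := (corners (spos H m) j).
Local Notation minus m e := (minus_element (Om D) (pos H m) (spos H m) e).

Let poly : polytopal_domain (Om D). Proof. by case: adm. Qed.
Let regm m : (m <= nstep D)%N -> regular_partition (Om D) (pos H m).
Proof. by case: sol => h _ _ /h[]. Qed.
Let clom m : (m <= nstep D)%N -> closed_surface (spos H m).
Proof. by case: sol => h _ _ /h[]. Qed.
Let fitm m : (m <= nstep D)%N -> fitted (spos H m) (pos H m).
Proof. by case: sol => h _ _ /h[]. Qed.

Lemma dt_gt0 m : (m < nstep D)%N -> 0 < dt D.
Proof.
move=> mM; rewrite divr_gt0 ?ltr0n ?(leq_ltn_trans (leq0n m) mM) //.
by case: adm.
Qed.

Lemma element_det_at m e : (m <= nstep D)%N -> \det (bordered (P m e)) != 0.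
Proof. by move=> mM; exact: (element_det (regm mM)). Qed.

Lemma phase_on_element m cm cp e x : (m <= nstep D)%N -> osimplex (P m e) x ->
  phase (spos H m) (Om D) cm cp x = if minus m e then cm else cp.
Proof.
move=> mM ex; have [hm hp] := element_phase (regm mM) poly (clom mM) (fitm mM) ex.
rewrite /phase !indicE.
have -> : (x \in Om_minus (spos H m) (Om D)) = minus m e by apply/idP/idP; rewrite inE => /hm.
have -> : (x \in Om_plus (spos H m) (Om D)) = ~~ minus m e by apply/idP/idP; rewrite inE => /hp.
by case: (minus m e); rewrite /= ?mulr1 ?mulr0 ?addr0 ?add0r.
Qed.

(** At the initial level the previous mesh is the mesh itself. *)
Lemma ale_element m e x : (m <= nstep D)%N -> csimplex (P m e) x ->
  ale D H m x = elem_map (P m e) (P m.-1 e) x.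
Proof.
case: m => [|m] mM ex.
  rewrite /ale; case: sol => _ [_ W0] _; rewrite W0; last exact: (csimplex_closure (regm mM) ex).
  by rewrite scaler0 subr0; have [_] := bcoordE x (element_det_at e mM).
have [_ _ h] := sol; have {h} [_ _ [_ [phi [nb WE]]] _] := h _ mM.
have x0 := proj1 (csimplexE x (element_det_at e mM)) ex.
have [x1 xE] := bcoordE x (element_det_at e mM).
have dt0 := dt_gt0 mM.
rewrite /ale WE; last exact: (csimplex_closure (regm mM) ex).
rewrite {1}xE; pose b i := bcoord (P m.+1 e) i x; rewrite -/b.
rewrite (_ : \sum_k phi k x *: _ = \sum_i b i *: ((dt D)^-1 *: (P m.+1 e i - P m e i))).
  rewrite scaler_sumr -sumrB; apply: eq_bigr => i _; rewrite [RHS]/=.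
  by apply/rowP => l; rewrite -/(b i) !mxE; field; rewrite gt_eqF.
have phiE k : phi k x = \sum_i b i * (k == simp e i)%:R.
  rewrite {1}xE (Sk1_affine (regm mM)) //; last by case: (nb k).
  by apply: eq_bigr => i _; rewrite /corners; case: (nb k) => _ ->.
under eq_bigr do rewrite phiE scaler_suml.
rewrite exchange_big /=; apply: eq_bigr => i _.
rewrite (bigD1 (simp e i)) //= eqxx mulr1 big1 ?addr0 // => k /negbTE ki.
by rewrite ki mulr0 scale0r.
Qed.

Lemma jac_element m e x : (m <= nstep D)%N -> osimplex (P m e) x ->
  jac D H m x = \det (bordered (P m.-1 e)) / \det (bordered (P m e)).
Proof.
move=> mM ex; rewrite /jac -(det_grad_elem_map (P m.-1 e) x (element_det_at e mM)).
rewrite (grad_on_element (regm mM) ex (G := fun i y => elem_map (P m e) (P m.-1 e) y ord0 i)) //.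
by move=> i y ey; rewrite (ale_element (e := e)) //; exact: osimplex_csimplex.
Qed.

Lemma jac_gt0 m e : (m <= nstep D)%N ->
  0 < \det (bordered (P m.-1 e)) / \det (bordered (P m e)).
Proof.
case: m => [|m] mM; first by rewrite /= divff ?ltr01 // element_det_at.
have [_ _ h] := sol; have {h} [_ _ _ [_ J _ _]] := h _ mM.
have [x ex] : exists x, osimplex (P m.+1 e) x.
  exists (\sum_i n.+2%:R^-1 *: P m.+1 e i); exists (fun=> n.+2%:R^-1); split => //.
  by rewrite sumr_const card_ord -[_ *+ _]mulr_natr mulVf // pnatr_eq0.
by rewrite -(jac_element mM ex); apply: J; exists e.
Qed.

Lemma minus_step m e : (m <= nstep D)%N -> minus m e = minus m.-1 e.
Proof.
case: m => [//|m] mM.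
have [_ _ h] := sol; have {h} [_ _ _ [_ _ Am Ap]] := h _ mM.
have [x ex] : exists x, osimplex (P m.+1 e) x.
  exists (\sum_i n.+2%:R^-1 *: P m.+1 e i); exists (fun=> n.+2%:R^-1); split => //.
  by rewrite sumr_const card_ord -[_ *+ _]mulr_natr mulVf // pnatr_eq0.
have [hm hp] := element_phase (regm mM) poly (clom mM) (fitm mM) ex.
have ey : osimplex (P m e) (ale D H m.+1 x).
  rewrite (ale_element (e := e) mM); last exact: osimplex_csimplex.
  by apply: elem_map_osimplex ex; exact: element_det_at.
have [hm' hp'] := element_phase (regm (ltnW mM)) poly (clom (ltnW mM)) (fitm (ltnW mM)) ey.
have [me|me] := boolP (minus m.+1 e).
  by apply/esym/hm'; rewrite -Am; exists x => //; exact/hm.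
by apply/esym/negbTE/hp'; rewrite -Ap; exists x => //; exact/hp.
Qed.

Definition kinetic k l : R :=
  int_Rn (Om D) (fun x => rho D H k x * dot (vel H l x) (vel H l x)).

Lemma vel_space m : (m <= nstep D)%N -> in_Um D H m.-1 (vel H m).
Proof.
by case: m => [|m] mM; case: sol => _ [] // U0 _ h; case: (h _ mM) => -[[]].
Qed.

Let dens m e : R := if minus m e then rho_minus D else rho_plus D.
Let dens_ge0 m e : 0 <= dens m e.
Proof. by rewrite /dens; case: adm => _ _ [? ? _ _ _] _ _; case: ifP => _; exact: ltW. Qed.

Lemma kinetic_elements m l (G : 'I_(nsimp (bulk H)) -> 'I_n.+1 -> V -> R) : (m <= nstep D)%N ->
  (forall e i, smooth (G e i)) ->
  (forall e i x, csimplex (P m e) x -> vel H l x ord0 i = G e i x) ->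
  kinetic m l = \sum_e `|\det (bordered (P m e))| *
    int_Rn ref_simplex (fun s => dens m e * \sum_i G e i (spt (P m e) s) ^+ 2).
Proof.
move=> mM sG UG; rewrite /kinetic (int_domain (regm mM) poly
  (h := fun e x => dens m e * \sum_i G e i x ^+ 2)) //.
  move=> e; apply: continuous_mulr; first exact: continuous_cstr.
  apply: continuous_sumr => i; under eq_fun do rewrite expr2.
  by apply: continuous_mulr; exact: smooth_continuous.
move=> e x ex; rewrite /rho (phase_on_element _ _ mM ex) dot_rV; congr (_ * _).
by apply: eq_bigr => i _; rewrite (UG e) -?expr2 //; exact: osimplex_csimplex.
Qed.

(** The factor [sqrt jac] turns the old kinetic energy, an integral over the
    old mesh, into an integral over the new one; then only
    (a - b) a >= (a^2 - b^2) / 2 is used. *)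
Lemma kinetic_step m : (m < nstep D)%N ->
  (2 * dt D)^-1 * (kinetic m m.+1 - kinetic m.-1 m) <=
  ip (Om D) (fun x => (rho D H m x / dt D) *:
     (vel H m.+1 x - Num.sqrt (jac D H m x) *: vel H m (ale D H m x))) (vel H m.+1).
Proof.
move=> mM; have mM' := ltnW mM; have pM : (m.-1 <= nstep D)%N by rewrite (leq_trans (leq_pred m)).
have dt0 := dt_gt0 mM.
have [G [sG UG]] := Svec_smooth (regm mM') (proj1 (vel_space (m := m.+1) mM)).
have [G' [sG' UG']] := Svec_smooth (regm pM) (proj1 (vel_space mM')).
rewrite (kinetic_elements mM' sG UG) (kinetic_elements pM sG' UG').
pose J e := \det (bordered (P m.-1 e)) / \det (bordered (P m e)).
have J0 e : 0 < J e by exact: jac_gt0.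
have cG e i : continuous (G e i \o spt (P m e)) by apply/continuous_comp_spt/smooth_continuous.
have cG' e i : continuous (G' e i \o spt (P m.-1 e)) by apply/continuous_comp_spt/smooth_continuous.
rewrite /ip (int_domain (regm mM') poly (h := fun e x => (dens m e / dt D) *
  \sum_i (G e i x - Num.sqrt (J e) * G' e i (elem_map (P m e) (P m.-1 e) x)) * G e i x)); first last.
- move=> e x ex; have ex' := osimplex_csimplex ex.
  rewrite /rho (phase_on_element _ _ mM' ex) (jac_element mM' ex) (ale_element mM' ex') dot_rV mulr_sumr.
  apply: eq_bigr => i _; rewrite !mxE (UG e) // (UG' e) -/(J e); first by rewrite mulrA.
  by apply: osimplex_csimplex; apply: elem_map_osimplex ex; exact: element_det_at.
- move=> e; apply: continuous_mulr; first exact: continuous_cstr.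
  apply: continuous_sumr => i; apply: continuous_mulr; last exact: smooth_continuous.
  apply: continuous_subr; first exact: smooth_continuous.
  apply: continuous_mulr; first exact: continuous_cstr.
  move=> x; apply: continuous_comp; first exact: continuous_elem_map.
  exact: smooth_continuous.
rewrite -sumrB mulr_sumr; apply: ler_sum => e _.
have -> : `|\det (bordered (P m.-1 e))| = `|\det (bordered (P m e))| * J e.
  by rewrite -[J e]gtr0_norm // /J -normrM mulrCA mulfV ?mulr1 // element_det_at.
rewrite -mulrA -mulrBr mulrCA; apply: ler_wpM2l; first exact: normr_ge0.
have bR := @ref_simplex_bounded_measurable R n.+1.
have csq (g : 'I_n.+1 -> 'rV[R]_n.+1 -> R) : (forall i, continuous (g i)) ->
    continuous (fun s => dens m e * \sum_i g i s ^+ 2).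
  move=> cg; apply: continuous_mulr; first exact: continuous_cstr.
  by apply: continuous_sumr => i; under eq_fun do rewrite expr2; exact: continuous_mulr.
have cstR (c : R) : continuous (fun _ : 'rV[R]_n.+1 => c) by exact: cst_continuous.
rewrite /dens -(minus_step e mM') -/(dens m e).
have cF := csq (fun i s => G e i (spt (P m e) s)) (cG e).
have cF' := csq (fun i s => G' e i (spt (P m.-1 e) s)) (cG' e).
have cJ := continuous_mulr (cstR (J e)) cF'.
rewrite -(int_RnZ (J e) bR cF') -(int_RnB bR cF cJ) -(int_RnZ _ bR (continuous_subr cF cJ)).
apply: le_int_Rn => //.
- by apply: continuous_mulr => //; exact: continuous_subr.
- apply: continuous_mulr => //; apply: continuous_sumr => i; apply: continuous_mulr; last exact: cG.
  apply: continuous_subr; first exact: cG.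
  apply: continuous_mulr => //.
  under eq_fun do rewrite /= elem_map_spt ?element_det_at //.
  exact: cG'.
move=> s _ /=; rewrite elem_map_spt ?element_det_at //.
set r := dens m e; have r0 : 0 <= r by exact: dens_ge0.
pose x i := G e i (spt (P m e) s); pose y i := G' e i (spt (P m.-1 e) s).
pose q := Num.sqrt (J e); have qE : J e = q ^+ 2 by rewrite sqr_sqrtr // ltW.
rewrite -subr_ge0; have -> : r / dt D * \sum_i (x i - q * y i) * x i -
    (2 * dt D)^-1 * (r * (\sum_i x i ^+ 2) - J e * (r * \sum_i y i ^+ 2)) =
    r / (2 * dt D) * \sum_i (x i - q * y i) ^+ 2.
  have -> : \sum_i (x i - q * y i) ^+ 2 = \sum_i x i ^+ 2 - 2 * q * \sum_i x i * y i +
      q ^+ 2 * \sum_i y i ^+ 2.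
    by rewrite !mulr_sumr -sumrB -big_split /=; apply: eq_bigr => i _; ring.
  have -> : \sum_i (x i - q * y i) * x i = \sum_i x i ^+ 2 - q * \sum_i x i * y i.
    by rewrite mulr_sumr -sumrB; apply: eq_bigr => i _; ring.
  by rewrite qE; field; rewrite gt_eqF.
apply: mulr_ge0; last by apply: sumr_ge0 => i _; exact: sqr_ge0.
by apply: divr_ge0 => //; apply: mulr_ge0 => //; exact: ltW.
Qed.

End DiscreteSolution.

(** * Surface area *)

Section AreaGrowth.
Context {R : realType}.

Lemma dot_trace p q (A B : 'M[R]_(p, q)) : dot A B = \tr (A *m B^T).
Proof.
by apply: eq_bigr => i _; rewrite mxE; apply: eq_bigr => j _; rewrite mxE.
Qed.

(** Adjoin the orientation vector to the edges: it is orthogonal to all of them,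
    and the determinant of the enlarged matrix is its squared norm. *)
Lemma det_gram n (q : 'I_n.+1 -> 'rV[R]_n.+1) : 0 < enorm (orient q) ->
  \det (edges q *m (edges q)^T) = enorm (orient q) ^+ 2.
Proof.
set o := orient q; set E := edges q => o0.
have dM : \det (col_mx o E : 'M[R]_n.+1) = enorm o ^+ 2 by rewrite enorm_sqr -orient_dot.
have oE : E *m o^T = 0.
  apply/matrixP => j k; rewrite !mxE ord1.
  transitivity (dot (row j E) o).
    by rewrite dot_rV; apply: eq_bigr => l _; rewrite !mxE.
  rewrite orient_dot; apply: (@determinant_alternate _ _ _ (lshift n ord0) (rshift 1 j)) => // l.
  by rewrite col_mxEu col_mxEd mxE.
pose M : 'M[R]_(1 + n) := col_mx (o : 'M[R]_(1, 1 + n)) E.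
have := det_mulmx M M^T; rewrite det_tr [\det M]dM /M tr_col_mx mul_col_row oE.
rewrite (det_ublock (o *m o^T)) det_mx11.
have -> : (o *m o^T) 0 0 = enorm o ^+ 2.
  by rewrite enorm_sqr dot_rV [LHS]mxE; apply: eq_bigr => l _; rewrite [(o^T) _ _]mxE.
by move/mulfI; apply; rewrite expf_neq0 // gt_eqF.
Qed.

(** The arithmetic-geometric mean inequality for the eigenvalues of G^-1 G'. *)
Lemma trace_sym2 (G G' : 'M[R]_2) (A A' : R) : 0 < A -> 0 < A' ->
  G^T = G -> G'^T = G' -> 0 <= G ord0 ord0 -> 0 <= G' ord0 ord0 ->
  \det G = A ^+ 2 -> \det G' = A' ^+ 2 ->
  2 * (A' / A) <= \tr (invmx G *m G').
Proof.
pose i1 : 'I_2 := lift ord0 ord0.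
have det2 (M : 'M[R]_2) : \det M = M ord0 ord0 * M i1 i1 - M ord0 i1 * M i1 ord0.
  rewrite (expand_det_row _ ord0) !big_ord_recl big_ord0 /cofactor !det_mx11 !mxE.
  rewrite addr0 /= expr0 mul1r expr1 mulN1r mulrN; congr (_ * M _ _ - _ * M _ _);
    by apply: val_inj.
move=> A0 A'0 /matrixP/(_ ord0 i1) sG /matrixP/(_ ord0 i1) sG' a0 a'0 dG dG'.
have uG : G \in unitmx by rewrite unitmxE dG unitfE expf_neq0 // gt_eqF.
move: sG sG' dG dG'; rewrite !mxE !det2.
set b := G ord0 i1; set c := G i1 i1; set b' := G' ord0 i1; set c' := G' i1 i1.
set a := G ord0 ord0 in a0 *; set a' := G' ord0 ord0 in a'0 *.
move=> G10 G'10; rewrite G10 G'10 => eA eA'.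
have pos x y z (r : R) : 0 <= x -> 0 < r -> x * z - y * y = r ^+ 2 -> 0 < x.
  move=> x0 r0 h; rewrite lt_neqAle x0 andbT eq_sym; apply/eqP => xz.
  have := exprn_gt0 2 r0; rewrite -h xz mul0r sub0r -expr2 oppr_gt0.
  by rewrite ltNge sqr_ge0.
have {}a0 := pos _ _ _ _ a0 A0 eA; have {}a'0 := pos _ _ _ _ a'0 A'0 eA'.
pose N : 'M[R]_2 := \matrix_(i, j) (if i == j then if i == ord0 then c else a else - b).
have NG : N *m G = (A ^+ 2)%:M.
  apply/matrixP => i j; rewrite !mxE !big_ord_recl big_ord0 addr0 !mxE -/i1.
  case: (unliftP ord0 i) => [k ->|->]; rewrite ?[k]ord1 -?/i1;
  case: (unliftP ord0 j) => [l ->|->]; rewrite ?[l]ord1 -?/i1 /= ?mulr1n ?mulr0n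
    -?/a -?/b -?/c ?G10 -?eA; ring.
have GN : invmx G = (A ^+ 2)^-1 *: N.
  rewrite -[RHS](mulmxK uG) -scalemxAl NG scale_scalar_mx mulVf ?mul1mx //.
  by rewrite expf_neq0 // gt_eqF.
rewrite GN -scalemxAl mxtraceZ /mxtrace !big_ord_recl big_ord0 addr0 !mxE.
rewrite !big_ord_recl !big_ord0 !addr0 !mxE -/i1 /= G'10 -/a' -/b' -/c'.
have -> : A' / A = (A ^+ 2)^-1 * (A * A') by field; rewrite gt_eqF.
rewrite mulrCA; apply: ler_wpM2l; first by rewrite invr_ge0 sqr_ge0.
rewrite -subr_ge0 -(pmulr_rge0 _ (mulr_gt0 a0 a'0)).
(* a sum of squares, since a c - b^2 = A^2 and a' c' - b'^2 = A'^2 *)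
have -> : a * a' * (c * a' + - b * b' + (- b * b' + a * c') - 2 * (A * A')) =
    (A * a' - A' * a) ^+ 2 + (b * a' - a * b') ^+ 2.
  transitivity ((a * c - b * b) * a' ^+ 2 + a ^+ 2 * (a' * c' - b' * b') +
    (b * a' - a * b') ^+ 2 - 2 * a * a' * A * A'); first by ring.
  by rewrite eA eA'; ring.
by rewrite addr_ge0 // sqr_ge0.
Qed.

Lemma trace_gram2 (E E' : 'M[R]_(2, 3)) (A A' : R) : 0 < A -> 0 < A' ->
  \det (E *m E^T) = A ^+ 2 -> \det (E' *m E'^T) = A' ^+ 2 ->
  2 * (A' / A) <= \tr (invmx (E *m E^T) *m (E' *m E'^T)).
Proof.
have sym (M : 'M[R]_(2, 3)) : (M *m M^T)^T = M *m M^T by rewrite trmx_mul trmxK.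
have diag_ge0 (M : 'M[R]_(2, 3)) : 0 <= (M *m M^T) ord0 ord0.
  by rewrite mxE; apply: sumr_ge0 => l _; rewrite mxE -expr2 sqr_ge0.
by move=> A0 A'0 dG dG'; apply: trace_sym2.
Qed.

Lemma trace_gram1 (E E' : 'M[R]_(1, 2)) (A A' : R) : 0 < A ->
  \det (E *m E^T) = A ^+ 2 -> \det (E' *m E'^T) = A' ^+ 2 ->
  \tr (invmx (E *m E^T) *m (E' *m E'^T)) = (A' / A) ^+ 2.
Proof.
move=> A0; set G := E *m E^T; set G' := E' *m E'^T; rewrite !det_mx11 => dG dG'.
rewrite [G]mx11_scalar [G']mx11_scalar dG dG' invmx_scalar -scalar_mxM mxtrace_scalar mulr1n.
by rewrite expr_div_n mulrC.
Qed.

(** The surface gradient, on a simplex with corners [q], of the affine map to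
    the simplex with corners [r]. *)
Definition corner_grad n (q r : 'I_n.+1 -> 'rV[R]_n.+1) : 'M[R]_n.+1 :=
  (edges r)^T *m invmx (edges q *m (edges q)^T) *m edges q.

(** The surface gradient of the map to the new simplex controls the growth of
    the area; this is where the dimension enters. *)
Lemma area_growth n (q q' : 'I_n.+1 -> 'rV[R]_n.+1) : n.+1 = 2%N \/ n.+1 = 3%N ->
  0 < enorm (orient q) -> 0 < enorm (orient q') ->
  enorm (orient q') - enorm (orient q) <=
  enorm (orient q) * dot (corner_grad q q') (corner_grad q q' - corner_grad q q).
Proof.
move=> hd A0 A'0; pose S := corner_grad q; rewrite -/(S q') -/(S q); have dG := det_gram A0; have dG' := det_gram A'0.
set A := enorm _ in A0 dG *; set A' := enorm _ in A'0 dG' *.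
set E := edges q in dG *; set E' := edges q' in dG' *.
set G := E *m E^T in dG *; pose Gi := invmx G.
have uG : G \in unitmx by rewrite unitmxE dG unitfE expf_neq0 // gt_eqF.
have GiT : Gi^T = Gi by rewrite /Gi trmx_inv /G trmx_mul trmxK.
have SS r : dot (S r) (S r) = \tr (Gi *m (edges r *m (edges r)^T)).
  rewrite dot_trace /S /corner_grad -/E -/G -/Gi !trmx_mul trmxK GiT.
  rewrite -!mulmxA (mulmxA E) -/G (mulmxA G) (mulmxV uG) mul1mx.
  by rewrite mxtrace_mulC -mulmxA.
have SSq : dot (S q) (S q) = n%:R by rewrite SS -/E -/G mulVmx // mxtrace1.
have half : (dot (S q') (S q') - n%:R) / 2 <= dot (S q') (S q' - S q).
  have := dot_ge0 (S q' - S q); rewrite dotBr [dot _ (S q')]dotC [dot _ (S q)]dotC.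
  by rewrite !dotBr SSq [dot (S q) (S q')]dotC; lra.
suff h : A' - A <= A * ((dot (S q') (S q') - n%:R) / 2).
  by apply: (le_trans h); apply: ler_wpM2l half; exact: ltW.
rewrite SS -/E'; clear SS SSq half; rewrite /Gi; clear GiT Gi S; rewrite /G in dG *; clear uG G.
case: hd => -[nE]; subst n.
  rewrite (trace_gram1 A0 dG dG') -subr_ge0.
  have -> : A * (((A' / A) ^+ 2 - 1%:R) / 2) - (A' - A) = (A' - A) ^+ 2 / (2 * A).
    by field; rewrite gt_eqF.
  by rewrite divr_ge0 ?sqr_ge0 // mulr_ge0 // ltW.
have h := trace_gram2 A0 A'0 dG dG'.
have -> : A' - A = A * ((2 * (A' / A) - 2%:R) / 2) by field; rewrite gt_eqF.
apply: ler_wpM2l; first exact: ltW.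
by rewrite ler_pM2r ?invr_gt0 // lerD2r.
Qed.

End AreaGrowth.

Section SurfaceFunctions.
Context {R : realType} {n : nat}.
Local Notation V := 'rV[R]_n.+1.
Variables (C : connectivity n.+1) (q : 'I_(nvert C) -> V).
Local Notation Q j := (corners q j).

Lemma poly_on_lin k (E : set V) (f g : V -> R) (s t : R) : poly_on k E f -> poly_on k E g ->
  poly_on k E (fun x => s * f x + t * g x).
Proof.
move=> [c fE] [c' gE]; exists (fun al => s * c al + t * c' al) => x Ex.
rewrite (fE _ Ex) (gE _ Ex) !mulr_sumr -big_split /=; apply: eq_bigr => al _; ring.
Qed.

Lemma poly_on_coord (E : set V) i : poly_on 1 E (fun x => x ord0 i).
Proof.
pose al0 : {ffun 'I_n.+1 -> 'I_2} := [ffun k => if k == i then ord_max else ord0].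
exists (fun al => (al == al0)%:R) => x _.
rewrite (bigD1 al0) /=; last first.
  by rewrite (bigD1 i) //= ffunE eqxx big1 // => k /negbTE ki; rewrite ffunE ki.
rewrite eqxx mul1r (bigD1 i) //= ffunE eqxx expr1 big1 ?mulr1; last first.
  by move=> k /negbTE ki; rewrite ffunE ki expr0.
by rewrite big1 ?addr0 // => al /andP[_ /negbTE ->]; rewrite mul0r.
Qed.

Lemma Vh_lin (f g : V -> R) (s t : R) : Vh q f -> Vh q g -> Vh q (fun x => s * f x + t * g x).
Proof.
move=> [cf pf] [cg pg]; split; last by move=> j; exact: poly_on_lin.
by apply: continuous_addr; apply: continuous_mulr => //;
  [exact: continuous_cstr|exact: continuous_cstr].
Qed.

Lemma Vh_coord i : Vh q (fun x => x ord0 i).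
Proof.
split; last by move=> j; exact: poly_on_coord.
by apply: continuous_subspaceT; exact: coord_continuous.
Qed.

Lemma Vh_affine f j : Vh q f -> exists g, affine_fun g /\
  forall x, csimplex (Q j) x -> f x = g x.
Proof.
move=> [cf pf]; have [g [pg ag fg]] := poly_on1_affine (pf j).
exists g; split => //; apply: (csimplex_extension cf) => //.
  exact/smooth_continuous/polyfun_smooth.
by move=> x ?; exists j.
Qed.

(** A short step along an edge, from an interior point, stays in the simplex, on
    which the function is affine. *)
Lemma derive_along_edge f j k x : Vh q f -> osimplex (Q j) x ->
  'D_(Q j (lift ord0 k) - Q j ord0) f x = f (Q j (lift ord0 k)) - f (Q j ord0).
Proof.
move=> /(Vh_affine j)[g [ag fg]] [c [c0 c1 xE]].
set w := Q j _ - _.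
pose b h l := c l + h * ((l == lift ord0 k)%:R - (l == ord0)%:R).
have b1 h : \sum_l b h l = 1.
  by rewrite big_split /= c1 -mulr_sumr sumrB !sum_delta1 subrr mulr0 addr0.
have bE h : h *: w + x = \sum_l b h l *: Q j l.
  under [RHS]eq_bigr do rewrite scalerDl -scalerA scalerBl.
  by rewrite big_split /= -xE -scaler_sumr sumrB !sum_delta addrC.
have x0 : csimplex (Q j) x by apply: osimplex_csimplex; exists c.
have gb h : g (h *: w + x) = g x + h * (g (Q j (lift ord0 k)) - g (Q j ord0)).
  rewrite bE (ag _ _ _ (b1 h)) xE (ag _ _ _ c1).
  under eq_bigr do rewrite mulrDl -mulrA mulrBl.
  by rewrite big_split /= -mulr_sumr sumrB !sum_deltaM.
rewrite /derive; apply/cvg_lim => //; apply: cvg_near_cst.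
have near_b : \forall h \near (0 : R)^', forall l, 0 < b h l.
  apply: cvg_within; apply: (@filter_forall _ _ (fun l h => 0 < b h l) (nbhs (0 : R)) _) => l.
  have cb : continuous (b^~ l).
    apply: continuous_addr; first exact: continuous_cstr.
    apply: continuous_mulr; first by move=> ?; exact: cvg_id.
    exact: continuous_cstr.
  have := cb 0; rewrite /continuous_at /b mul0r addr0 => /cvgr_gt; apply; exact: c0.
near=> h; have bh : forall l, 0 < b h l by near: h.
rewrite /= !fg //; last 3 first.
- exact: csimplex_corner.
- exact: csimplex_corner.
- by rewrite bE; exists (b h); split => // l; exact: ltW.
rewrite gb [g x + _]addrC addrK /GRing.scale /= mulKf //.
by near: h; exact: nbhs_dnbhs_neq.
Unshelve. all: by end_near. Qed.

Lemma sgrad_corner_grad (X : V -> V) j x : Vhvec q X -> osimplex (Q j) x ->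
  sgrad (Q j) X x = corner_grad (Q j) (X \o Q j).
Proof.
move=> VX xj; apply/matrixP => i l; rewrite mxE /sgrad_scalar /corner_grad.
set r := \row__ _; have -> : r = row i (edges (X \o Q j))^T.
  apply/rowP => k; rewrite !mxE /=.
  rewrite (_ : row k (edges (Q j)) = Q j (lift ord0 k) - Q j ord0).
    exact: (derive_along_edge k (VX i) xj).
  by apply/rowP => m; rewrite !mxE.
by rewrite -!row_mul mxE.
Qed.

Lemma int_surf_cst (w : 'I_(nsimp C) -> V -> R) (c : 'I_(nsimp C) -> R) :
  (forall j x, osimplex (Q j) x -> w j x = c j) ->
  int_surf q w = vol (@ref_simplex R n) * \sum_j enorm (orient (Q j)) * c j.
Proof.
move=> wc; rewrite mulr_sumr; apply: eq_bigr => j _.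
rewrite (eq_int_Rn (g := fun=> c j)).
  by rewrite (int_Rn_cst _ (@ref_simplex_bounded_measurable R n)) mulrA mulrC.
by move=> s s0; apply: wc; rewrite -sptE; apply/osimplex_spt; exists s.
Qed.

Lemma area_corners : area q = vol (@ref_simplex R n) * \sum_j enorm (orient (Q j)).
Proof.
rewrite /area (int_surf_cst (c := fun=> 1)) //; congr (_ * _).
by apply: eq_bigr => j _; rewrite mulr1.
Qed.

Lemma corner_gradB c p (r r' : 'I_n.+1 -> V) :
  corner_grad p (fun k => c *: (r k - r' k)) = c *: (corner_grad p r - corner_grad p r').
Proof.
rewrite /corner_grad -!mulmxBl -raddfB /= !scalemxAl -linearZ /=; congr (_^T *m _ *m _).
by apply/matrixP => i l; rewrite !mxE; ring.
Qed.

End SurfaceFunctions.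

(** * The energy law *)

Section EnergyLaw.
Context {R : realType} {n : nat} (D : problem R n) (H : discrete R n).
Local Notation V := 'rV[R]_n.+1.
Hypothesis hd : n.+1 = 2%N \/ n.+1 = 3%N.
Hypothesis adm : admissible D.
Hypothesis sol : fitted_ALE_solution D H.
Local Notation Q m j := (corners (spos H m) j).

Lemma solution_step m : (m < nstep D)%N -> [/\ solves_step D H m, moves_surface H m, moves_mesh D H m & valid_ale D H m].
Proof. by case: sol => _ _; apply. Qed.

Lemma surface_orient_gt0 m j : (m <= nstep D)%N -> 0 < enorm (orient (Q m j)).
Proof.
case: sol => h _ _ /h[clo sub ori reg fit].
by apply: orient_surface_gt0; try exact: reg; case: adm.
Qed.

Lemma corners_next m j : (m < nstep D)%N -> Q m.+1 j = defo H m.+1 \o Q m j.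
Proof. by move=> /solution_step[_ [h _] _ _]; apply/funext => k; rewrite /corners h. Qed.

Lemma area_step m : (m < nstep D)%N ->
  let zeta := fun x => (dt D)^-1 *: (defo H m.+1 x - x) in
  (dt D)^-1 * (area (spos H m.+1) - area (spos H m)) <=
  int_surf (spos H m) (fun j x => dot (sgrad (Q m j) (defo H m.+1) x) (sgrad (Q m j) zeta x)) /\
  Vhvec (spos H m) zeta.
Proof.
move=> mM zeta; have dt0 := dt_gt0 adm mM.
have [[[_ _ VX _] _ _ _ _] _ _ _] := solution_step mM.
have Vz : Vhvec (spos H m) zeta.
  move=> i; have := Vh_lin (dt D)^-1 (- (dt D)^-1) (VX i) (@Vh_coord R n _ (spos H m) i).
  by congr Vh; apply/funext => x; rewrite /zeta !mxE; ring.
split => //.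
rewrite (int_surf_cst (c := fun j => (dt D)^-1 * dot (corner_grad (Q m j) (Q m.+1 j))
    (corner_grad (Q m j) (Q m.+1 j) - corner_grad (Q m j) (Q m j)))); last first.
  move=> j x xj; rewrite !(sgrad_corner_grad _ xj) //.
  rewrite -corners_next // (_ : zeta \o _ = fun k => (dt D)^-1 *: (Q m.+1 j k - Q m j k)).
    by rewrite corner_gradB dotZr.
  by apply/funext => k; rewrite corners_next.
rewrite !area_corners -mulrBr mulrCA; apply: ler_wpM2l.
  by apply: fine_ge0; exact: measure_ge0.
rewrite -sumrB mulr_sumr; apply: ler_sum => j _; rewrite mulrCA.
apply: ler_wpM2l; first by rewrite invr_ge0 ltW.
by apply: area_growth => //; apply: surface_orient_gt0 => //; exact: ltnW.
Qed.

Lemma ipE_L2norm p q (E : set V) (f : V -> 'M[R]_(p, q)) : L2norm E f ^+ 2 = ip E f f.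
Proof.
rewrite /L2norm sqr_sqrtr //; apply: Rintegral_ge0 => t _; exact: dot_ge0.
Qed.

Lemma phase_ge0 m cm cp x : 0 <= cm -> 0 <= cp -> 0 <= phase (spos H m) (Om D) cm cp x.
Proof. by move=> c0 c1; rewrite addr_ge0 // mulr_ge0 // indicE ler0n. Qed.

Lemma energyE k l : energy D H k l = 2^-1 * kinetic D H k l + gamma D * area (spos H l).
Proof.
rewrite /energy ipE_L2norm; congr (_ * _ + _); apply: eq_int_Rn => x _.
rewrite dotZ -expr2 sqr_sqrtr //.
by apply: phase_ge0; case: adm => _ _ [? ? ? ? ?] _ _; exact: ltW.
Qed.

Lemma dissipationE m : dissipation D H m =
  ip (Om D) (fun x => mu D H m x *: symgrad (pos H m) (vel H m.+1) x)
    (symgrad (pos H m) (vel H m.+1)).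
Proof.
rewrite /dissipation ipE_L2norm; apply: eq_int_Rn => x _.
rewrite dotZ -expr2 sqr_sqrtr; first by rewrite [RHS]dotC dotZr.
by apply: phase_ge0; case: adm => _ _ [? ? ? ? ?] _ _; exact: ltW.
Qed.

(** Testing with the solution itself: the convective term is antisymmetric, the
    pressure is tested by its own divergence constraint, and the two lumped
    surface terms are the same. *)
Lemma energy_step m : (m < nstep D)%N ->
  energy D H m m.+1 + 2 * dt D * dissipation D H m <=
  energy D H m.-1 m + dt D * gravity_work D H m.
Proof.
move=> mM; have dt0 := dt_gt0 adm mM.
have [[[U1 P1 X1 K1] a1 a2 a3 a4] _ _ _] := solution_step mM.
have [hA Vz] := area_step mM.
have hK := kinetic_step adm sol mM.
have g0 : 0 < gamma D by case: adm => _ _ [].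
move: (a1 _ U1); rewrite /antisym_conv subrr mulr0 addr0.
rewrite (_ : ips _ _ _ = 0) ?subr0; last first.
  by rewrite -(a2 _ P1); apply: eq_int_Rn => x _; rewrite mulrC.
rewrite -dissipationE -/(gravity_work D H m).
have -> : int_surf (spos H m) (fun j x => dot (curv H m.+1 x *: nu m j) (vel H m.+1 x)) =
  - int_surf (spos H m) (fun j x => dot (sgrad (Q m j) (defo H m.+1) x)
       (sgrad (Q m j) (fun x => (dt D)^-1 *: (defo H m.+1 x - x)) x)).
  apply/esym/eqP; rewrite eqr_oppLR -addr_eq0 addrC; apply/eqP.
  rewrite -[RHS](a4 _ Vz); congr (_ + _).
  have /eqP := a3 _ K1; rewrite subr_eq0 => /eqP e3.
  transitivity (int_surf (spos H m) (fun j x => dot (vel H m.+1 x) (nu m j) * curv H m.+1 x)).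
    congr int_surf; apply/funext => j; apply/funext => x.
    by rewrite dotC dotZr mulrC.
  rewrite -e3; congr int_lumped; apply/funext => j; apply/funext => x.
  by rewrite [RHS]dotC dotZr mulrC.
set T1 := ip _ _ _ in hK *; set S := int_surf _ _ in hA *.
rewrite !energyE; move: hK hA; rewrite invfM.
set A' := area _; set A := area _; set K' := kinetic _ _ _ _; set K := kinetic _ _ _ _.
set W := gravity_work _ _ _; set F := dissipation _ _ _.
move=> hK hA e1.
have hK' : 2^-1 * (K' - K) <= dt D * T1.
  have -> : 2^-1 * (K' - K) = dt D * (2^-1 / dt D * (K' - K)) by field; rewrite gt_eqF.
  by apply: ler_wpM2l hK; exact: ltW.
have hA' : gamma D * (A' - A) <= dt D * (gamma D * S).
  rewrite mulrCA; apply: ler_wpM2l; first exact: ltW.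
  by have := ler_wpM2l (ltW dt0) hA; rewrite mulrA mulfV ?gt_eqF // mul1r.
have : dt D * W = dt D * T1 + 2 * dt D * F + dt D * (gamma D * S) by rewrite -e1; ring.
move=> ->; lra.
Qed.

Lemma energy_law k : (k < nstep D)%N ->
  energy D H k k.+1 + 2 * dt D * \sum_(0 <= m < k.+1) dissipation D H m <=
  energy D H 0 0 + dt D * \sum_(0 <= m < k.+1) gravity_work D H m.
Proof.
elim: k => [|k IH] kM.
  by rewrite !big_nat1; exact: (energy_step kM).
have := energy_step kM; have := IH (ltnW kM).
rewrite !(big_nat_recr k.+1) //= !mulrDr.
set a := energy D H k k.+1; set b := energy D H k.+1 k.+2; set c := energy D H 0 0.
set s := _ * (\sum_(_ <= _ < _) dissipation _ _ _); set t := _ * dissipation _ _ _.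
set u := _ * (\sum_(_ <= _ < _) gravity_work _ _ _); set v := _ * gravity_work _ _ _.
move: a b c s t u v => a b c s t u v; lra.
Qed.

End EnergyLaw.

(** * Derivatives of determinants *)

Section DerivativeOfDeterminants.
Context {R : realType}.

Lemma continuous_prodr (T : topologicalType) (I : Type) (r : seq I) (f : I -> T -> R) :
  (forall i, continuous (f i)) -> continuous (fun x => \prod_(i <- r) f i x).
Proof.
move=> cf; elim: r => [|i r IH].
  by under eq_fun do rewrite big_nil; exact: continuous_cstr.
by under eq_fun do rewrite big_cons; exact: continuous_mulr.
Qed.

Lemma continuous_det (T : topologicalType) k (M : T -> 'M[R]_k) :
  (forall i j, continuous (fun t => M t i j)) -> continuous (fun t => \det (M t)).
Proof.
move=> cM; apply: continuous_sumr => s; apply: continuous_mulr.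
  exact: continuous_cstr.
by apply: continuous_prodr => i; exact: cM.
Qed.

Lemma is_derive_affine (c d t : R) : is_derive t 1 (fun x => c + x * d) d.
Proof.
have cv : (fun h : R => h^-1 *: (((fun x => c + x * d) \o shift t) (h *: 1) - (c + t * d))) @ 0^'
    --> d.
  apply: cvg_near_cst; near=> h.
  have h0 : h != 0 by near: h; exact: nbhs_dnbhs_neq.
  by rewrite /GRing.scale /= mulr1; field.
by split; [apply/cvg_ex; exists d|exact/cvg_lim].
Unshelve. all: by end_near. Qed.

Lemma is_derive_big (I : Type) (r : seq I) (f df : I -> R -> R) (t : R) :
  (forall i, is_derive t 1 (f i) (df i t)) ->
  is_derive t 1 (fun t => \sum_(i <- r) f i t) (\sum_(i <- r) df i t).
Proof.
move=> h; elim: r => [|i r IH].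
  by under eq_fun do rewrite big_nil; rewrite big_nil; exact: is_derive_cst.
by under eq_fun do rewrite big_cons; rewrite big_cons; exact: is_deriveD.
Qed.

Lemma is_derive_prod k (f : 'I_k -> R -> R) (df : 'I_k -> R) (t : R) :
  (forall i, is_derive t 1 (f i) (df i)) ->
  is_derive t 1 (fun t => \prod_i f i t) (\sum_i df i * \prod_(j | j != i) f j t).
Proof.
elim: k f df => [|k IH] f df h.
  under eq_fun do rewrite big_ord0; rewrite big_ord0; exact: is_derive_cst.
under eq_fun do rewrite big_ord_recl.
apply: (is_derive_eq (is_deriveM (h ord0) (IH _ _ (fun i => h (lift ord0 i))))).
rewrite [RHS]big_ord_recl addrC; congr (_ + _).
  rewrite [RHS]mulrC; congr (_ * _).
  by rewrite [RHS]big_mkcond big_ord_recl /= mul1r.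
rewrite scaler_sumr; apply: eq_bigr => i _.
rewrite [in RHS]big_mkcond big_ord_recl /= mulrCA; congr (_ * (_ * _)).
by rewrite big_mkcond; apply: eq_bigr => j _.
Qed.

(** The determinant is multilinear in its rows. *)
Lemma is_derive_det k (A B : 'M[R]_k) (t : R) :
  is_derive t 1 (fun t => \det (A + t *: B))
    (\sum_i \det (set_row i (row i B) (A + t *: B))).
Proof.
pose f (s : 'S_k) i (u : R) := (A + u *: B) i (s i).
have df s i : is_derive t 1 (f s i) (B i (s i)).
  by rewrite /f; under eq_fun do rewrite !mxE; exact: is_derive_affine.
have := @is_derive_big _ (index_enum {perm 'I_k}) (fun s u => (-1) ^+ s * \prod_i f s i u)
  (fun s u => (-1) ^+ s * \sum_i B i (s i) * \prod_(j | j != i) f s j u) t.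
rewrite /determinant => h; apply: (is_derive_eq (h _)).
  move=> s; apply: is_derive_eq.
    by apply: is_deriveZ; apply: is_derive_prod => i; exact: df.
  by [].
under eq_bigr do rewrite mulr_sumr.
rewrite exchange_big /=; apply: eq_bigr => i _; apply: eq_bigr => s _.
congr (_ * _); rewrite [RHS](bigD1 i) //=; congr (_ * _).
  by rewrite !mxE eqxx mxE.
by apply: eq_bigr => j /negbTE ji; rewrite /f [in RHS]mxE ji [in RHS]mxE.
Qed.

(** The bordered matrix maps the first basis vector to the vector of ones,
    against which the cofactors are summed. *)
Lemma sum_coord_det d (p : 'I_d.+1 -> 'rV[R]_d) (w : 'rV[R]_d) :
  \sum_i coord_det p i (border 0 w) = 0.
Proof.
have -> : \sum_i coord_det p i (border 0 w) =
    (border 0 w *m \adj (bordered p) *m (const_mx 1 : 'cV[R]_d.+1)) ord0 ord0.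
  by rewrite mxE; apply: eq_bigr => i _; rewrite [const_mx _ _ _]mxE mulr1.
have -> : const_mx 1 = bordered p *m (delta_mx ord0 ord0 : 'cV[R]_d.+1).
  by apply/matrixP => i k; rewrite -colE !mxE border_head.
by rewrite mulmxA -(mulmxA (border 0 w)) mul_adj_mx mul_mx_scalar -scalemxAl -colE !mxE
  border_head mulr0.
Qed.

Lemma FTC_derive (F f : R -> R) (a b : R) : a < b -> continuous f ->
  (forall t : R, is_derive t 1 F (f t)) ->
  \int[lebesgue_measure]_(t in `[a, b]) f t = F b - F a.
Proof.
move=> ab cf dF.
have dvF t : derivable F t 1 by case: (dF t).
have cF t : {for t, continuous F} by apply: differentiable_continuous; apply/derivable1_diffP.
rewrite /Rintegral (@continuous_FTC2 R f F a b) //.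
- exact: continuous_subspaceT.
- split; [by move=> t _|by apply: cvg_at_right_filter; exact: cF|
    by apply: cvg_at_left_filter; exact: cF].
- by move=> t _; rewrite derive1E; case: (dF t).
Qed.

Lemma integrable_itv_continuous (f : R -> R) (a b : R) : continuous f ->
  (@lebesgue_measure R).-integrable `[a, b]%classic (EFin \o f).
Proof.
move=> cf; apply: continuous_compact_integrable; first exact: segment_compact.
exact: continuous_subspaceT.
Qed.

Lemma Rintegral_itv_sum (I : Type) (r : seq I) (f : I -> R -> R) (a b : R) :
  (forall i, continuous (f i)) ->
  \int[lebesgue_measure]_(t in `[a, b]) (\sum_(i <- r) f i t) =
  \sum_(i <- r) \int[lebesgue_measure]_(t in `[a, b]) f i t.
Proof.
move=> cf; elim: r => [|i r IH].
  by rewrite big_nil; under eq_Rintegral do rewrite big_nil; rewrite Rintegral_cst // mul0r.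
rewrite big_cons -IH -RintegralD //.
- by apply: eq_Rintegral => t _; rewrite big_cons.
- exact: integrable_itv_continuous.
- by apply: integrable_itv_continuous; exact: continuous_sumr.
Qed.

End DerivativeOfDeterminants.

(** * Volume of the inner phase and fluxes of the velocity *)

Section MeshVolume.
Context {R : realType} {n : nat}.
Local Notation V := 'rV[R]_n.+1.
Variables (Om : set V) (B : connectivity n.+2) (a : 'I_(nvert B) -> V).
Variables (C : connectivity n.+1) (q : 'I_(nvert C) -> V).
Hypothesis reg : regular_partition Om a.
Hypothesis poly : polytopal_domain Om.
Hypothesis clo : closed_surface q.
Hypothesis sub : carrier q `<=` Om.
Hypothesis ori : oriented q Om.
Hypothesis fit : fitted q a.
Local Notation P e := (corners a e).
Local Notation Q j := (corners q j).
Local Notation minus e := (minus_element Om a q e).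
Let edet := element_det reg.

Lemma domain_bounded_measurable : bounded_measurable Om.
Proof.
have [oOm _ _ bOm _] := poly; split; first exact: measurable_pt_open.
have [M [_ HM]] := bOm; exists (M + 1) => x Ox i.
have := HM (M + 1) (ltr_pwDr ltr01 (lexx M)) x Ox.
move=> /= xM; apply: le_trans xM.
rewrite [leRHS](_ : _ = mx_norm x) // mx_normrE.
exact: (le_bigmax _ (fun k : 'I_1 * 'I_n.+1 => `|x k.1 k.2|) (ord0, i)).
Qed.

Lemma open_Om_minus : open (Om_minus q Om).
Proof.
rewrite openE => x [Ox ex].
have nx : ~ carrier q x by case: ex.
have [r /= r0 hr] := (proj1 (nbhs_ballP _ _) (near_off_surface reg clo fit nx)).
have : \forall y \near x, ball x r y by exact: nbhsx_ballx.
have oOm : nbhs x Om by case: poly => oOm _ _ _ _; apply: open_nbhs_nbhs.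
apply: filterS2 oOm => y Oy xy; split => //.
apply: (proj1 (@enclosed_segment _ _ _ q x y _) ex) => t /andP[t0 t1].
apply: hr; rewrite -ball_normE /= opprD addNKr normrN normrZ ger0_norm //.
move: xy; rewrite -ball_normE /= distrC; apply: le_lt_trans.
by rewrite ler_piMl.
Qed.

Lemma vol_Om_minus : vol (Om_minus q Om) =
  vol (@ref_simplex R n.+1) * \sum_(e | minus e) `|\det (bordered (P e))|.
Proof.
have bm : bounded_measurable (Om_minus q Om).
  apply: bounded_measurable_sub domain_bounded_measurable; first by move=> x [].
  by apply: measurable_pt_open; exact: open_Om_minus.
rewrite -[LHS]mul1r -int_Rn_cst //.
rewrite (int_Rn_elements (a := a) edet _ (K := fun e => minus e) (h := fun _ _ => 1)) //.
- rewrite mulr_sumr; apply: eq_bigr => e _.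
  rewrite int_osimplex //; last exact: continuous_cstr.
  rewrite /comp int_Rn_cst ?mul1r 1?mulrC //; exact: ref_simplex_bounded_measurable.
- by move=> e f x; apply: (osimplex_unique reg).
- by case: reg => _ _ _ <- _ x [Ox _]; exact: subset_closure.
- by move=> e x ex; case: (element_phase reg poly clo fit ex).
- by move=> e; exact: continuous_cstr.
Qed.

Lemma csimplex_comp m k (p : 'I_m -> V) (h : 'I_k -> 'I_m) : csimplex (p \o h) `<=` csimplex p.
Proof.
move=> _ [c [c0 c1 ->]]; exists (fun l => \sum_(i | h i == l) c i); split.
- by move=> l; apply: sumr_ge0.
- by rewrite -c1 (partition_big h predT).
- rewrite (partition_big h predT) //=; apply: eq_bigr => l _.
  by rewrite scaler_suml; apply: eq_bigr => i /eqP <-.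
Qed.

Lemma osimplex_in_facet e i x : osimplex (P e \o lift i) x -> in_facet a e i x.
Proof.
move=> [c [c0 c1 ->]].
pose c' k := if unlift i k is Some l then c l else 0.
have c'i : c' i = 0 by rewrite /c' unlift_none.
have c'l l : c' (lift i l) = c l by rewrite /c' liftK.
have c'1 : \sum_k c' k = 1.
  by rewrite (bigD1_ord i) //= c'i add0r -c1; apply: eq_bigr => l _.
have -> : \sum_l c l *: (P e \o lift i) l = \sum_k c' k *: P e k.
  by rewrite [RHS](bigD1_ord i) //= c'i scale0r add0r; apply: eq_bigr => l _; rewrite c'l.
split => [k ki|]; rewrite bcoord_unique //.
by case: (unliftP i k) ki => [l ->|->]; rewrite ?eqxx // c'l.
Qed.

Lemma boundary_facet e i x : ~ has_partner (C := B) e i -> in_facet a e i x -> bdry Om x.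
Proof.
move=> np xF; split.
  exact: (csimplex_closure reg (in_facet_csimplex reg xF)).
have [_ hn] := boundary_facet_normal reg poly xF np.
move=> Ox; have := proj1 (nbhs_singleton hn) Ox.
by rewrite subrr dot_rV big1 ?ltxx // => l _; rewrite mxE mul0r.
Qed.

Lemma no_flux_facet (u : V -> V) e i x : no_normal_flux Om (bdry Om) u ->
  ~ has_partner (C := B) e i -> in_facet a e i x -> dot (u x) (facet_normal (P e) i) = 0.
Proof.
move=> hu np xF.
have := hu _ _ (boundary_facet np xF) (boundary_facet_normal reg poly xF np).
rewrite dotZr => /eqP; rewrite mulf_eq0 => /orP[|/eqP //].
rewrite mulf_eq0 oppr_eq0 sgr_eq0 (negbTE (edet e)) invr_eq0 /= gt_eqF //.
by apply: enorm_gt0; exact: (facet_normal_neq0 reg).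
Qed.

(** The outer normal only exists in the relative interior of a facet; the
    vertices are reached by continuity. *)
Lemma no_flux_closed_facet (u : V -> V) e i x : no_normal_flux Om (bdry Om) u ->
  (forall c, {within closure Om, continuous (fun y => u y ord0 c)}) ->
  ~ has_partner (C := B) e i -> csimplex (P e \o lift i) x ->
  dot (u x) (facet_normal (P e) i) = 0.
Proof.
move=> hu cu np xe; set N := facet_normal _ _.
apply: (csimplex_extension (W := closure Om) (f := fun x => dot (u x) N) (g := fun=> 0)) xe => //.
- under eq_fun do rewrite dot_rV.
  apply: continuous_sumr => c; apply: continuous_mulr; first exact: cu.
  exact: continuous_cstr.
- by move=> y; exact: cst_continuous.
- by move=> y /csimplex_comp; exact: csimplex_closure.
- by move=> y /osimplex_in_facet; exact: no_flux_facet.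
Qed.

Section FluxOfField.
Variables (u : V -> V) (G : 'I_(nsimp B) -> 'I_n.+1 -> V -> R).
Hypothesis sG : forall e i, smooth (G e i).
Hypothesis uG : forall e i x, csimplex (P e) x -> u x ord0 i = G e i x.

Definition face_flux e i : V := \row_c face_int (P e) i (G e c).

Definition surface_flux j : V := \row_c int_Rn ref_simplex (fun s => u (spt (Q j) s) ord0 c).

Lemma spt_face e (h : 'I_n.+1 -> 'I_n.+2) s : ref_simplex s -> csimplex (P e) (spt (P e \o h) s).
Proof.
move=> s0; apply: (@csimplex_comp _ _ _ h); apply: osimplex_csimplex.
by apply/osimplex_spt; exists s.
Qed.

Lemma int_div_flux e :
  `|\det (bordered (P e))| *
    int_Rn ref_simplex (fun s => \sum_c 'D_(delta_mx ord0 c) (G e c) (spt (P e) s)) =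
  \sum_i flux a a face_flux e i.
Proof.
have cD c : continuous (fun x => 'D_(delta_mx ord0 c) (G e c) x) by case: (sG e c) => _; apply.
rewrite -(int_osimplex (f := fun x => \sum_c 'D_(delta_mx ord0 c) (G e c) x)) //;
  last exact: continuous_sumr.
rewrite int_Rn_sum //; last exact: osimplex_bounded_measurable.
under eq_bigr do rewrite int_osimplex_derive //.
rewrite -mulr_sumr exchange_big /= mulr_sumr; apply: eq_bigr => i _.
rewrite /flux; congr (_ * _); rewrite -dot_facet_normal dot_rV; apply: eq_bigr => c _.
by rewrite !mxE mulrC.
Qed.

Lemma face_flux_perm e i (h : 'I_n.+1 -> 'I_n.+2) c : injective h -> (forall k, h k != i) ->
  face_int (P e) i (G e c) = int_Rn ref_simplex (G e c \o spt (P e \o h)).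
Proof.
move=> hi hn.
have [s hs] : exists s : 'S_n.+1, h =1 lift i \o s.
  apply: enum_perm hi; first exact: lift_inj.
  by move=> k; case: (unliftP i (h k)) (hn k) => [l ->|->]; rewrite ?eqxx //; exists l.
have -> : P e \o h = (P e \o lift i) \o s by apply/funext => k /=; rewrite hs.
by rewrite int_ref_perm //; exact: smooth_continuous.
Qed.

Lemma face_flux_shared e i f k : facet e i = facet f k -> face_flux e i = face_flux f k.
Proof.
move=> fE; apply/rowP => c; rewrite !mxE.
have [s [si sl]] := facet_perm reg fE.
rewrite (@face_flux_perm e i (fun l => s (lift k l))); first last.
- by move=> l; rewrite -si (inj_eq perm_inj) eq_sym neq_lift.
- by move=> l l' /perm_inj/lift_inj.
have pE : P e \o (fun l => s (lift k l)) = P f \o lift k.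
  by apply/funext => l; rewrite /= /corners sl // eq_sym neq_lift.
apply: eq_int_Rn => x x0 /=.
rewrite -(uG (e := e)); last exact: spt_face.
by rewrite pE -(uG (e := f)) //; exact: spt_face.
Qed.

Lemma face_flux_surface j e i h : facet_of a q j e i h -> face_flux e i = surface_flux j.
Proof.
move=> [hi hn hE]; apply/rowP => c; rewrite !mxE (@face_flux_perm e i h c hi hn).
have qE : Q j = P e \o h by apply/funext => k; rewrite hE.
by apply: eq_int_Rn => x x0 /=; rewrite qE (uG (e := e)) //; exact: spt_face.
Qed.

Lemma face_flux_boundary e i : no_normal_flux Om (bdry Om) u -> ~ has_partner (C := B) e i ->
  coord_det (P e) i (border 0 (face_flux e i)) = 0.
Proof.
move=> hu np; rewrite -dot_facet_normal dot_rV.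
set N := facet_normal _ _.
have bR := @ref_simplex_bounded_measurable R n.
have cG c : continuous (fun s : 'rV[R]_n => G e c (spt (P e \o lift i) s)).
  by apply: (continuous_comp_spt (p := P e \o lift i)); exact: smooth_continuous.
transitivity (int_Rn (@ref_simplex R n) (fun s => \sum_c N ord0 c * G e c (spt (P e \o lift i) s))).
  rewrite int_Rn_sum //; last first.
    by move=> c; apply: continuous_mulr => //; exact: continuous_cstr.
  by apply: eq_bigr => c _; rewrite (int_RnZ _ bR (cG c)) mulrC; congr (_ * _); rewrite mxE.
rewrite (eq_int_Rn (g := fun=> 0)); first by rewrite int_Rn_cst // mul0r.
move=> s s0.
have xF : in_facet a e i (spt (P e \o lift i) s).
  by apply: osimplex_in_facet; apply/osimplex_spt; exists s.
rewrite -[RHS](no_flux_facet hu np xF) dot_rV; apply: eq_bigr => c _.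
by rewrite mulrC -(uG (e := e)) //; exact: spt_face.
Qed.

Lemma int_surf_flux : int_surf q (fun j x => dot (u x) (unit_normal (Q j)) * 1) =
  \sum_j dot (surface_flux j) (orient (Q j)).
Proof.
apply: eq_bigr => j _; have [e [i [h fj]]] := fitted_facet clo fit j.
have [hi hn hE] := fj.
have qE : Q j = P e \o h by apply/funext => k; rewrite hE.
have o0 := orient_surface_gt0 reg clo fit j.
have bR := @ref_simplex_bounded_measurable R n.
have cG c : continuous (fun s : 'rV[R]_n => G e c (spt (P e \o h) s)).
  by apply: (continuous_comp_spt (p := P e \o h)); exact: smooth_continuous.
rewrite (eq_int_Rn (g := fun s => \sum_c (enorm (orient (Q j)))^-1 * orient (Q j) ord0 c *
    G e c (spt (P e \o h) s))); last first.
  move=> s s0; rewrite -sptE mulr1 dot_rV; apply: eq_bigr => c _.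
  by rewrite [X in _ * X]mxE mulrC qE (uG (e := e)) //; exact: spt_face.
rewrite int_Rn_sum //; last first.
  move=> c; apply: continuous_mulr => //.
  exact: (@cst_continuous _ _ ((enorm (orient (Q j)))^-1 * orient (Q j) ord0 c : R)).
rewrite mulr_sumr dot_rV; apply: eq_bigr => c _.
rewrite int_RnZ // !mulrA mulfV ?gt_eqF // mul1r mulrC; congr (_ * _).
by rewrite mxE; apply: eq_int_Rn => s s0; rewrite qE -(uG (e := e)) //; exact: spt_face.
Qed.

End FluxOfField.

End MeshVolume.

(** * Volume conservation *)

Section MovingSimplices.
Context {R : realType}.

Lemma poly_on_cst d (E : set 'rV[R]_d) (c : R) : poly_on 1 E (fun=> c).
Proof.
pose al0 : {ffun 'I_d -> 'I_2} := [ffun => ord0].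
exists (fun al => (al == al0)%:R * c) => x _.
rewrite (bigD1 al0) /=; last by rewrite big1 // => i _; rewrite ffunE.
rewrite eqxx mul1r big1 ?mulr1; last by move=> i _; rewrite ffunE expr0.
by rewrite big1 ?addr0 // => al /andP[_ /negbTE ->]; rewrite !mul0r.
Qed.

Lemma dot_border d (s t : R) (x y : 'rV[R]_d) :
  \sum_j border s x ord0 j * border t y ord0 j = s * t + dot x y.
Proof.
rewrite big_ord_recl !border_head dot_rV; congr (_ + _).
by apply: eq_bigr => j _; rewrite !border_tail.
Qed.

Lemma continuous_moving_orient n (tm tm' dt : R) (q q' : 'I_n.+1 -> 'rV[R]_n.+1) i :
  continuous (fun t => orient (moving_corners tm tm' dt q q' t) ord0 i).
Proof.
under eq_fun do rewrite mxE.
apply: (continuous_det (k := 1 + n)) => k l; case: (split_ordP k) => k' ->.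
  under eq_fun do rewrite col_mxEu.
  exact: continuous_cstr.
under eq_fun do rewrite col_mxEd !mxE.
have cc (c : R) : continuous (fun _ : R => c) by exact: cst_continuous.
have cid' : continuous (fun t : R => t) by move=> t; exact: cvg_id.
have m (x y : R) : continuous (fun t => (tm' - t) / dt * x + (t - tm) / dt * y).
  apply: continuous_addr; apply: continuous_mulr => //; apply: continuous_mulr => //;
    exact: continuous_subr.
exact: continuous_subr.
Qed.

End MovingSimplices.

Section VolumeConservation.
Context {R : realType} {n : nat} (D : problem R n) (H : discrete R n).
Local Notation V := 'rV[R]_n.+1.
Hypothesis adm : admissible D.
Hypothesis sol : fitted_ALE_solution D H.
Local Notation P m e := (corners (pos H m) e).
Local Notation Q m j := (corners (spos H m) j).
Local Notation minus m e := (minus_element (Om D) (pos H m) (spos H m) e).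

Let poly : polytopal_domain (Om D). Proof. by case: adm. Qed.

Variable m : nat.
Hypothesis mM : (m < nstep D)%N.
Let mM' : (m <= nstep D)%N := ltnW mM.
Let clo : closed_surface (spos H m). Proof. by case: sol => h _ _; case: (h _ mM'). Qed.
Let sub : carrier (spos H m) `<=` Om D. Proof. by case: sol => h _ _; case: (h _ mM'). Qed.
Let ori : oriented (spos H m) (Om D). Proof. by case: sol => h _ _; case: (h _ mM'). Qed.
Let reg : regular_partition (Om D) (pos H m). Proof. by case: sol => h _ _; case: (h _ mM'). Qed.
Let fit : fitted (spos H m) (pos H m). Proof. by case: sol => h _ _; case: (h _ mM'). Qed.
Let dt0 : 0 < dt D := dt_gt0 adm mM.

(** Testing the divergence constraint with the phase indicator: the velocity
    has no net flux through the interface. *)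
Lemma interface_flux0 :
  in_Pspace D H m (fun x => \1_(Om_minus (spos H m) (Om D)) x - omega D H m) ->
  \sum_j dot (surface_flux (spos H m) (vel H m.+1) j) (orient (Q m j)) = 0.
Proof.
move=> hP; have [[[[U1 [_ Ud1 Ud2]] _ _ _] _ a2 _ _] _ _ _] := solution_step sol mM.
have [G [sG UG]] := Svec_smooth reg U1.
have nf : no_normal_flux (Om D) (bdry (Om D)) (vel H m.+1).
  move=> x nu xb xn; case: adm => _ [bE _] _ _ _; move: xb; rewrite bE => -[/Ud1 ->|xb].
    by rewrite dot_rV big1 // => l _; rewrite mxE mul0r.
  exact: Ud2.
have wsh := face_flux_shared reg sG UG.
have wb e i := face_flux_boundary reg poly sG UG (e := e) (i := i) nf.
have ws j e i h (fj : facet_of (pos H m) (spos H m) j e i h) :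
    face_flux (pos H m) G e i = surface_flux (spos H m) (vel H m.+1) j /\
    Q m j = P m e \o h.
  split; first exact: (face_flux_surface sG UG fj).
  by case: fj => _ _ hE; apply/funext => k; rewrite hE.
rewrite -(flux_sum_minus reg poly clo sub ori fit wsh wb ws).
pose I e := \sum_i flux (pos H m) (pos H m) (face_flux (pos H m) G) e i.
have I0 : \sum_e I e = 0 by exact: (flux_sum_total reg wsh wb).
have cD e : continuous (fun x => \sum_c 'D_(delta_mx ord0 c) (G e c) x).
  by apply: continuous_sumr => c; case: (sG e c) => _; apply.
have := a2 _ hP; rewrite /ips (int_domain reg poly (h := fun e x =>
  ((minus m e)%:R - omega D H m) * \sum_c 'D_(delta_mx ord0 c) (G e c) x)); first last.
- move=> e x ex; rewrite mulrC; congr (_ * _).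
    have [hm _] := element_phase reg poly clo fit ex.
    rewrite indicE; congr ((nat_of_bool _)%:R - _).
    by apply/idP/idP; rewrite inE => /hm.
  apply: (div_on_element reg ex) => i y ey; apply: UG; exact: osimplex_csimplex.
- move=> e; apply: continuous_mulr => //.
  exact: continuous_cstr.
rewrite (eq_bigr (fun e => (minus m e)%:R * I e - omega D H m * I e)); last first.
  move=> e _; rewrite -mulrBl /I -(int_div_flux reg sG) mulrCA; congr (_ * _).
  rewrite /comp int_RnZ //; first exact: ref_simplex_bounded_measurable.
  exact: (continuous_comp_spt (p := P m e) (cD e)).
rewrite sumrB -mulr_sumr I0 mulr0 subr0 => h; rewrite -[RHS]h [LHS]big_mkcond.
by apply: eq_bigr => e _; case: (minus m e); rewrite ?mul1r ?mul0r.
Qed.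

Definition orient_integral j : V :=
  \row_i \int[lebesgue_measure]_(t in `[time D m, time D m.+1])
    orient (moving_corners (time D m) (time D m.+1) (dt D) (Q m j) (Q m.+1 j) t) ord0 i.

(** The lumped interface condition tested with 1; the limits at the corners are
    values, since the test expression is continuous on the closed simplex. *)
Lemma interface_displacement0 :
  \sum_j dot (surface_flux (spos H m) (vel H m.+1) j) (orient (Q m j)) = 0 ->
  \sum_j dot (\sum_k (Q m.+1 j k - Q m j k))
    (orient_integral j) = 0.
Proof.
move=> fl0; have [[[[U1 _] _ VX _] _ _ a3 _] _ _ _] := solution_step sol mM.
have [G [sG UG]] := Svec_smooth reg U1.
have V1 : Vh (spos H m) (fun=> 1).
  split; first by apply: continuous_subspaceT; exact: cst_continuous.
  by move=> j; exact: poly_on_cst.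
have := a3 _ V1; rewrite (int_surf_flux reg clo fit sG UG) fl0 subr0.
pose Iv := orient_integral.
rewrite /int_lumped => /eqP; rewrite mulf_eq0 invr_eq0 pnatr_eq0 /= => /eqP h.
suff E : \sum_j simp_area (Q m j) * \sum_k lim ((fun x =>
    dot ((dt D)^-1 *: (defo H m.+1 x - x)) (nu_half D m j) * 1)
      @ within (osimplex (Q m j)) (nbhs (Q m j k))) =
    (n`!%:R)^-1 * (dt D)^-1 ^+ 2 * \sum_j dot (\sum_k (Q m.+1 j k - Q m j k)) (Iv j).
  move/eqP: h; rewrite E mulf_eq0 => /orP[|/eqP //].
  by rewrite mulf_eq0 expf_eq0 /= !invr_eq0 pnatr_eq0 eqn0Ngt fact_gt0 /= gt_eqF.
rewrite mulr_sumr; apply: eq_bigr => j _.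
have o0 : 0 < enorm (orient (Q m j)) := orient_surface_gt0 reg clo fit j.
have lE k : lim ((fun x => dot ((dt D)^-1 *: (defo H m.+1 x - x)) (nu_half D m j) * 1)
      @ within (osimplex (Q m j)) (nbhs (Q m j k))) =
    (dt D)^-1 ^+ 2 / enorm (orient (Q m j)) * dot (Q m.+1 j k - Q m j k) (Iv j).
  have pF : ProperFilter (within (osimplex (Q m j)) (nbhs (Q m j k))).
    by apply: within_nbhs_proper; apply: csimplex_closure_osimplex; exact: csimplex_corner.
  have cz : {within carrier (spos H m), continuous
      (fun x => dot ((dt D)^-1 *: (defo H m.+1 x - x)) (nu_half D m j) * 1)}.
    apply: continuous_mulr; last exact: continuous_cstr.
    under eq_fun do rewrite dot_rV; apply: continuous_sumr => c; apply: continuous_mulr;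
      last exact: continuous_cstr.
    under eq_fun do rewrite !mxE.
    apply: continuous_mulr; first exact: continuous_cstr.
    by apply: continuous_subr; [case: (VX c)|case: (@Vh_coord R n _ (spos H m) c)].
  have Wj : osimplex (Q m j) `<=` carrier (spos H m).
    by move=> x /osimplex_csimplex xj; exists j.
  have Wk : carrier (spos H m) (Q m j k) by exists j => //; exact: csimplex_corner.
  rewrite (cvg_lim (@Rhausdorff R) (cvg_within_osimplex cz Wj Wk)).
  rewrite mulr1 -[X in X - _](_ : Q m.+1 j k = _); last by rewrite (corners_next sol).
  rewrite /nu_half /weighted_normal dotZ -/(orient_integral j) -/(Iv j); congr (_ * _).
  by field; rewrite !gt_eqF.
under eq_bigr do rewrite lE.
rewrite -mulr_sumr /simp_area.
have -> : dot (\sum_k (Q m.+1 j k - Q m j k)) (Iv j) = \sum_k dot (Q m.+1 j k - Q m j k) (Iv j).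
  rewrite dot_rV; under [RHS]eq_bigr do rewrite dot_rV.
  by rewrite exchange_big /=; apply: eq_bigr => c _; rewrite summxE mulr_suml.
rewrite !mulrA; congr (_ * _); field.
by rewrite !gt_eqF ?ltr0n ?fact_gt0.
Qed.

Definition vertex_velocity l : V := (dt D)^-1 *: (pos H m.+1 l - pos H m l).

Definition pos_at (t : R) l : V :=
  ((time D m.+1 - t) / dt D) *: pos H m l + ((t - time D m) / dt D) *: pos H m.+1 l.

Definition spos_at (t : R) l : V :=
  ((time D m.+1 - t) / dt D) *: spos H m l + ((t - time D m) / dt D) *: spos H m.+1 l.

Lemma time_step : time D m.+1 = time D m + dt D.
Proof. by rewrite /time -natr1 mulrDl mul1r. Qed.

Lemma pos_at_velocity t l : pos_at t l = pos H m l + (t - time D m) *: vertex_velocity l.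
Proof.
by apply/rowP => c; rewrite !mxE time_step; field; rewrite gt_eqF.
Qed.

Lemma pos_at_start l : pos_at (time D m) l = pos H m l.
Proof. by rewrite pos_at_velocity subrr scale0r addr0. Qed.

Lemma pos_at_end l : pos_at (time D m.+1) l = pos H m.+1 l.
Proof.
by rewrite pos_at_velocity time_step addrAC subrr add0r scalerA mulfV ?gt_eqF // scale1r addrC subrK.
Qed.

Lemma bordered_pos_at e : exists A B : 'M[R]_n.+2,
  (forall t, bordered (corners (pos_at t) e) = A + t *: B) /\
  forall i, row i B = border 0 (vertex_velocity (simp e i)).
Proof.
exists (bordered (P m e) - time D m *: \matrix_i border 0 (vertex_velocity (simp e i))).
exists (\matrix_i border 0 (vertex_velocity (simp e i))); split => [t|i]; last by rewrite rowK.
apply/row_matrixP => i; rewrite rowK !raddfD /= raddfN /= !linearZ /= !rowK.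
rewrite /corners pos_at_velocity -{1}[1]addr0 -[X in border (1 + X)](mulr0 (t - time D m)).
by rewrite borderD borderZ -[RHS]addrA; congr (_ + _); rewrite scalerBl scalerN addrC.
Qed.

(** The facet moves within its own hyperplane: the row vector [border (- c) N],
    with [N] normal to the facet at the old time level, annihilates all its
    moving vertices. *)
Lemma mesh_velocity_boundary e i t : ~ has_partner (C := bulk H) e i ->
  coord_det (corners (pos_at t) e) i
    (border 0 (\sum_(l in facet e i) vertex_velocity l)) = 0.
Proof.
move=> np; have [_ _ [[psi [[Spsi npsi _ _] posE]] _] _] := solution_step sol mM.
set N := facet_normal (P m e) i; set w := \sum_(l in _) _.
have N0 : N != 0 by exact: (facet_normal_neq0 reg).
pose c := - coord_det (P m e) i (border 1 0).
have cE x : coord_det (P m e) i (border 1 x) = dot x N - c.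
  by rewrite dot_facet_normal opprK -coord_detD -borderD add0r addr0.
have PN k : k != i -> dot (P m e k) N = c.
  move=> ki; apply/eqP; rewrite -subr_eq0 -cE coord_det_vertex [i == k]eq_sym (negbTE ki).
  by rewrite mul0r.
have vN k : k != i -> dot (vertex_velocity (simp e k)) N = 0.
  move=> ki; rewrite /vertex_velocity posE addrC addKr dotC dotZr dotC.
  rewrite (no_flux_closed_facet reg poly npsi _ np) ?mulr0 //; first by move=> c'; case: (Spsi c').
  case: (unliftP i k) ki => [l ->|->]; last by rewrite eqxx.
  by move=> _; exact: (csimplex_corner (P m e \o lift i)).
have wN : dot w N = 0.
  rewrite dotC dot_rV /w.
  transitivity (\sum_(l in facet e i) dot N (vertex_velocity l)).
    under [RHS]eq_bigr do rewrite dot_rV.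
    by rewrite exchange_big /=; apply: eq_bigr => l _; rewrite summxE mulr_sumr.
  rewrite big1 // => l /imsetP[k]; rewrite !inE => ki ->.
  by rewrite dotC vN.
have ptN k : k != i -> dot (corners (pos_at t) e k) N = c.
  move=> ki; rewrite /corners pos_at_velocity dotC -[_ *: _]opprK -scaleNr dotBr dotZr.
  by rewrite [dot N (vertex_velocity _)]dotC vN // mulr0 subr0 dotC; exact: PN.
pose z := border (- c) N.
have z0 : z != 0.
  apply: contra N0 => /eqP /rowP z0; apply/eqP/rowP => l.
  by have := z0 (lift ord0 l); rewrite border_tail !mxE.
apply/eqP; rewrite coord_detE -det_tr; apply/det0P; exists z => //.
apply/rowP => k; rewrite [LHS]mxE [RHS]mxE.
transitivity (\sum_j z ord0 j * (if k == i then border 0 w else border 1 (corners (pos_at t) e k)) ord0 j).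
  by apply: eq_bigr => j _; rewrite !mxE; case: eqP => // _; rewrite !mxE.
rewrite /z; case: eqP => [_|/eqP ki]; rewrite dot_border dotC.
  by rewrite wN mulr0 addr0.
by rewrite ptN // mulr1 addNr.
Qed.

(** The vertex opposite to a facet can be exchanged for the others, because the
    cofactors of a constant direction sum up to 0; this turns the derivative of
    the determinants into fluxes of the mesh velocity through the facets. *)
Lemma volume_derivative t :
  \sum_(e | minus m e) Num.sg (\det (bordered (P m e))) *
    (\sum_i coord_det (corners (pos_at t) e) i (border 0 (vertex_velocity (simp e i)))) =
  \sum_j dot ((dt D)^-1 *: \sum_k (Q m.+1 j k - Q m j k))
    (orient (moving_corners (time D m) (time D m.+1) (dt D) (Q m j) (Q m.+1 j) t)).
Proof.
have [_ _ [[psi [[_ _ psiX _] posE]] _] _] := solution_step sol mM.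
pose w (e : 'I_(nsimp (bulk H))) i := \sum_(l in facet e i) vertex_velocity l.
have ws e i f k : facet (C := bulk H) e i = facet f k -> w e i = w f k.
  by move=> fE; rewrite /w fE.
have wsum e i : w e i = \sum_(k | k != i) vertex_velocity (simp e k).
  rewrite /w /facet big_imset /=; last by move=> ? ? _ _; exact: (simp_inj reg).
  by apply: eq_bigl => k; rewrite !inE.
have wf j e i h : facet_of (pos H m) (spos H m) j e i h ->
    w e i = (dt D)^-1 *: (\sum_k (Q m.+1 j k - Q m j k)) /\
    corners (spos_at t) j = corners (pos_at t) e \o h.
  move=> fj; have [hi hn hE] := fj.
  have qE k : Q m.+1 j k = P m.+1 e (h k).
    have Qk : carrier (spos H m) (Q m j k) by exists j => //; exact: csimplex_corner.
    rewrite (corners_next sol) //= /corners posE -/(P m e (h k)) -hE (psiX _ Qk).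
    by rewrite addrC subrK.
  split; last first.
    apply/funext => k; rewrite /= /corners /spos_at /pos_at.
    by rewrite -/(Q m j k) -/(Q m.+1 j k) qE hE.
  rewrite wsum scaler_sumr.
  rewrite (reindex h) /=; last first.
    exists (fun k => odflt ord0 [pick l | h l == k]) => k ki.
      by case: pickP => [l /eqP/hi //|/(_ k)]; rewrite eqxx.
    have [l hl] := facet_of_image fj ki; rewrite -hl.
    by case: pickP => [l' /eqP //|/(_ l)]; rewrite eqxx.
  rewrite (eq_bigl predT); last by move=> k; rewrite hn.
  by apply: eq_bigr => k _; rewrite qE hE.
rewrite -(flux_sum_minus reg poly clo sub ori fit ws
  (fun e i np => mesh_velocity_boundary t np) wf).
apply: eq_bigr => e _; rewrite /flux -mulr_sumr mulNr -mulrN; congr (_ * _).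
have vE i : coord_det (corners (pos_at t) e) i (border 0 (vertex_velocity (simp e i))) =
    coord_det (corners (pos_at t) e) i (border 0 (\sum_k vertex_velocity (simp e k))) -
    coord_det (corners (pos_at t) e) i (border 0 (w e i)).
  rewrite [in X in _ = X - _](bigD1 i) //= -wsum -{2}[0]addr0 borderD coord_detD addrK.
  by [].
by under eq_bigr do rewrite vE; rewrite sumrB sum_coord_det sub0r.
Qed.

(** The volume of the enclosed phase changes at the rate of the interface
    fluxes, whose time integral vanishes. *)
Lemma volume_step :
  \sum_j dot (\sum_k (Q m.+1 j k - Q m j k)) (orient_integral j) = 0 ->
  vol (Om_minus (spos H m.+1) (Om D)) = vol (Om_minus (spos H m) (Om D)).
Proof.
move=> h0.
have [regS cloS fitS] : [/\ regular_partition (Om D) (pos H m.+1), closed_surface (spos H m.+1)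
    & fitted (spos H m.+1) (pos H m.+1)].
  by case: sol => h _ _; case: (h _ mM).
rewrite (vol_Om_minus regS poly cloS fitS) (vol_Om_minus reg poly clo fit); congr (_ * _).
rewrite (eq_bigl (fun e => minus m e)); last by move=> e; rewrite (minus_step adm sol).
pose s e := Num.sg (\det (bordered (P m e))).
pose F t := \sum_e (if minus m e then s e else 0) * \det (bordered (corners (pos_at t) e)).
pose wS j : V := (dt D)^-1 *: \sum_k (Q m.+1 j k - Q m j k).
pose mv j t := orient (moving_corners (time D m) (time D m.+1) (dt D) (Q m j) (Q m.+1 j) t).
pose f t := \sum_j \sum_c wS j ord0 c * mv j t ord0 c.
have dF (t : R) : is_derive t 1 F (f t).
  rewrite /F; have hd e : is_derive t 1 (fun t => (if minus m e then s e else 0) *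
        \det (bordered (corners (pos_at t) e)))
      ((if minus m e then s e else 0) * \sum_i coord_det (corners (pos_at t) e) i
         (border 0 (vertex_velocity (simp e i)))).
    have [A [B [AB rB]]] := bordered_pos_at e.
    apply: is_derive_eq.
      apply: is_deriveZ; under eq_fun do rewrite AB; exact: is_derive_det.
    congr (_ * _); apply: eq_bigr => i _.
    by rewrite coord_detE AB rB.
  apply: (is_derive_eq (is_derive_big (index_enum _) (df := fun e t => _) hd)).
  rewrite /f; under [RHS]eq_bigr do rewrite -dot_rV.
  rewrite -volume_derivative [RHS]big_mkcond; apply: eq_bigr => e _.
  by case: (minus m e) => //; exact: mul0r.
have cmv j c : continuous (fun t => wS j ord0 c * mv j t ord0 c).
  apply: continuous_mulr; first exact: continuous_cstr.
  exact: continuous_moving_orient.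
have cf : continuous f by apply: continuous_sumr => j; apply: continuous_sumr => c.
have tt' : time D m < time D m.+1 by rewrite time_step ltrDl.
have := FTC_derive tt' cf dF.
rewrite Rintegral_itv_sum; last by move=> j; exact: continuous_sumr.
rewrite (eq_bigr (fun j => (dt D)^-1 * dot (\sum_k (Q m.+1 j k - Q m j k)) (orient_integral j)));
  last first.
  move=> j _; rewrite Rintegral_itv_sum // dot_rV mulr_sumr; apply: eq_bigr => c _.
  rewrite RintegralZl //; last by apply: integrable_itv_continuous; exact: continuous_moving_orient.
  by rewrite [wS _ _ _]mxE -mulrA; congr (_ * (_ * _)); rewrite mxE.
rewrite -mulr_sumr h0 mulr0 => /esym/eqP; rewrite subr_eq0 /F => /eqP FE.
rewrite [LHS]big_mkcond [RHS]big_mkcond.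
transitivity (F (time D m.+1)); [|transitivity (F (time D m)); first exact: FE].
  apply: eq_bigr => e _; case: ifP => _; last by rewrite mul0r.
  have -> : corners (pos_at (time D m.+1)) e = P m.+1 e.
    by apply/funext => k; rewrite /corners pos_at_end.
  have := jac_gt0 adm sol e mM; rewrite /= => J0.
  rewrite normrEsg; congr (_ * _); rewrite /s.
  have := gtr0_sg J0; rewrite sgrM sgrV => h.
  have D0 : \det (bordered (P m.+1 e)) != 0 by exact: (element_det_at sol).
  by rewrite -[LHS]mul1r -h -mulrA -expr2 sqr_sg D0 mulr1.
apply: eq_bigr => e _; case: ifP => _; last by rewrite mul0r.
have -> : corners (pos_at (time D m)) e = P m e.
  by apply/funext => k; rewrite /corners pos_at_start.
by rewrite normrEsg.
Qed.

End VolumeConservation.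

Theorem theorem4p4 (R : realType) (n : nat) (hd : n.+1 = 2%N \/ n.+1 = 3%N)
    (D : problem R n) (H : discrete R n) :
  admissible D -> fitted_ALE_solution D H ->
  (forall k, (k < nstep D)%N ->
     energy D H k k.+1 + 2 * dt D * \sum_(0 <= m < k.+1) dissipation D H m
     <= energy D H 0 0 + dt D * \sum_(0 <= m < k.+1) gravity_work D H m) /\
  (forall m, (m < nstep D)%N ->
     in_Pspace D H m
       (fun x => \1_(Om_minus (spos H m) (Om D)) x - omega D H m) ->
     vol (Om_minus (spos H m.+1) (Om D)) = vol (Om_minus (spos H m) (Om D))).
Proof.
move=> adm sol; split => [k kM|m mM hP]; first exact: energy_law.
apply: (volume_step adm sol mM); apply: (interface_displacement0 adm sol mM).
exact: (interface_flux0 adm sol mM hP).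
Qed.
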